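(* Let $\alpha>0$, $R>0$, $\rho>\big(\sqrt{4\alpha^2R^2+6-2\sqrt{4\alpha^2R^2+9}}\big)/\alpha$, and $r_0>R$. Then there exist constants $C_1>0$ and $a$ with $0<a<1$, independent of $N$ and $g$, such that the following holds. Let $g$ be the solution of $$\Delta g-\alpha^2g=0\ \text{ in }\Omega=B(0,R),\qquad \frac{\partial g}{\partial n}=s\ \text{ on }\partial\Omega,$$ and assume that $g$ extends (still denoted $g$), as a solution of $\Delta g-\alpha^2 g=0$, to a neighbourhood of $\overline\Omega$ containing $\{|x|\le r_0\}$, so that $g$ is bounded on $\{|x|\le r_0\}$. Then for every $N\in\mathbb N$, with $g_N$ the approximate solution of the method of fundamental solutions with $N$ points, $$\sup_{x\in\Omega}|g(x)-g_N(x)|\le C_1N^2a^N\sup_{|x|\le r_0}|g(x)|.$$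
   Context: $\mathbb N=\{1,2,\dots\}$; $\mathbb R^2$ is identified with $\mathbb C$; $\Omega=B(0,R)$ is the disk of radius $R$ centred at the origin; $0<R<\rho$; $\partial/\partial n$ is the outward normal derivative on $\partial\Omega$; $s$ is a real-valued, sufficiently smooth function on $\partial\Omega$. $K_0$ is the modified Bessel function of the second kind of order $0$. Approximate solution: for $N\in\mathbb N$ let $\omega=e^{2\pi i/N}$, charge points $y_k=\rho\,\omega^k$ ($k=1,\dots,N$), collocation points $x_j=R\,\omega^j$ ($j=1,\dots,N$). Then $$g_N(x)=\sum_{k=1}^NQ_kK_0(\alpha|x-y_k|),$$ where $Q_1,\dots,Q_N$ are determined by $\frac{\partial g_N}{\partial n}(x_j)=s(x_j)$, $j=1,\dots,N$. Under the stated condition on $\rho$ this linear system has a unique solution. *)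

(* Defs.v *)
From Stdlib Require Export Reals.
From Coquelicot Require Export Coquelicot.
Open Scope R_scope.

(* Modified Bessel function of the second kind of order 0, by its integral
   representation K_0(x) = int_0^oo exp(-x cosh t) dt, valid for x > 0. The
   value for x <= 0 is meaningless. *)
Definition K0 (x : R) : R :=
  RInt_gen (fun t : R => exp (- x * cosh t)) (at_point 0) (Rbar_locally p_infty).

(* Points of the plane are complex numbers; [curry_C] gives a function of the
   plane as a function of two real coordinates. *)
Definition curry_C (f : C -> R) : R -> R -> R := fun u v => f (u, v).

Definition laplacian (f : C -> R) (x : C) : R :=
  partial_derive 2 0 (curry_C f) (fst x) (snd x)
  + partial_derive 0 2 (curry_C f) (fst x) (snd x).

(* Classical (C^2) solution of  Delta f - alpha^2 f = 0  on U. *)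
Definition helmholtz_solution (alpha : R) (U : C -> Prop) (f : C -> R) : Prop :=
  forall x : C, U x ->
    ex_diff_n (curry_C f) 2 (fst x) (snd x) /\
    laplacian f x - alpha ^ 2 * f x = 0.

(* The outward unit normal of a circle centred at 0 is x / |x| at its point x. *)
Definition is_normal_derivative (f : C -> R) (x : C) (l : R) : Prop :=
  is_derive (fun t : R => f (x + RtoC (t / Cmod x) * x)%C) 0 l.

(* exp (2 i pi / N) *)
Definition omega (N : nat) : C := (cos (2 * PI / INR N), sin (2 * PI / INR N)).

(* The points radius * omega^k; k ranges over 1..N. *)
Definition circle_point (radius : R) (N k : nat) : C :=
  (RtoC radius * omega N ^ k)%C.

Definition mfs_approx (alpha rho : R) (N : nat) (Q : nat -> R) (x : C) : R :=
  sum_n_m (fun k => Q k * K0 (alpha * Cmod (x - circle_point rho N k)%C)) 1 N.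

Definition collocation (alpha r rho : R) (s : C -> R) (N : nat)
    (Q : nat -> R) : Prop :=
  forall j : nat, (1 <= j <= N)%nat ->
    is_normal_derivative (mfs_approx alpha rho N Q) (circle_point r N j)
      (s (circle_point r N j)).

(* The supremum of |f| on D, with value +oo when f is unbounded on D. *)
Definition sup_norm (D : C -> Prop) (f : C -> R) : Rbar :=
  Lub_Rbar (fun v : R => exists x : C, D x /\ v = Rabs (f x)).

(* Main.v *)
Require Import Defs.
From Stdlib Require Import Lra Lia ZArith Classical.
From Stdlib Require Import ssreflect.

(** On every circle around the origin a solution of the modified Helmholtz
equation expands in the modes I_m (alpha t) cos (m th), I_m (alpha t) sin (m th),
and the method of fundamental solutions sees these modes only through their
values at the N nodes, where two modes m and p agree up to sign if
m = p or m = -p modulo N, and are orthogonal otherwise.  The error is therefore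
pure aliasing, and it is small because both the coefficients of g and those of
the fundamental solution decay geometrically.

Mode expansions.  The m-th Fourier coefficient h of a solution on the circle
of radius t solves the modified Bessel equation in t and stays bounded at the
centre; the Wronskian t (h' u - h u') with u = I_m (alpha t) is constant and
tends to 0 with t, so h is a multiple of u ([coef_bessel]).  Dirichlet's theorem
([fourier_sum]) turns this into convergent expansions of the solution and of
its radial derivative ([polar_expansion]).  This applies to g and equally to
x |-> K_0 (alpha |x - y|) inside the circle through y ([source_polar_solution]).

Coefficients of the source.  With y = (rho, 0), Graf's formula says that they
are multiples of K_m (alpha rho).  Only three consequences matter: they are
positive, they satisfy the three-term recurrence of K_m, and hence the
products k_m I_m (alpha r), r < rho, are eventually dominated by a geometric
sequence of ratio as close to r / rho as desired.  The recurrence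
([source_coef_rec]) is read off from the rotational symmetry of the source
about y, and positivity ([source_coef_pos]) follows from it by induction, the
first two coefficients being integrals of K_0 > 0 and of -K_0' > 0.

Aliasing.  Let d_m > 0 be the normal derivative at radius r of the mode
I_m (alpha t), A_m the coefficients of g and P_m = sum_k Q_k cos (m th_k), or with
sin.  Projecting the collocation equations on a mode p <= N/2 gives a linear
relation between A_m and k_m P_m over the alias class of p.  In this relation
every k_m d_m P_m appears as P_p times a nonnegative weight, because P_m and the
value of the mode at the nodes change sign together.  No cancellation occurs:
this bounds P_p ([source_part_bound_low]) without any knowledge of the inverse
of the linear system.  The relation then bounds A_p - k_p P_p by the tail of the
class, which starts at index N - p ([aliased_mode_error_bound]).  Summation over
the modes yields an error of order a^N <= N^2 a^N ([uniform_error]). *)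

(** * Integrals over a period *)

Lemma is_derive_Rplus (f g : R -> R) (x a b : R) : is_derive f x a -> is_derive g x b ->
  is_derive (fun t => f t + g t) x (a + b).
Proof. exact: (@is_derive_plus R_AbsRing R_NormedModule). Qed.
Lemma is_derive_Rminus (f g : R -> R) (x a b : R) : is_derive f x a -> is_derive g x b ->
  is_derive (fun t => f t - g t) x (a - b).
Proof. exact: (@is_derive_minus R_AbsRing R_NormedModule). Qed.
Lemma is_derive_Rmult (f g : R -> R) (x a b : R) : is_derive f x a -> is_derive g x b ->
  is_derive (fun t => f t * g t) x (a * g x + f x * b).
Proof. move=> Hf Hg; exact: (@is_derive_mult R_AbsRing _ _ _ _ _ Hf Hg Rmult_comm). Qed.
Lemma is_derive_Rcomp (f g : R -> R) (x a b : R) : is_derive f (g x) a -> is_derive g x b ->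
  is_derive (fun t => f (g t)) x (b * a).
Proof. exact: (@is_derive_comp R_AbsRing R_NormedModule). Qed.
Lemma is_derive_eq (f : R -> R) (x a b : R) : is_derive f x a -> a = b -> is_derive f x b.
Proof. by move=> H <-. Qed.

Definition circle_cont (f : R -> R) := forall t, -PI <= t <= PI -> continuous f t.
Definition circle_int (f : R -> R) : R := RInt f (-PI) PI.

Lemma opp_PI_le_PI : -PI <= PI. Proof. have := PI_RGT_0; lra. Qed.

Lemma circle_cont_ex_RInt (f : R -> R) : circle_cont f -> ex_RInt f (-PI) PI.
Proof.
move=> H; apply: (@ex_RInt_continuous R_CompleteNormedModule) => z.
rewrite Rmin_left ?Rmax_right; try exact: opp_PI_le_PI. exact: H.
Qed.

Lemma circle_cont_plus f g : circle_cont f -> circle_cont g -> circle_cont (fun t => f t + g t).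
Proof. move=> Hf Hg t Ht; apply: (@continuous_plus _ R_AbsRing R_NormedModule); [exact: Hf|exact: Hg]. Qed.
Lemma circle_cont_minus f g : circle_cont f -> circle_cont g -> circle_cont (fun t => f t - g t).
Proof. move=> Hf Hg t Ht; apply: (@continuous_minus _ R_AbsRing R_NormedModule); [exact: Hf|exact: Hg]. Qed.
Lemma circle_cont_mult f g : circle_cont f -> circle_cont g -> circle_cont (fun t => f t * g t).
Proof. move=> Hf Hg t Ht; apply: (@continuous_mult _ R_AbsRing); [exact: Hf|exact: Hg]. Qed.
Lemma circle_cont_const c : circle_cont (fun _ => c).
Proof. move=> t Ht; exact: continuous_const. Qed.
Lemma ex_derive_circle_cont f : (forall t, ex_derive f t) -> circle_cont f.
Proof. move=> H t _; apply: (@ex_derive_continuous R_AbsRing R_NormedModule). exact: H. Qed.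

Lemma circle_int_plus f g : circle_cont f -> circle_cont g -> circle_int (fun t => f t + g t) = circle_int f + circle_int g.
Proof. move=> Hf Hg; apply: (@RInt_plus R_CompleteNormedModule); exact: circle_cont_ex_RInt. Qed.
Lemma circle_int_minus f g : circle_cont f -> circle_cont g -> circle_int (fun t => f t - g t) = circle_int f - circle_int g.
Proof. move=> Hf Hg; apply: (@RInt_minus R_CompleteNormedModule); exact: circle_cont_ex_RInt. Qed.
Lemma circle_int_scal c f : circle_cont f -> circle_int (fun t => c * f t) = c * circle_int f.
Proof. move=> Hf; apply: (@RInt_scal R_CompleteNormedModule); exact: circle_cont_ex_RInt. Qed.
Lemma circle_int_ext f g : (forall t, -PI < t < PI -> f t = g t) -> circle_int f = circle_int g.
Proof.
move=> H; apply: RInt_ext => t.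
rewrite Rmin_left ?Rmax_right; try exact: opp_PI_le_PI. exact: H.
Qed.

Lemma circle_int_ge0 f : circle_cont f -> (forall t, -PI < t < PI -> 0 <= f t) -> 0 <= circle_int f.
Proof. move=> Hf H; apply: RInt_ge_0 => //; [exact: opp_PI_le_PI|exact: circle_cont_ex_RInt]. Qed.

Lemma circle_int_le_const f M : circle_cont f -> (forall t, -PI <= t <= PI -> Rabs (f t) <= M) ->
  Rabs (circle_int f) <= 2 * PI * M.
Proof.
move=> Hf H. have -> : 2 * PI * M = (PI - - PI) * M by ring.
apply: abs_RInt_le_const => //; [exact: opp_PI_le_PI|exact: circle_cont_ex_RInt].
Qed.

Lemma circle_int_derive f df : (forall t, is_derive f t (df t)) -> circle_cont df ->
  circle_int df = f PI - f (- PI).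
Proof.
move=> H Hc. apply: is_RInt_unique.
apply: (@is_RInt_derive R_CompleteNormedModule) => t.
- move=> _; exact: H.
- rewrite Rmin_left ?Rmax_right; try exact: opp_PI_le_PI. exact: Hc.
Qed.

Lemma circle_int_cos (l : Z) : circle_int (fun t => cos (IZR l * t)) = if Z.eqb l 0 then 2 * PI else 0.
Proof.
case: (Z.eqb_spec l 0) => [->|Hl].
- rewrite (circle_int_ext _ (fun _ => 1)); last by move=> t _; rewrite Rmult_0_l cos_0.
  rewrite /circle_int RInt_const /scal /= /mult /=; ring.
- have Hl' : IZR l <> 0 by move/eq_IZR.
  rewrite (circle_int_derive (fun t => sin (IZR l * t) / IZR l)).
  + have S0 : sin (IZR l * PI) = 0 by apply: sin_eq_0_1; exists l.
    have -> : IZR l * - PI = - (IZR l * PI) by ring.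
    rewrite sin_neg S0; field; exact: Hl'.
  + move=> t; auto_derive => //. by field.
  + apply: ex_derive_circle_cont => t; auto_derive; by [].
Qed.

(** * Pointwise convergence of Fourier series *)

(** The numerator of the Dirichlet kernel. *)
Definition half_sin (n : nat) (t : R) := sin ((INR n + / 2) * t).

Lemma half_sin_continuous n : circle_cont (half_sin n).
Proof. apply: ex_derive_circle_cont => t; rewrite /half_sin; auto_derive; by []. Qed.

Lemma half_sin_orthogonal j k : circle_int (fun t => half_sin j t * half_sin k t) = if Nat.eqb j k then PI else 0.
Proof.
have E : forall t, half_sin j t * half_sin k t =
  / 2 * (cos (IZR (Z.of_nat j - Z.of_nat k) * t) - cos (IZR (Z.of_nat j + Z.of_nat k + 1) * t)).
  move=> t; rewrite /half_sin minus_IZR !plus_IZR -!INR_IZR_INZ.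
  set a := (INR j + _) * t; set b := (INR k + _) * t.
  have -> : (INR j - INR k) * t = a - b by rewrite /a /b; field.
  have -> : (INR j + INR k + 1) * t = a + b by rewrite /a /b; field.
  rewrite cos_minus cos_plus; field.
rewrite (circle_int_ext _ _ (fun t _ => E t)).
have C : forall l, circle_cont (fun t => cos (IZR l * t)) by move=> l; apply: ex_derive_circle_cont => t; auto_derive.
rewrite circle_int_scal; last by apply: circle_cont_minus; exact: C.
rewrite circle_int_minus; try exact: C.
rewrite !circle_int_cos.
have -> : (Z.of_nat j + Z.of_nat k + 1 =? 0)%Z = false by apply/Z.eqb_neq; lia.
have -> : (Z.of_nat j - Z.of_nat k =? 0)%Z = Nat.eqb j k.
  case: (Nat.eqb_spec j k) => H; [apply/Z.eqb_eq|apply/Z.eqb_neq]; lia.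
case: (Nat.eqb j k); field.
Qed.

(** Bessel's identity: [rn] is [q] minus its projection on the first [n]
functions of the orthogonal family, and its square integral is what these
projections leave of that of [q].  The middle clause carries the
induction: the later coefficients of [rn] are still those of [q]. *)
Lemma bessel_residual (q : R -> R) : circle_cont q ->
  forall n, exists rn : R -> R, circle_cont rn /\
   (forall j, (n <= j)%nat -> circle_int (fun t => rn t * half_sin j t) = circle_int (fun t => q t * half_sin j t)) /\
   circle_int (fun t => rn t * rn t) =
     circle_int (fun t => q t * q t) -
     match n with O => 0 | S n' => sum_n (fun k => (circle_int (fun t => q t * half_sin k t)) ^ 2 / PI) n' end.
Proof.
move=> Hq; elim => [|n [rn [Hc [Ho Hn]]]].
  exists q; split => //; split => //. ring.
set c := fun k => circle_int (fun t => q t * half_sin k t).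
have Hpi := PI_RGT_0.
exists (fun t => rn t - c n / PI * half_sin n t).
have Hs : forall k, circle_cont (half_sin k) by exact: half_sin_continuous.
have C0 : circle_cont (fun t => c n / PI * half_sin n t) by apply: circle_cont_mult => //; exact: circle_cont_const.
split; [exact: circle_cont_minus|split].
- move=> j Hj.
  rewrite (circle_int_ext _ (fun t => rn t * half_sin j t - c n / PI * (half_sin n t * half_sin j t))); last by move=> t _; ring.
  rewrite circle_int_minus; try (by apply: circle_cont_mult); last by apply: circle_cont_mult; [exact: circle_cont_const|apply: circle_cont_mult].
  rewrite circle_int_scal; last by apply: circle_cont_mult.
  rewrite half_sin_orthogonal Ho; last lia.
  have -> : Nat.eqb n j = false by apply/Nat.eqb_neq; lia.
  ring.
- rewrite (circle_int_ext _ (fun t => rn t * rn t - 2 * (c n / PI) * (rn t * half_sin n t) + (c n / PI)^2 * (half_sin n t * half_sin n t))); last by move=> t _; ring.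
  have A1 : circle_cont (fun t => rn t * rn t) by apply: circle_cont_mult.
  have A2 : circle_cont (fun t => 2 * (c n / PI) * (rn t * half_sin n t)) by apply: circle_cont_mult; [exact: circle_cont_const|exact: circle_cont_mult].
  have A3 : circle_cont (fun t => (c n / PI)^2 * (half_sin n t * half_sin n t)) by apply: circle_cont_mult; [exact: circle_cont_const|exact: circle_cont_mult].
  rewrite circle_int_plus //; last by apply: circle_cont_minus.
  rewrite circle_int_minus // !circle_int_scal; try by apply: circle_cont_mult.
  rewrite half_sin_orthogonal Nat.eqb_refl Ho // Hn -/(c n).
  case: n {Hn Ho C0 A2 A3} => [|n].
    rewrite sum_O -/(c 0%nat); field; lra.
  rewrite sum_Sn -/(c (S n)) /plus /=; field; lra.
Qed.

(** By Bessel's inequality the squares of these integrals are summable. *)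
Lemma riemann_lebesgue q : circle_cont q -> is_lim_seq (fun n => circle_int (fun t => q t * half_sin n t)) 0.
Proof.
move=> Hq. set c := fun k => circle_int (fun t => q t * half_sin k t).
have Hpi := PI_RGT_0.
have B : forall n, sum_n (fun k => c k ^ 2 / PI) n <= circle_int (fun t => q t * q t).
  (* The integral of the squared residual is nonnegative. *)
  move=> n. have [rn [Hc [_ E]]] := bessel_residual q Hq (S n).
  have : 0 <= circle_int (fun t => rn t * rn t).
    apply: circle_int_ge0; [exact: circle_cont_mult|move=> t _; nra].
  rewrite E /c; lra.
have P : forall k, 0 <= c k ^ 2 / PI.
  move=> k; apply: Rmult_le_pos; [nra|left; exact: Rinv_0_lt_compat].
have X : ex_series (fun k => c k ^ 2 / PI).
  have [l Hl] : ex_finite_lim_seq (sum_n (fun k => c k ^ 2 / PI)).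
    apply: (ex_finite_lim_seq_incr _ (circle_int (fun t => q t * q t))) => // n.
    rewrite sum_Sn /plus /=; have := P (S n); rewrite /=; lra.
  by exists l.
have L := ex_series_lim_0 _ X.
have L2 : is_lim_seq (fun n => c n ^ 2) 0.
  have := is_lim_seq_scal_l _ PI _ L. rewrite /= Rmult_0_r.
  apply: is_lim_seq_ext => n; field; lra.
apply/is_lim_seq_abs_0.
have L3 : is_lim_seq (fun n => sqrt (c n ^ 2)) (sqrt 0).
  apply: (is_lim_seq_continuous sqrt _ 0 _ L2).
  apply/continuity_pt_filterlim. exact: continuous_sqrt.
rewrite sqrt_0 in L3.
apply: is_lim_seq_ext L3 => n.
by rewrite -/(c n) -(sqrt_Rsqr_abs (c n)) /Rsqr /= Rmult_1_r.
Qed.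

Lemma circle_int_shift f th : (forall t, continuous f t) -> (forall t, f (t + 2 * PI) = f t) ->
  circle_int (fun t => f (th + t)) = circle_int f.
Proof.
move=> Hc Hp.
have ex : forall a b, ex_RInt f a b by move=> a b; apply: (@ex_RInt_continuous R_CompleteNormedModule) => z _.
have sh : forall u a b, RInt (fun t => f (u + t)) a b = RInt f (u + a) (u + b).
  move=> u a b.
  have := @RInt_comp_lin R_CompleteNormedModule f 1 u a b (ex _ _).
  rewrite !Rmult_1_l (Rplus_comm a) (Rplus_comm b) => <-.
  apply: RInt_ext => t _; rewrite /scal /= /mult /= !Rmult_1_l; by rewrite (Rplus_comm u t).
rewrite /circle_int sh.
have E1 : RInt f (th + - PI) (th + PI) =
  RInt f (th + - PI) (- PI) + RInt f (- PI) PI + RInt f PI (th + PI).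
  have A := @RInt_Chasles R_CompleteNormedModule f (th + - PI) (- PI) PI (ex _ _) (ex _ _).
  have B := @RInt_Chasles R_CompleteNormedModule f (th + - PI) PI (th + PI) (ex _ _) (ex _ _).
  by rewrite -B -A.
have E2 : RInt f PI (th + PI) = RInt f (-PI) (th + - PI).
  have -> : RInt f PI (th + PI) = RInt f (2 * PI + - PI) (2 * PI + (th + - PI)) by congr RInt; ring.
  rewrite -sh. apply: RInt_ext => t _; by rewrite Rplus_comm Hp.
have E3 : RInt f (th + - PI) (- PI) = - RInt f (-PI) (th + - PI).
  by rewrite -(@opp_RInt_swap R_CompleteNormedModule) // /opp /= ?Ropp_involutive.
rewrite E1 E2 E3; ring.
Qed.

Definition trig (b : bool) (m : nat) (t : R) := if b then cos (INR m * t) else sin (INR m * t).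
Definition fourier_coef (b : bool) (m : nat) (f : R -> R) := / PI * circle_int (fun t => f t * trig b m t).
(** The coefficients below are all normalised by 1 / pi, so the constant mode
enters a Fourier series with weight one half. *)
Definition mode_weight (m : nat) : R := match m with O => / 2 | S _ => 1 end.
Definition fourier_term f m th :=
  mode_weight m * (fourier_coef true m f * trig true m th + fourier_coef false m f * trig false m th).
Definition dirichlet n t := sum_n (fun m => mode_weight m * cos (INR m * t)) n.

Definition dtrig (b : bool) (m : nat) (t : R) :=
  if b then - INR m * trig false m t else INR m * trig true m t.

Lemma trig_derive b m t : is_derive (trig b m) t (dtrig b m t).
Proof. case: b; rewrite /dtrig /trig; auto_derive => //; ring. Qed.

Lemma dtrig_derive b m t : is_derive (dtrig b m) t (- INR m ^ 2 * trig b m t).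
Proof. case: b; rewrite /dtrig /trig; auto_derive => //; ring. Qed.
Lemma trig_continuous b m t : continuous (trig b m) t.
Proof. apply: (@ex_derive_continuous R_AbsRing R_NormedModule). eexists; exact: trig_derive. Qed.
Lemma trig_circle_cont b m : circle_cont (trig b m). Proof. move=> t _; exact: trig_continuous. Qed.
Lemma trig_bound b m t : Rabs (trig b m t) <= 1.
Proof. apply: Rabs_le; case: b; [exact: COS_bound|exact: SIN_bound]. Qed.

Lemma dirichlet_S n t : dirichlet (S n) t = dirichlet n t + mode_weight (S n) * cos (INR (S n) * t).
Proof. by rewrite /dirichlet sum_Sn. Qed.

Lemma dirichlet_continuous n : circle_cont (dirichlet n).
Proof.
elim: n => [|n IH].
  apply: ex_derive_circle_cont => t; rewrite /dirichlet.
  apply: (ex_derive_ext (fun t => mode_weight 0 * cos (INR 0 * t))); first by move=> s; rewrite sum_O.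
  auto_derive; by [].
move=> t Ht.
apply: (continuous_ext (fun t => dirichlet n t + mode_weight (S n) * cos (INR (S n) * t))).
  move=> s; by rewrite /dirichlet sum_Sn.
apply: (@continuous_plus _ R_AbsRing R_NormedModule); first exact: IH.
apply: (@ex_derive_continuous R_AbsRing R_NormedModule); auto_derive; by [].
Qed.

(** The sum telescopes after multiplication by 2 sin (t / 2), and stating the
product avoids the removable singularity at 0. *)
Lemma dirichlet_closed_form n t : 2 * sin (t / 2) * dirichlet n t = half_sin n t.
Proof.
rewrite /dirichlet /half_sin; elim: n => [|n IH].
  rewrite sum_O /= Rmult_0_l cos_0. have -> : (0 + / 2) * t = t / 2 by field. field.
rewrite sum_Sn /plus [mode_weight (S n)]/= Rmult_plus_distr_l IH S_INR Rmult_1_l.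
set a := INR n.
have -> : (a + / 2) * t = (a + 1) * t - t / 2 by field.
have -> : (a + 1 + / 2) * t = (a + 1) * t + t / 2 by field.
rewrite sin_plus sin_minus; ring.
Qed.

Lemma dirichlet_int n : circle_int (dirichlet n) = PI.
Proof.
rewrite /dirichlet; elim: n => [|n IH].
  rewrite (circle_int_ext _ (fun _ => / 2)); last first.
    by move=> t _; rewrite sum_O /= Rmult_0_l cos_0 Rmult_1_r.
  rewrite /circle_int RInt_const /scal /= /mult /=; field.
rewrite (circle_int_ext _ (fun t => dirichlet n t + cos (IZR (Z.of_nat (S n)) * t))); last first.
  move=> t _; by rewrite sum_Sn -INR_IZR_INZ /plus [mode_weight (S n)]/= Rmult_1_l.
rewrite circle_int_plus; [|exact: dirichlet_continuous|by apply: ex_derive_circle_cont => t; auto_derive].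
rewrite circle_int_cos /= IH; ring.
Qed.

Lemma fourier_term_sum f th n : circle_cont f ->
  sum_n (fun m => fourier_term f m th) n = / PI * circle_int (fun t => f t * dirichlet n (t - th)).
Proof.
move=> Hf.
have T : forall m, fourier_term f m th = / PI * circle_int (fun t => f t * (mode_weight m * cos (INR m * (t - th)))).
  move=> m; rewrite /fourier_term /fourier_coef.
  rewrite (circle_int_ext (fun t => f t * (mode_weight m * cos (INR m * (t - th))))
    (fun t => (mode_weight m * trig true m th) * (f t * trig true m t) + (mode_weight m * trig false m th) * (f t * trig false m t))).
    rewrite circle_int_plus ?circle_int_scal; try (apply: circle_cont_mult => //; exact: trig_circle_cont);
     try (apply: circle_cont_mult; [exact: circle_cont_const|apply: circle_cont_mult => //; exact: trig_circle_cont]).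
    ring.
  move=> t _; rewrite /trig.
  have -> : INR m * (t - th) = INR m * t - INR m * th by ring.
  rewrite cos_minus; ring.
have Cc : forall m, circle_cont (fun t => f t * (mode_weight m * cos (INR m * (t - th)))).
  move=> m; apply: circle_cont_mult => //; apply: ex_derive_circle_cont => t; auto_derive; by [].
have Cd : forall m, circle_cont (fun t => f t * dirichlet m (t - th)).
  elim => [|m IH].
    move=> t Ht. apply: continuous_ext; last exact: (Cc 0%nat).
    by move=> s; rewrite /dirichlet sum_O.
  move=> t Ht.
  apply: (continuous_ext (fun t => f t * dirichlet m (t - th) + f t * (mode_weight (S m) * cos (INR (S m) * (t - th))))).
    by move=> s; rewrite dirichlet_S Rmult_plus_distr_l.
  apply: (circle_cont_plus _ _ IH (Cc (S m))); exact: Ht.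
elim: n => [|n IH].
  rewrite sum_O T; congr (_ * _); apply: circle_int_ext => t _; by rewrite /dirichlet sum_O.
rewrite sum_Sn IH T.
transitivity (/ PI * (circle_int (fun t => f t * dirichlet n (t - th)) + circle_int (fun t => f t * (mode_weight (S n) * cos (INR (S n) * (t - th)))))).
  by rewrite Rmult_plus_distr_l.
rewrite -circle_int_plus //; congr (_ * _); apply: circle_int_ext => t _. by rewrite dirichlet_S Rmult_plus_distr_l.
Qed.

Lemma slope_limit f l : is_derive f 0 l -> f 0 = 0 -> is_lim (fun t => f t / t) 0 l.
Proof.
move=> /is_derive_Reals H H0; apply/is_lim_spec => eps.
have [d Hd] := H eps (cond_pos eps).
exists d => t Ht Hn.
have := Hd t Hn. rewrite Rplus_0_l H0 Rminus_0_r; apply.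
move: Ht; rewrite /ball /= /AbsRing_ball /abs /= /minus /plus /opp /=.
by rewrite Ropp_0 Rplus_0_r.
Qed.

Lemma is_lim_continuous f (x : R) : is_lim f x (f x) -> continuous f x.
Proof.
move=> /is_lim_spec H. apply/filterlim_locally => eps.
case: (H eps : locally x (fun y => y <> x -> Rabs (f y - f x) < eps)) => d Hd; exists d => y Hy.
case: (Req_dec_T y x) => [->|Hn]; first exact: ball_center.
exact: Hd.
Qed.

(** Dirichlet's argument: the error is the integral of the difference
quotient (f (th + t) - f th) / (2 sin (t / 2)) against half-integer sines.  The
quotient extends continuously to t = 0 because [f] is differentiable at
[th], so the integral tends to 0 by the Riemann-Lebesgue lemma. *)
Theorem fourier_sum f th : (forall t, continuous f t) ->
  (forall t, f (t + 2 * PI) = f t) -> ex_derive f th ->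
  is_series (fun m => fourier_term f m th) (f th).
Proof.
move=> Hc Hp [l Hl]. have Hpi := PI_RGT_0.
have cf : circle_cont f by move=> t _.
pose A t := f (th + t) - f th.
have Ac : forall t, continuous A t.
  move=> t; apply: (@continuous_minus _ R_AbsRing R_NormedModule); last exact: continuous_const.
  apply: continuous_comp; last exact: Hc.
  apply: (@ex_derive_continuous R_AbsRing R_NormedModule); auto_derive; by [].
have A0 : A 0 = 0 by rewrite /A Rplus_0_r; ring.
have dA : is_derive A 0 l.
  rewrite /A. 
  have := @is_derive_comp R_AbsRing R_NormedModule f (fun t => th + t) 0 l 1.
  rewrite Rplus_0_r scal_one => X.
  have Y := X Hl ltac:(auto_derive; [by []|by ring]).
  have Z := @is_derive_minus R_AbsRing R_NormedModule _ (fun _ => f th) 0 _ 0 Y (is_derive_const _ _).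
  move: Z; by rewrite minus_zero_r.
pose B t := 2 * sin (t / 2).
have Bc : forall t, continuous B t.
  move=> t; apply: (@ex_derive_continuous R_AbsRing R_NormedModule); rewrite /B; auto_derive; by [].
have B0 : B 0 = 0 by rewrite /B /Rdiv Rmult_0_l sin_0; ring.
have dB : is_derive B 0 1.
  rewrite /B; auto_derive => //. rewrite Rmult_0_l cos_0; field.
pose q t := match Req_dec_T t 0 with left _ => l | right _ => A t / B t end.
have Bn : forall t, -PI <= t <= PI -> t <> 0 -> B t <> 0.
  move=> t Ht Hn; rewrite /B => H.
  have [H'|H'] : t < 0 \/ 0 < t by lra.
  - have := sin_gt_0 (- (t / 2)) ltac:(lra) ltac:(lra). rewrite sin_neg; lra.
  - have := sin_gt_0 (t / 2) ltac:(lra) ltac:(lra); lra.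
have qc : circle_cont q.
  move=> t Ht. case: (Req_dec_T t 0) => [E|E].
  - rewrite E; apply: is_lim_continuous.
    have -> : q 0 = l by rewrite /q; case: Req_dec_T.
    have L := is_lim_div _ _ 0 _ _ (slope_limit _ _ dA A0) (slope_limit _ _ dB B0).
    have L' : is_lim (fun y => A y / y / (B y / y)) 0 l.
      move: L; rewrite /= Rinv_1 Rmult_1_r; apply => //; case; lra.
    apply: is_lim_ext_loc L'.
    exists (mkposreal _ Hpi) => y Hy Hn.
    have Hy' : -PI <= y <= PI.
      move: Hy; rewrite /ball /= /AbsRing_ball /abs /= /minus /plus /opp /= Ropp_0 Rplus_0_r => /Rabs_def2; lra.
    rewrite /q; case: Req_dec_T => // _. have := Bn y Hy' Hn => ?. by field.
  - apply: (continuous_ext_loc _ (fun t => A t / B t)).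
      exists (mkposreal _ (Rabs_pos_lt _ E)) => y Hy.
      rewrite /q; case: Req_dec_T => // E'. exfalso; move: Hy.
      rewrite E' /ball /= /AbsRing_ball /abs /= /minus /plus /opp /= Rplus_0_l Rabs_Ropp; lra.
    apply: (@continuous_mult _ R_AbsRing) => //.
    apply: continuous_comp; first exact: Bc.
    apply: continuous_Rinv; exact: Bn.
have P : forall n, sum_n (fun m => fourier_term f m th) n - f th = / PI * circle_int (fun t => q t * half_sin n t).
  move=> n; rewrite fourier_term_sum //.
  have S : circle_int (fun t => f t * dirichlet n (t - th)) = circle_int (fun t => f (th + t) * dirichlet n t).
    rewrite -(circle_int_shift (fun t => f t * dirichlet n (t - th)) th).
    - apply: circle_int_ext => t _. by have -> : th + t - th = t by ring.
    - move=> t; apply: (@continuous_mult _ R_AbsRing) => //.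
      apply: (@ex_derive_continuous R_AbsRing R_NormedModule).
      elim: n => [|n IH].
        apply: (ex_derive_ext (fun t => mode_weight 0 * cos (INR 0 * (t - th)))); first by move=> s; rewrite /dirichlet sum_O.
        auto_derive; by [].
      apply: (ex_derive_ext (fun t => dirichlet n (t - th) + mode_weight (S n) * cos (INR (S n) * (t - th)))).
        by move=> s; rewrite dirichlet_S.
      apply: (@ex_derive_plus R_AbsRing R_NormedModule) => //; auto_derive; by [].
    - move=> t; rewrite Hp; congr (_ * _).
      have -> : t + 2 * PI - th = (t - th) + 2 * PI by ring.
      elim: n => [|n IH]; first by rewrite /dirichlet !sum_O /= !Rmult_0_l.
      rewrite !dirichlet_S IH; congr (_ + _ * _).
      have -> : INR (S n) * (t - th + 2 * PI) = INR (S n) * (t - th) + 2 * INR (S n) * PI by ring.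
      exact: cos_period.
  rewrite S.
  have cA : circle_cont (fun t => f (th + t)).
    move=> t _; apply: continuous_comp; last exact: Hc.
    apply: (@ex_derive_continuous R_AbsRing R_NormedModule); auto_derive; by [].
  have -> : circle_int (fun t => q t * half_sin n t) = circle_int (fun t => f (th + t) * dirichlet n t - f th * dirichlet n t).
    apply: circle_int_ext => t Ht. rewrite -dirichlet_closed_form -/(B t) /q; case: Req_dec_T => E.
      rewrite E B0 Rplus_0_r; ring.
    rewrite /A; field; apply: Bn => //; lra.
  rewrite circle_int_minus ?circle_int_scal ?dirichlet_int; try exact: dirichlet_continuous; last 2 first.
  - apply: circle_cont_mult => //; exact: dirichlet_continuous.
  - apply: circle_cont_mult; [exact: circle_cont_const|exact: dirichlet_continuous].
  field; lra.
have R := is_lim_seq_scal_l _ (/ PI) _ (riemann_lebesgue q qc).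
have R2 := is_lim_seq_plus' _ _ _ _ R (is_lim_seq_const (f th)).
rewrite Rmult_0_r Rplus_0_l in R2.
apply: (is_lim_seq_ext _ _ _ _ R2) => n. by rewrite -P Rplus_comm Rplus_minus.
Qed.

(** * The function K_0 and its derivatives *)

Notation is_tail_int f l := (is_RInt_gen f (at_point 0) (Rbar_locally p_infty) l).

(** Between two bounds a <= b the integral of [f] is at most
C (exp (-a) - exp (-b)), which gives the Cauchy criterion at infinity. *)
Lemma tail_int_exists (f : R -> R) C : (forall t, continuous f t) ->
  (forall t, 0 <= t -> 0 <= f t <= C * exp (- t)) ->
  exists l, is_tail_int f l.
Proof.
move=> Hc Hb.
have ex : forall a b, ex_RInt f a b.
  move=> a b; apply: (@ex_RInt_continuous R_CompleteNormedModule) => z _; exact: Hc.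
pose F T := RInt f 0 T.
have Eg : forall a b, is_RInt (fun t => C * exp (- t)) a b (C * exp (- a) - C * exp (- b)).
  move=> a b.
  have := @is_RInt_derive R_CompleteNormedModule (fun t => - (C * exp (- t))) (fun t => C * exp (- t)) a b.
  rewrite /minus /plus /opp /= Ropp_involutive Rplus_comm; apply.
  - move=> t _; auto_derive => //; ring.
  - move=> t _; apply: (@ex_derive_continuous R_AbsRing R_NormedModule); auto_derive; by [].
have step : forall a b, 0 <= a <= b -> 0 <= F b - F a <= C * exp (- a) - C * exp (- b).
  move=> a b Hab.
  have E : F b - F a = RInt f a b.
    have := @RInt_Chasles R_CompleteNormedModule f 0 a b (ex _ _) (ex _ _).
    rewrite /F => <-. rewrite /plus /=; ring.
  rewrite E; split.
    apply: RInt_ge_0 => //; [lra|move=> t Ht; apply Hb; lra].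
  rewrite -(is_RInt_unique _ _ _ _ (Eg a b)).
  apply: RInt_le => //; [lra|by eexists; exact: Eg|move=> t Ht; apply Hb; lra].
have C0 : 0 <= C.
  have := Hb 0 (Rle_refl _). rewrite Ropp_0 exp_0; lra.
have [l Hl] : exists l, filterlim F (Rbar_locally p_infty) (locally l).
  apply/filterlim_locally_cauchy => eps.
  have e0 := cond_pos eps.
  (* Since u exp (-u) <= 1, beyond this bound C exp (-u) is below eps. *)
  pose A := Rmax 0 (C / eps).
  exists (fun T => A < T); split; first by exists A.
  have key : forall u v, A < u -> u <= v -> Rabs (F v - F u) < eps.
    move=> u v Hu Huv.
    have Au := Rmax_l 0 (C / eps). have Au' := Rmax_r 0 (C / eps).
    rewrite -/A in Au Au'.
    have [S1 S2] := step u v ltac:(lra).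
    rewrite Rabs_pos_eq //. apply: Rle_lt_trans S2 _.
    have ev := exp_pos (- v).
    apply: (Rle_lt_trans _ (C * exp (- u))); first by nra.
    have X : C < eps * u.
      have : eps * (C / eps) < eps * u by apply: Rmult_lt_compat_l; lra.
      have -> : eps * (C / eps) = C by field; lra. by [].
    have Y : u * exp (- u) <= 1.
      rewrite exp_Ropp. have := exp_ineq1 u ltac:(lra). have e1 := exp_pos u => e2.
      apply: (Rmult_le_reg_r (exp u)) => //. rewrite Rmult_assoc Rinv_l; lra.
    have eu := exp_pos (- u). nra.
  move=> u v Hu Hv; rewrite /ball /= /AbsRing_ball /abs /= /minus /plus /opp /=.
  case: (Rle_dec u v) => H.
    exact: (key u v).
  rewrite -Rabs_Ropp; have -> : - (F v + - F u) = F u - F v by ring.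
  apply: key => //; lra.
exists l => P HP.
apply: (Filter_prod _ _ _ (fun a => a = 0) (fun b => P (F b))).
- by [].
- exact: Hl.
- move=> a b -> Hb'; exists (F b); split => //.
  exact: (@RInt_correct R_CompleteNormedModule).
Qed.

(** Since exp y >= y, exp (x u) is at least (x u / (n + 1))^(n + 1). *)
Lemma pow_exp_bound n x u : 0 < x -> 0 <= u -> u ^ S n * exp (- x * u) <= (INR (S n) / x) ^ S n.
Proof.
move=> Hx Hu. have Hn : 0 < INR (S n) by apply: lt_0_INR; lia.
have E : exp (x * u) = exp (x * u / INR (S n)) ^ S n.
  rewrite -Rpower_pow ?/Rpower ?ln_exp; last exact: exp_pos.
  congr exp; field; lra.
have L : x * u / INR (S n) <= exp (x * u / INR (S n)).
  have := exp_ineq1_le (x * u / INR (S n)); lra.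
have P0 : 0 <= x * u / INR (S n).
  apply: Rmult_le_pos; [nra|left; exact: Rinv_0_lt_compat].
have L2 : (x * u / INR (S n)) ^ S n <= exp (x * u) by rewrite E; apply: pow_incr.
have -> : - x * u = - (x * u) by ring.
rewrite exp_Ropp.
have e := exp_pos (x * u).
apply: (Rmult_le_reg_r (exp (x * u))) => //.
rewrite Rmult_assoc Rinv_l ?Rmult_1_r; last lra.
apply: (Rle_trans _ ((INR (S n) / x) ^ S n * (x * u / INR (S n)) ^ S n)).
  right; rewrite -Rpow_mult_distr; congr (_ ^ _); field; lra.
apply: Rmult_le_compat_l => //. apply: pow_le.
apply: Rmult_le_pos; [lra|left; exact: Rinv_0_lt_compat].
Qed.

Lemma cosh_ge1 t : 1 <= cosh t.
Proof.
rewrite /cosh. have a := exp_pos t; have b := exp_pos (- t).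
have E : exp t * exp (- t) = 1 by rewrite -exp_plus Rplus_opp_r exp_0.
have : 0 <= (exp t - 1) ^ 2 * exp (- t) by apply: Rmult_le_pos; [exact: pow2_ge_0|lra].
have -> : (exp t - 1) ^ 2 * exp (- t) = exp t * (exp t * exp (- t)) - 2 * (exp t * exp (- t)) + exp (- t) by ring.
rewrite E; lra.
Qed.

(** The integrals of these functions are (-1)^j times the j-th derivative of
K_0.  Working with them all at once makes differentiation a shift of [j]. *)
Definition K_integrand (j : nat) (x t : R) := cosh t ^ j * exp (- x * cosh t).

Lemma K_integrand_continuous j x t : continuous (K_integrand j x) t.
Proof.
apply: (@ex_derive_continuous R_AbsRing R_NormedModule). rewrite /K_integrand /cosh; auto_derive; by [].
Qed.

(** The spare power of cosh gained in [pow_exp_bound] is traded for the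
factor exp (-t), as cosh t >= exp t / 2. *)
Lemma K_integrand_bound j x t : 0 < x -> 0 <= t ->
  0 <= K_integrand j x t <= 2 * (INR (S j) / x) ^ S j * exp (- t).
Proof.
move=> Hx Ht. have c1 := cosh_ge1 t. split.
  apply: Rmult_le_pos; [apply: pow_le; lra|left; exact: exp_pos].
have B := pow_exp_bound j x (cosh t) Hx ltac:(lra).
have D : 1 <= 2 * exp (- t) * cosh t.
  rewrite /cosh. have E : exp t * exp (- t) = 1 by rewrite -exp_plus Rplus_opp_r exp_0.
  have := exp_pos (- t); nra.
have p0 : 0 <= K_integrand j x t.
  apply: Rmult_le_pos; [apply: pow_le; lra|left; exact: exp_pos].
apply: (Rle_trans _ (K_integrand j x t * (2 * exp (- t) * cosh t))); first by nra.
have -> : K_integrand j x t * (2 * exp (- t) * cosh t) = 2 * exp (- t) * (cosh t ^ S j * exp (- x * cosh t)).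
  rewrite /K_integrand /=; ring.
have := exp_pos (- t) => e. nra.
Qed.

Definition K_moment (j : nat) (x : R) : R :=
  RInt_gen (K_integrand j x) (at_point 0) (Rbar_locally p_infty).

Lemma K_moment_correct j x : 0 < x -> is_tail_int (K_integrand j x) (K_moment j x).
Proof.
move=> Hx.
have [|t Ht|l Hl] := tail_int_exists (K_integrand j x) (2 * (INR (S j) / x) ^ S j).
- exact: K_integrand_continuous.
- exact: K_integrand_bound.
- by rewrite /K_moment (is_RInt_gen_unique _ _ Hl).
Qed.

Lemma tail_filter_forall (P : R -> Prop) : (forall t, 0 <= t -> P t) ->
  filter_prod (at_point 0) (Rbar_locally p_infty)
    (fun ab => forall t, fst ab <= t <= snd ab -> P t).
Proof.
move=> H; apply: (Filter_prod _ _ _ (fun a => a = 0) (fun _ => True)) => //.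
- exists 0; by [].
- move=> a b -> _ t /= Ht; apply: H; lra.
Qed.

Lemma tail_filter_le : filter_prod (at_point 0) (Rbar_locally p_infty) (fun ab => fst ab <= snd ab).
Proof.
apply: (Filter_prod _ _ _ (fun a => a = 0) (fun b => 0 < b)) => //.
- by exists 0.
- move=> a b -> /=; lra.
Qed.

Lemma tail_int_ext (f g : R -> R) l : (forall t, f t = g t) -> is_tail_int f l -> is_tail_int g l.
Proof.
move=> E H. refine (@is_RInt_gen_ext R_NormedModule _ _ _ _ f g l _ H).
apply: (Filter_prod _ _ _ (fun a => a = 0) (fun _ => True)) => //; by exists 0.
Qed.
Lemma tail_int_minus (f g : R -> R) lf lg : is_tail_int f lf -> is_tail_int g lg ->
  is_tail_int (fun t => f t - g t) (lf - lg).
Proof. move=> Hf Hg; exact: (@is_RInt_gen_minus R_NormedModule). Qed.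
Lemma tail_int_plus (f g : R -> R) lf lg : is_tail_int f lf -> is_tail_int g lg ->
  is_tail_int (fun t => f t + g t) (lf + lg).
Proof. move=> Hf Hg; exact: (@is_RInt_gen_plus R_NormedModule). Qed.
Lemma tail_int_scal (f : R -> R) c lf : is_tail_int f lf ->
  is_tail_int (fun t => c * f t) (c * lf).
Proof. move=> Hf; exact: (@is_RInt_gen_scal R_NormedModule). Qed.

Lemma tail_int_norm (f g : R -> R) lf lg : (forall t, 0 <= t -> Rabs (f t) <= g t) ->
  is_tail_int f lf -> is_tail_int g lg -> Rabs lf <= lg.
Proof.
move=> H Hf Hg.
apply: (@RInt_gen_norm R_CompleteNormedModule _ _ _ _ f g lf lg tail_filter_le _ Hf Hg).
exact: tail_filter_forall.
Qed.

Lemma tail_int_le (f g : R -> R) lf lg : (forall t, 0 <= t -> f t <= g t) ->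
  is_tail_int f lf -> is_tail_int g lg -> lf <= lg.
Proof.
move=> H Hf Hg.
have D := tail_int_minus _ _ _ _ Hg Hf.
have := tail_int_norm _ _ _ _ _ D D. move=> X.
have : Rabs (lg - lf) <= lg - lf.
  apply: X => t Ht; rewrite Rabs_pos_eq; have := H t Ht; lra.
have := Rabs_pos (lg - lf); lra.
Qed.

(** A one-sided consequence of exp s >= 1 + s, applied to s and to -s; the
second-order remainder is what makes [K_moment_derive] work under the
integral sign. *)
Lemma exp_taylor1 s : Rabs (exp s - 1 - s) <= s ^ 2 * exp (Rabs s).
Proof.
have L := exp_ineq1_le s. have L' := exp_ineq1_le (- s).
have E : exp s * exp (- s) = 1 by rewrite -exp_plus Rplus_opp_r exp_0.
have e := exp_pos s.
have U : exp s - 1 <= s * exp s by nra.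
rewrite Rabs_pos_eq; last lra.
case: (Rle_dec 0 s) => Hs.
  rewrite Rabs_pos_eq //; nra.
have := Rabs_pos s => as0. have := exp_ineq1_le (Rabs s); nra.
Qed.

Lemma quadratic_derive (f : R -> R) x l M d : 0 < d ->
  (forall y, Rabs (y - x) < d -> Rabs (f y - f x - (y - x) * l) <= M * (y - x) ^ 2) ->
  is_derive f x l.
Proof.
move=> Hd H. apply/is_derive_Reals => eps Heps.
have M0 : 0 < Rabs M + 1 by have := Rabs_pos M; lra.
have D : 0 < Rmin d (eps / (Rabs M + 1)).
  apply: Rmin_pos => //; exact: Rdiv_lt_0_compat.
exists (mkposreal _ D) => h Hn /= Hh.
have h1 : Rabs h < d by apply: Rlt_le_trans Hh (Rmin_l _ _).
have h2 : Rabs h < eps / (Rabs M + 1) by apply: Rlt_le_trans Hh (Rmin_r _ _).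
have := H (x + h). have -> : x + h - x = h by ring. move=> /(_ h1) B.
have -> : (f (x + h) - f x) / h - l = (f (x + h) - f x - h * l) / h by field.
have ah := Rabs_pos_lt _ Hn.
rewrite Rabs_div //. apply: (Rmult_lt_reg_r (Rabs h)) => //.
have -> : Rabs (f (x + h) - f x - h * l) / Rabs h * Rabs h = Rabs (f (x + h) - f x - h * l) by field; lra.
apply: Rle_lt_trans B _.
have -> : h ^ 2 = Rabs h * Rabs h by rewrite -Rabs_mult Rabs_pos_eq; nra.
have k : Rabs h * (Rabs M + 1) < eps.
  have : Rabs h * (Rabs M + 1) < eps / (Rabs M + 1) * (Rabs M + 1) by apply: Rmult_lt_compat_r.
  have -> : eps / (Rabs M + 1) * (Rabs M + 1) = eps by field; lra. by [].
have := Rle_abs M. nra.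
Qed.

(** The difference quotients are controlled by a quadratic remainder whose
integrand is dominated by [K_integrand] of index j + 2 at x / 2, so the
derivative passes under the integral. *)
Lemma K_moment_derive j x : 0 < x -> is_derive (K_moment j) x (- K_moment (S j) x).
Proof.
move=> Hx. apply: (quadratic_derive _ _ _ (K_moment (S (S j)) (x / 2)) (x / 2)); first lra.
move=> y Hy.
have y0 : 0 < y by move/Rabs_def2: Hy; lra.
have I1 := tail_int_minus _ _ _ _ (K_moment_correct j y y0) (K_moment_correct j x Hx).
have I2 := tail_int_scal _ (y - x) _ (K_moment_correct (S j) x Hx).
have I3 := tail_int_plus _ _ _ _ I1 I2.
have I4 := tail_int_scal _ ((y - x)^2) _ (K_moment_correct (S (S j)) (x / 2) ltac:(lra)).
have := tail_int_norm _ _ _ _ _ I3 I4.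
move=> X.
have -> : K_moment j y - K_moment j x - (y - x) * - K_moment (S j) x = K_moment j y - K_moment j x + (y - x) * K_moment (S j) x by ring.
rewrite (Rmult_comm (K_moment _ _)); apply: X => t Ht.
have c1 := cosh_ge1 t. rewrite /K_integrand. set c := cosh t in c1 *.
pose s := - (y - x) * c.
have Ey : exp (- y * c) = exp (- x * c) * exp s by rewrite -exp_plus; congr exp; rewrite /s; ring.
have -> : c ^ j * exp (- y * c) - (c ^ j * exp (- x * c)) + (y - x) * (c ^ S j * exp (- x * c))
  = c ^ j * exp (- x * c) * (exp s - 1 - s) by rewrite Ey /s /=; ring.
have cj : 0 <= c ^ j by apply: pow_le; lra.
have ex := exp_pos (- x * c).
rewrite Rabs_mult (Rabs_pos_eq (_ * _)); last by nra.
have T := exp_taylor1 s.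
have S1 : Rabs s <= x / 2 * c.
  rewrite /s Rabs_mult Rabs_Ropp (Rabs_pos_eq c); last lra.
  apply: Rmult_le_compat_r; lra.
have S2 : exp (- x * c) * exp (Rabs s) <= exp (- (x / 2) * c).
  rewrite -exp_plus. have [H|H] : - x * c + Rabs s < - (x / 2) * c \/ - x * c + Rabs s = - (x / 2) * c by lra.
    left; exact: exp_increasing.
  right; by rewrite H.
have s2 : s ^ 2 = (y - x) ^ 2 * c ^ 2 by rewrite /s; ring.
apply: (Rle_trans _ (c ^ j * exp (- x * c) * (s ^ 2 * exp (Rabs s)))).
  apply: Rmult_le_compat_l => //; nra.
rewrite s2.
have -> : c ^ j * exp (- x * c) * ((y - x) ^ 2 * c ^ 2 * exp (Rabs s)) =
  ((y - x) ^ 2 * c ^ j * c ^ 2) * (exp (- x * c) * exp (Rabs s)) by ring.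
have -> : (y - x) ^ 2 * (c ^ S (S j) * exp (- (x / 2) * c)) =
  ((y - x) ^ 2 * c ^ j * c ^ 2) * exp (- (x / 2) * c) by rewrite /=; ring.
apply: Rmult_le_compat_l => //.
apply: Rmult_le_pos; last exact: pow2_ge_0.
apply: Rmult_le_pos => //; exact: pow2_ge_0.
Qed.

Lemma K0_K_moment x : 0 < x -> K0 x = K_moment 0 x.
Proof.
move=> Hx. have H := K_moment_correct 0 x Hx.
have E : is_tail_int (fun t => exp (- x * cosh t)) (K_moment 0 x).
  apply: tail_int_ext H => t; by rewrite /K_integrand /= Rmult_1_l.
by rewrite /K0 (is_RInt_gen_unique _ _ E).
Qed.

Lemma K_moment_ge0 j x : 0 < x -> 0 <= K_moment j x.
Proof.
move=> Hx. have := tail_int_norm _ _ _ _ _ (K_moment_correct j x Hx) (K_moment_correct j x Hx).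
have := Rabs_pos (K_moment j x) => a X.
apply: Rle_trans a (X _) => t Ht.
rewrite Rabs_pos_eq; first lra.
apply: (proj1 (K_integrand_bound j x t Hx Ht)).
Qed.

Lemma exp_cosh_tail x (g : R -> R) : 0 < x -> (forall t, 0 <= t -> 0 <= g t <= cosh t) ->
  filterlim (fun t => g t * exp (- x * cosh t)) (Rbar_locally p_infty) (locally 0).
Proof.
move=> Hx Hg. pose C := 2 * (INR 2 / x) ^ 2.
apply: (filterlim_le_le (fun _ => 0) _ (fun t => C * exp (- t)) (Finite 0)).
- exists 0 => t Ht; split.
    apply: Rmult_le_pos; [apply Hg; lra|left; exact: exp_pos].
  have := proj2 (K_integrand_bound 1 x t Hx ltac:(lra)).
  rewrite -/C /K_integrand /= Rmult_1_r => H. apply: Rle_trans H.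
  apply: Rmult_le_compat_r; [left; exact: exp_pos|apply Hg; lra].
- exact: filterlim_const.
- have L : is_lim (fun t => C * exp (- t)) p_infty 0.
    have : is_lim (fun t => C * exp (- t)) p_infty (Rbar_mult C 0).
      apply: is_lim_scal_l. apply: (is_lim_comp exp (fun t => - t) p_infty 0 m_infty).
      + exact: is_lim_exp_m.
      + apply: (is_lim_opp (fun t => t) p_infty p_infty); exact: is_lim_id.
      + exists 0; by [].
    by rewrite /= Rmult_0_r.
  exact: L.
Qed.

Lemma sinh_bounds t : 0 <= t -> 0 <= sinh t <= cosh t.
Proof.
move=> Ht; rewrite /sinh /cosh; have e := exp_pos (- t).
have : exp (- t) <= exp t.
  have [H|H] : - t < t \/ - t = t by lra.
    left; exact: exp_increasing.
  by rewrite H; right.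
lra.
Qed.

Lemma cosh_sinh_sq t : cosh t ^ 2 = 1 + sinh t ^ 2.
Proof.
rewrite /sinh /cosh.
have E : exp t * exp (- t) = 1 by rewrite -exp_plus Rplus_opp_r exp_0. nra.
Qed.

Lemma tail_int_Derive (f df : R -> R) : (forall t, is_derive f t (df t)) ->
  (forall t, continuous df t) -> filterlim f (Rbar_locally p_infty) (locally 0) ->
  is_tail_int df (- f 0).
Proof.
move=> H Hc Hl.
have := @is_RInt_gen_Derive (at_point 0) (Rbar_locally p_infty) _ _ f (f 0) 0.
move=> X.
have {}X : is_tail_int (Derive f) (0 - f 0).
  apply: X => //.
  - apply: (Filter_prod _ _ _ (fun a => a = 0) (fun _ => True)) => //; first by exists 0.
    move=> a b _ _ t _; by eexists; exact: H.
  - apply: (Filter_prod _ _ _ (fun a => a = 0) (fun _ => True)) => //; first by exists 0.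
    move=> a b _ _ t _. apply: (continuous_ext df) => // s. by rewrite (is_derive_unique _ _ _ (H s)).
  - move=> P HP. exact: locally_singleton.
rewrite Rminus_0_l in X.
apply: tail_int_ext X => t; exact: is_derive_unique.
Qed.

(** The modified Bessel equation of order 0: the combination is the integral of
the derivative of - sinh t exp (-x cosh t), which vanishes at 0 and at
infinity. *)
Lemma K_moment_ode x : 0 < x -> x * K_moment 2 x - K_moment 1 x - x * K_moment 0 x = 0.
Proof.
move=> Hx.
have I1 := tail_int_scal _ x _ (K_moment_correct 2 x Hx).
have I2 := tail_int_scal _ x _ (K_moment_correct 0 x Hx).
have I3 := tail_int_minus _ _ _ _ (tail_int_minus _ _ _ _ I1 (K_moment_correct 1 x Hx)) I2.
have J := tail_int_Derive (fun t => - (sinh t * exp (- x * cosh t)))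
  (fun t => (x * sinh t ^ 2 - cosh t) * exp (- x * cosh t)).
have {}J : is_tail_int (fun t => (x * sinh t ^ 2 - cosh t) * exp (- x * cosh t)) (- - (sinh 0 * exp (- x * cosh 0))).
  apply: J.
  - move=> t; rewrite /sinh /cosh; auto_derive => //. rewrite /Rdiv; set E := exp (- x * _); field.
  - move=> t; apply: (@ex_derive_continuous R_AbsRing R_NormedModule); rewrite /sinh /cosh; auto_derive; by [].
  - have := filterlim_comp _ _ _ _ Ropp _ _ _ (exp_cosh_tail x sinh Hx sinh_bounds) (filterlim_opp (V := R_NormedModule) 0).
    by rewrite /opp /= Ropp_0.
rewrite sinh_0 Rmult_0_l !Ropp_0 in J.
rewrite -(is_RInt_gen_unique _ _ I3).
refine (is_RInt_gen_unique _ _ (tail_int_ext _ _ _ _ J)) => t.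
rewrite /K_integrand /= !Rmult_1_r.
have := cosh_sinh_sq t. rewrite /= !Rmult_1_r => ->. ring.
Qed.

(** As cosh t >= sinh t, the integral is at least that of
sinh t exp (-x cosh t), whose value is exp (-x) / x. *)
Lemma K_moment1_pos x : 0 < x -> 0 < K_moment 1 x.
Proof.
move=> Hx.
have J := tail_int_Derive (fun t => - (/ x * exp (- x * cosh t))) (fun t => sinh t * exp (- x * cosh t)).
have {}J : is_tail_int (fun t => sinh t * exp (- x * cosh t)) (- - (/ x * exp (- x * cosh 0))).
  apply: J.
  - move=> t; rewrite /sinh /cosh; auto_derive => //. rewrite /Rdiv; set E := exp (- x * _); field; lra.
  - move=> t; apply: (@ex_derive_continuous R_AbsRing R_NormedModule); rewrite /sinh /cosh; auto_derive; by [].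
  - have := exp_cosh_tail x (fun _ => 1) Hx. move=> X.
    have {}X := X ltac:(move=> t _; have := cosh_ge1 t; lra).
    have Y := filterlim_comp _ _ _ _ (fun y => (- / x) * y) _ _ _ X (filterlim_scal_r (V := R_NormedModule) (- / x) 0).
    rewrite /scal /= /mult /= Rmult_0_r in Y.
    apply: filterlim_ext Y => t; ring.
rewrite Ropp_involutive in J.
apply: Rlt_le_trans (_ : / x * exp (- x * cosh 0) <= _).
  apply: Rmult_lt_0_compat; [exact: Rinv_0_lt_compat|exact: exp_pos].
apply: tail_int_le J (K_moment_correct 1 x Hx) => t Ht.
rewrite /K_integrand /= Rmult_1_r; apply: Rmult_le_compat_r; [left; exact: exp_pos|].
exact: (proj2 (sinh_bounds t Ht)).
Qed.

(** It is nonnegative and strictly decreasing. *)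
Lemma K_moment0_pos x : 0 < x -> 0 < K_moment 0 x.
Proof.
move=> Hx.
have [c [Hc E]] : exists c, Rmin x (x + 1) <= c <= Rmax x (x + 1) /\
    K_moment 0 (x + 1) - K_moment 0 x = - K_moment 1 c * (x + 1 - x).
  apply: (MVT_gen (K_moment 0) x (x + 1) (fun y => - K_moment 1 y)) => y; rewrite Rmin_left ?Rmax_right; try lra; move=> Hy.
    apply: K_moment_derive; lra.
  apply/continuity_pt_filterlim.
  apply: (@ex_derive_continuous R_AbsRing R_NormedModule); eexists; apply: K_moment_derive; lra.
rewrite Rmin_left ?Rmax_right in Hc; try lra.
have := K_moment1_pos c ltac:(lra). have := K_moment_ge0 0 (x + 1) ltac:(lra). lra.
Qed.

(** * The modified Bessel functions I_m *)

Definition bessel_coef (m j : nat) : R := / (INR (fact j) * INR (fact (m + j))).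
Definition bessel_Phi (m : nat) (z : R) : R := PSeries (bessel_coef m) z.
(** The function I_m, written as (x / 2)^m times an entire function of
(x / 2)^2, so that its recurrences reduce to identities between power series
with nonnegative coefficients. *)
Definition BesselI (m : nat) (x : R) : R := (x / 2) ^ m * bessel_Phi m ((x / 2) ^ 2).
(** The derivative of I_m, in the form given by the recurrence
I_m' = (m / x) I_m + I_(m+1). *)
Definition BesselI_d (m : nat) (x : R) : R := INR m / x * BesselI m x + BesselI (S m) x.

Lemma bessel_coef_pos m j : 0 < bessel_coef m j.
Proof. apply: Rinv_0_lt_compat; apply: Rmult_lt_0_compat; exact: INR_fact_lt_0. Qed.

Lemma bessel_coef_radius m : CV_radius (bessel_coef m) = p_infty.
Proof.
apply: CV_radius_infinite_DAlembert; first by move=> n; apply: Rgt_not_eq; exact: bessel_coef_pos.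
apply: (is_lim_seq_le_le (fun _ => 0) _ (fun n => / INR (S n))).
- move=> n.
  have E : bessel_coef m (S n) / bessel_coef m n = / (INR (S n) * INR (m + S n)).
    rewrite /bessel_coef. have -> : (m + S n)%nat = S (m + n) by lia.
    rewrite !fact_simpl !mult_INR.
    field; repeat split; try exact: INR_fact_neq_0; apply: not_0_INR; lia.
  rewrite E. have a : 0 < INR (S n) by apply: lt_0_INR; lia.
  have b : 1 <= INR (m + S n) by apply: (le_INR 1); lia.
  rewrite Rabs_pos_eq.
    split; first by left; apply: Rinv_0_lt_compat; nra.
    apply: Rinv_le_contravar => //; nra.
  left; apply: Rinv_0_lt_compat; nra.
- exact: is_lim_seq_const.
- apply/(is_lim_seq_incr_1 (fun n => / INR n) 0).
  have := is_lim_seq_inv _ _ is_lim_seq_INR. by apply.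
Qed.

Lemma bessel_coef_inside m z : Rbar_lt (Rabs z) (CV_radius (bessel_coef m)).
Proof. by rewrite bessel_coef_radius. Qed.

Lemma bessel_Phi_derive m z : is_derive (bessel_Phi m) z (bessel_Phi (S m) z).
Proof.
have := is_derive_PSeries (bessel_coef m) z (bessel_coef_inside m z).
have -> : PSeries (PS_derive (bessel_coef m)) z = bessel_Phi (S m) z; last by [].
apply: PSeries_ext => n; rewrite /PS_derive /bessel_coef.
have -> : (m + S n)%nat = (S m + n)%nat by lia.
rewrite fact_simpl mult_INR.
field; repeat split; try exact: INR_fact_neq_0; apply: not_0_INR; lia.
Qed.

Lemma bessel_Phi_rec m z : bessel_Phi m z = INR (S m) * bessel_Phi (S m) z + z * bessel_Phi (S (S m)) z.
Proof.
rewrite /bessel_Phi -PSeries_scal -PSeries_incr_1 -PSeries_plus.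
- apply: PSeries_ext => -[|n].
  + rewrite /PS_plus /PS_scal /PS_incr_1 /bessel_coef /plus /scal /= /mult /zero /=.
    have -> : (m + 0)%nat = m by lia.
    have F := INR_fact_lt_0 m.
    rewrite plus_INR mult_INR. change (match m with 0%nat => 1 | S _ => INR m + 1 end) with (INR (S m)).
    rewrite S_INR. have := pos_INR m => P.
    field; split; nra.
  + rewrite /PS_plus /PS_scal /PS_incr_1 /bessel_coef /plus /scal [RHS]/= /mult [RHS]/=.
    have -> : (m + S n)%nat = S (m + n) by lia.
    have -> : (m + n)%nat = (n + m)%nat by lia.
    change (match m with 0%nat => 1 | S _ => INR m + 1 end) with (INR (S m)).
    change (fact (n + m) + (n + m) * fact (n + m))%nat with (fact (S (n + m))).
    change (fact n + n * fact n)%nat with (fact (S n)).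
    have -> : (fact (S (n + m)) + S (n + m) * fact (S (n + m)))%nat = fact (S (S (n + m))) by [].
    rewrite !fact_simpl !mult_INR !S_INR plus_INR.
    have := pos_INR m; have := pos_INR n => P P'.
    have F := INR_fact_neq_0 n; have F' := INR_fact_neq_0 (n + m).
    field; repeat split => //; lra.
- apply: ex_pseries_scal; first exact: Rmult_comm.
  apply: CV_radius_inside; exact: bessel_coef_inside.
- apply: ex_pseries_incr_1. apply: CV_radius_inside; exact: bessel_coef_inside.
Qed.

Lemma bessel_Phi_pos m z : 0 <= z -> 0 < bessel_Phi m z.
Proof.
move=> Hz.
have E : ex_series (fun j => bessel_coef m j * z ^ j).
  apply/ex_pseries_R; apply: CV_radius_inside; exact: bessel_coef_inside.
rewrite /bessel_Phi /PSeries Series_incr_1 //=.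
apply: Rplus_lt_le_0_compat; first by rewrite Rmult_1_r; exact: bessel_coef_pos.
have P : forall k, 0 <= bessel_coef m (S k) * (z * z ^ k).
  move=> k; apply: Rmult_le_pos; [left; exact: bessel_coef_pos|apply: Rmult_le_pos => //; exact: pow_le].
have X : ex_series (fun k => bessel_coef m (S k) * (z * z ^ k)).
  by move/ex_series_incr_1: E.
have := Series_le (fun _ => 0) _ _ X.
have -> : Series (fun _ : nat => 0) = 0.
  have S0 : Series (fun _ : nat => 0) = 0 * Series (fun _ : nat => 0).
    rewrite -Series_scal_l; apply: Series_ext => n; ring.
  by rewrite S0 Rmult_0_l.
apply => n; split; [lra|exact: P].
Qed.

Lemma bessel_Phi_mono m y z : 0 <= y <= z -> bessel_Phi m y <= bessel_Phi m z.
Proof.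
move=> H. apply: Series_le.
- move=> n; split.
    apply: Rmult_le_pos; [left; exact: bessel_coef_pos|apply: pow_le; lra].
  apply: Rmult_le_compat_l; [left; exact: bessel_coef_pos|apply: pow_incr; lra].
- apply/ex_pseries_R; apply: CV_radius_inside; exact: bessel_coef_inside.
Qed.

Lemma BesselI_pos m x : 0 < x -> 0 < BesselI m x.
Proof.
move=> Hx; apply: Rmult_lt_0_compat; first by apply: pow_lt; lra.
apply: bessel_Phi_pos; exact: pow2_ge_0.
Qed.

Lemma BesselI_rec m x : 0 < x -> BesselI m x = 2 * INR (S m) / x * BesselI (S m) x + BesselI (S (S m)) x.
Proof. move=> Hx; rewrite /BesselI bessel_Phi_rec [(_ / _) ^ S m]/= [(_ / _) ^ S (S m)]/=. field; lra. Qed.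

Lemma BesselI_derive m x : 0 < x -> is_derive (BesselI m) x (BesselI_d m x).
Proof.
move=> Hx.
have P : is_derive (fun x => bessel_Phi m ((x / 2) ^ 2)) x (x / 2 * bessel_Phi (S m) ((x / 2) ^ 2)).
  have := is_derive_comp (bessel_Phi m) (fun x => (x / 2) ^ 2) x _ _ (bessel_Phi_derive m _).
  move=> /(_ (x / 2)) H. apply: H; auto_derive => //; field.
have Q : is_derive (fun x => (x / 2) ^ m) x (INR m / x * (x / 2) ^ m).
  auto_derive => //. case: m {P} => [|m]; first by rewrite /=; field; lra.
  have E : forall y : R, y ^ S m = y * y ^ m by [].
  rewrite /Rdiv !E [Nat.pred _]/=; field; lra.
have := is_derive_mult _ _ _ _ _ Q P Rmult_comm.
rewrite /BesselI_d /BesselI /plus /mult /=.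
have -> : INR m / x * (x / 2) ^ m * bessel_Phi m (x / 2 * (x / 2 * 1)) +
  (x / 2) ^ m * (x / 2 * bessel_Phi (S m) (x / 2 * (x / 2 * 1))) =
  INR m / x * ((x / 2) ^ m * bessel_Phi m (x / 2 * (x / 2 * 1))) +
  x / 2 * (x / 2) ^ m * bessel_Phi (S m) (x / 2 * (x / 2 * 1)) by ring.
by [].
Qed.

(** The modified Bessel equation in divergence form: the function that is
differentiated is x I_m'. *)
Lemma BesselI_ode m x : 0 < x ->
  is_derive (fun x => INR m * BesselI m x + x * BesselI (S m) x) x ((INR m ^ 2 + x ^ 2) / x * BesselI m x).
Proof.
move=> Hx.
have D := is_derive_plus _ _ _ _ _ (is_derive_scal _ _ (INR m) _ (BesselI_derive m x Hx))
  (is_derive_mult _ _ _ _ _ (is_derive_id x) (BesselI_derive (S m) x Hx) Rmult_comm).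
move: D; rewrite /plus /mult /one /scal /= /BesselI_d.
have -> : (INR m ^ 2 + x ^ 2) / x * BesselI m x =
  INR m * (INR m / x * BesselI m x + BesselI (S m) x) +
  (1 * BesselI (S m) x + x * (INR (S m) / x * BesselI (S m) x + BesselI (S (S m)) x)); last by [].
have := BesselI_rec m x Hx. rewrite S_INR => E.
have -> : BesselI (S (S m)) x = BesselI m x - 2 * (INR m + 1) / x * BesselI (S m) x by rewrite E; ring.
field; lra.
Qed.

Lemma BesselI_ratio m x : 0 < x -> BesselI (S m) x <= x / (2 * INR (S m)) * BesselI m x.
Proof.
move=> Hx; rewrite (BesselI_rec m x Hx). have := BesselI_pos (S (S m)) x Hx => P.
have N : 0 < INR (S m) by apply: lt_0_INR; lia.
have -> : x / (2 * INR (S m)) * (2 * INR (S m) / x * BesselI (S m) x + BesselI (S (S m)) x) =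
  BesselI (S m) x + x / (2 * INR (S m)) * BesselI (S (S m)) x by field; lra.
have : 0 < x / (2 * INR (S m)) by apply: Rdiv_lt_0_compat; lra.
nra.
Qed.

Lemma BesselI_growth m x y : 0 < x <= y -> BesselI m x <= (x / y) ^ m * BesselI m y.
Proof.
move=> H; rewrite /BesselI.
have -> : (x / y) ^ m * ((y / 2) ^ m * bessel_Phi m ((y / 2) ^ 2)) = (x / 2) ^ m * bessel_Phi m ((y / 2) ^ 2).
  rewrite -Rmult_assoc -Rpow_mult_distr; congr (_ ^ _ * _); field; lra.
apply: Rmult_le_compat_l; first by apply: pow_le; lra.
apply: bessel_Phi_mono; split; [exact: pow2_ge_0|apply: pow_incr; lra].
Qed.

Lemma BesselI_mono m x y : 0 < x <= y -> BesselI m x <= BesselI m y.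
Proof.
move=> H; apply: Rmult_le_compat.
- apply: pow_le; lra.
- left; apply: bessel_Phi_pos; exact: pow2_ge_0.
- apply: pow_incr; lra.
- apply: bessel_Phi_mono; split; [exact: pow2_ge_0|apply: pow_incr; lra].
Qed.

(** The flux x I_m' vanishes at 0; this is the boundary term in the Wronskian
argument of [coef_bessel]. *)
Lemma BesselI_flux_lim0 m (eps : R) : 0 < eps -> exists d, 0 < d /\
  forall x, 0 < x < d -> 0 <= INR m * BesselI m x + x * BesselI (S m) x < eps.
Proof.
move=> He.
have c : continuous (fun x => INR m * BesselI m x + x * BesselI (S m) x) 0.
  have B : forall k, continuous (BesselI k) 0.
    move=> k; rewrite /BesselI. apply: (@continuous_mult _ R_AbsRing).
      apply: (@ex_derive_continuous R_AbsRing R_NormedModule); auto_derive; by [].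
    apply: (continuous_comp (fun x => (x / 2) ^ 2) (bessel_Phi k)).
      apply: (@ex_derive_continuous R_AbsRing R_NormedModule); auto_derive; by [].
    apply: (@ex_derive_continuous R_AbsRing R_NormedModule); eexists; exact: bessel_Phi_derive.
  apply: (@continuous_plus _ R_AbsRing R_NormedModule); apply: (@continuous_mult _ R_AbsRing) => //.
  exact: continuous_const.
have E : INR m * BesselI m 0 + 0 * BesselI (S m) 0 = 0.
  rewrite Rmult_0_l /BesselI; case: m {c} => [|m]; first by rewrite /=; ring.
  rewrite [(0 / 2) ^ _]/=; field.
move/filterlim_locally: c => /(_ (mkposreal _ He)) [d Hd].
exists d; split; first exact: cond_pos.
move=> x Hx. have := Hd x. rewrite E.
rewrite /ball /= /AbsRing_ball /abs /= /minus /plus /opp /= Ropp_0 !Rplus_0_r.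
rewrite Rabs_pos_eq; last lra. move=> /(_ ltac:(lra)) /Rabs_def2 [h _].
split => //. have := BesselI_pos m x ltac:(lra). have := BesselI_pos (S m) x ltac:(lra). have := pos_INR m; nra.
Qed.

(** * Solutions of the Helmholtz equation in polar coordinates *)

(** A solution on the disk of radius [r1], through its polar derivatives.  The
Helmholtz equation is the clause [ps_tt], which solves it for the second
angular derivative.  The point r = 0 is excluded; [ps_bound] records that
the solution is regular there. *)
Record polar_solution (alpha r1 : R) (H Hr Hrr Ht : R -> R -> R) : Prop := {
  ps_r : forall r t, 0 < r < r1 -> is_derive (fun s => H s t) r (Hr r t);
  ps_rr : forall r t, 0 < r < r1 -> is_derive (fun s => Hr s t) r (Hrr r t);
  ps_t : forall r t, 0 < r < r1 -> is_derive (H r) t (Ht r t);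
  ps_tt : forall r t, 0 < r < r1 ->
    is_derive (Ht r) t (r ^ 2 * (alpha ^ 2 * H r t - Hrr r t) - r * Hr r t);
  ps_rt : forall r t, 0 < r < r1 -> ex_derive (Hr r) t;
  ps_cr : forall r t, 0 < r < r1 -> continuity_2d_pt Hr r t;
  ps_crr : forall r t, 0 < r < r1 -> continuity_2d_pt Hrr r t;
  ps_per : forall r t, 0 < r < r1 -> H r (t + 2 * PI) = H r t;
  ps_perr : forall r t, 0 < r < r1 -> Hr r (t + 2 * PI) = Hr r t;
  ps_pert : forall r t, 0 < r < r1 -> Ht r (t + 2 * PI) = Ht r t;
  ps_bound : exists B d, 0 < d /\ forall r t, 0 < r < d -> Rabs (H r t) <= B /\ Rabs (Hr r t) <= B
}.

Lemma cont2d_snd f x y : continuity_2d_pt f x y -> continuous (f x) y.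
Proof.
move=> /continuity_2d_pt_filterlim H.
apply/filterlim_locally => eps.
move/filterlim_locally: H => /(_ eps) [d Hd].
exists d => z Hz. apply: (Hd (x, z)); split => //=; exact: ball_center.
Qed.

Lemma ex_derive_continuous_R (f : R -> R) (x : R) : ex_derive f x -> continuous f x.
Proof. exact: (@ex_derive_continuous R_AbsRing R_NormedModule). Qed.

Lemma is_derive_continuous (f : R -> R) (x l : R) : is_derive f x l -> continuous f x.
Proof. move=> H; apply: ex_derive_continuous_R; by exists l. Qed.

Lemma fourier_coef_bound b m f B : circle_cont f -> (forall t, Rabs (f t) <= B) -> Rabs (fourier_coef b m f) <= 2 * B.
Proof.
move=> Hc Hb. have Hpi := PI_RGT_0.
have C : circle_cont (fun t => f t * trig b m t) by apply: circle_cont_mult => //; exact: trig_circle_cont.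
have := circle_int_le_const _ B C => X.
rewrite /fourier_coef Rabs_mult Rabs_pos_eq; last by left; apply: Rinv_0_lt_compat.
have {}X : Rabs (circle_int (fun t => f t * trig b m t)) <= 2 * PI * B.
  apply: X => t _; rewrite Rabs_mult.
  have := trig_bound b m t. have := Hb t. have := Rabs_pos (f t). have := Rabs_pos (trig b m t). nra.
have -> : 2 * B = / PI * (2 * PI * B) by field; lra.
apply: Rmult_le_compat_l => //; left; exact: Rinv_0_lt_compat.
Qed.

Lemma interval_locally (a b r : R) (P : R -> Prop) : a < r < b ->
  (forall s, a < s < b -> P s) -> locally r P.
Proof.
move=> Hr HP.
have D : 0 < Rmin (r - a) (b - r) by apply: Rmin_pos; lra.
exists (mkposreal _ D) => s Hs; apply: HP.
move: Hs; rewrite /ball /= /AbsRing_ball /abs /= /minus /plus /opp /= => /Rabs_def2.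
have := Rmin_l (r - a) (b - r); have := Rmin_r (r - a) (b - r); lra.
Qed.

Lemma fourier_coef_derive (F G : R -> R -> R) (a c r : R) b m : a < r < c ->
  (forall s t, a < s < c -> is_derive (fun s => F s t) s (G s t)) ->
  (forall s t, a < s < c -> continuous (F s) t) ->
  (forall t, continuity_2d_pt G r t) ->
  is_derive (fun s => fourier_coef b m (F s)) r (fourier_coef b m (G r)).
Proof.
move=> Hr HD HF HG. rewrite /fourier_coef.
apply: (is_derive_scal (fun s => circle_int (fun t => F s t * trig b m t))).
have D : forall s t, a < s < c -> is_derive (fun s => F s t * trig b m t) s (G s t * trig b m t).
  move=> s t Hs. apply: (is_derive_ext (fun s => trig b m t * F s t)); first by move=> u; rewrite Rmult_comm.
  rewrite Rmult_comm; apply: is_derive_scal; exact: HD.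
have E : circle_int (fun t => G r t * trig b m t) = RInt (fun t => Derive (fun u => F u t * trig b m t) r) (-PI) PI.
  apply: circle_int_ext => t _; symmetry; apply: is_derive_unique; exact: D.
rewrite E. apply: (is_derive_RInt_param (fun s t => F s t * trig b m t)).
- apply: (interval_locally a c) => // s Hs t _; eexists; exact: D.
- move=> t _. apply: (continuity_2d_pt_ext_loc (fun u v => G u v * trig b m v)).
    have [d Hd] := interval_locally a c r (fun s => a < s < c) Hr (fun s H => H).
    exists d => u v Hu Hv; symmetry; apply: is_derive_unique; apply: D; exact: Hd.
  apply: continuity_2d_pt_mult; first exact: HG.
  apply: (continuity_1d_2d_pt_comp (trig b m) (fun _ v => v)); last exact: continuity_2d_pt_id2.
  apply/continuity_pt_filterlim; exact: trig_continuous.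
- apply: (interval_locally a c) => // s Hs.
  apply: circle_cont_ex_RInt => t Ht. apply: (@continuous_mult _ R_AbsRing); [exact: HF|exact: trig_continuous].
Qed.

Lemma constant_on f a b x y : (forall s, a < s < b -> is_derive f s 0) ->
  a < x < b -> a < y < b -> f x = f y.
Proof.
move=> H Hx Hy.
have [c [Hc E]] : exists c, Rmin x y <= c <= Rmax x y /\ f y - f x = 0 * (y - x).
  have R1 := Rmin_glb_lt x y a ltac:(lra) ltac:(lra); have R2 := Rmax_lub_lt x y b ltac:(lra) ltac:(lra).
  apply: (MVT_gen f x y (fun _ => 0)) => z Hz.
  - apply: H; lra.
  - apply/continuity_pt_filterlim; apply: (is_derive_continuous _ _ 0); apply: H; lra.
lra.
Qed.

Lemma wronskian_bound s h h1 u V B : 0 <= s -> 0 <= u -> 0 <= V ->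
  Rabs h <= B -> Rabs h1 <= B -> Rabs (s * h1 * u - h * V) <= s * B * u + B * V.
Proof.
move=> Hs Hu HV Hh Hh1. apply: Rle_trans (Rabs_triang _ _) _.
rewrite Rabs_Ropp !Rabs_mult (Rabs_pos_eq s) // (Rabs_pos_eq u) // (Rabs_pos_eq V) //.
apply: Rplus_le_compat; apply: Rmult_le_compat_r => //.
exact: Rmult_le_compat_l.
Qed.

Section Polar.
Variables (alpha r1 : R) (H Hr Hrr Ht : R -> R -> R).
Hypothesis Ha : 0 < alpha.
Hypothesis Hp : polar_solution alpha r1 H Hr Hrr Ht.

Lemma polar_continuous r t : 0 < r < r1 -> continuous (H r) t.
Proof. move=> Hh; exact: is_derive_continuous (ps_t _ _ _ _ _ _ Hp r t Hh). Qed.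
Lemma polar_continuous_r r t : 0 < r < r1 -> continuous (Hr r) t.
Proof. move=> Hh; apply: cont2d_snd; exact: (ps_cr _ _ _ _ _ _ Hp). Qed.
Lemma polar_continuous_rr r t : 0 < r < r1 -> continuous (Hrr r) t.
Proof. move=> Hh; apply: cont2d_snd; exact: (ps_crr _ _ _ _ _ _ Hp). Qed.

Lemma coef_derive b m r : 0 < r < r1 -> is_derive (fun s => fourier_coef b m (H s)) r (fourier_coef b m (Hr r)).
Proof.
move=> Hh; apply: (fourier_coef_derive H Hr 0 r1) => //.
- move=> s t; exact: (ps_r _ _ _ _ _ _ Hp).
- move=> s t; exact: polar_continuous.
- move=> t; exact: (ps_cr _ _ _ _ _ _ Hp).
Qed.

Lemma coef_derive2 b m r : 0 < r < r1 -> is_derive (fun s => fourier_coef b m (Hr s)) r (fourier_coef b m (Hrr r)).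
Proof.
move=> Hh; apply: (fourier_coef_derive Hr Hrr 0 r1) => //.
- move=> s t; exact: (ps_rr _ _ _ _ _ _ Hp).
- move=> s t; exact: polar_continuous_r.
- move=> t; exact: (ps_crr _ _ _ _ _ _ Hp).
Qed.

Lemma trig_periodic b m t : trig b m (t + 2 * PI) = trig b m t.
Proof.
rewrite /trig; have -> : INR m * (t + 2 * PI) = INR m * t + 2 * INR m * PI by ring.
case: b; [exact: cos_period|exact: sin_period].
Qed.

(** Two integrations by parts, in which the boundary terms cancel by
periodicity, replace the second angular derivative by - m^2. *)
Lemma coef_ode b m r : 0 < r < r1 ->
  r ^ 2 * fourier_coef b m (Hrr r) + r * fourier_coef b m (Hr r) =
  (INR m ^ 2 + alpha ^ 2 * r ^ 2) * fourier_coef b m (H r).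
Proof.
move=> Hh. have Hpi := PI_RGT_0.
have cH : circle_cont (fun t => H r t * trig b m t).
  apply: circle_cont_mult; [move=> t _; exact: polar_continuous|exact: trig_circle_cont].
have cr : circle_cont (fun t => Hr r t * trig b m t).
  apply: circle_cont_mult; [move=> t _; exact: polar_continuous_r|exact: trig_circle_cont].
have crr : circle_cont (fun t => Hrr r t * trig b m t).
  apply: circle_cont_mult; [move=> t _; exact: polar_continuous_rr|exact: trig_circle_cont].
have cs : forall c f, circle_cont f -> circle_cont (fun t => c * f t).
  move=> c f Hf; apply: circle_cont_mult => //; exact: circle_cont_const.
have Z := circle_int_derive (fun t => Ht r t * trig b m t - H r t * dtrig b m t)
  (fun t => (r ^ 2 * alpha ^ 2 + INR m ^ 2) * (H r t * trig b m t) -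
     r ^ 2 * (Hrr r t * trig b m t) - r * (Hr r t * trig b m t)).
have {}Z : circle_int (fun t => (r ^ 2 * alpha ^ 2 + INR m ^ 2) * (H r t * trig b m t) -
     r ^ 2 * (Hrr r t * trig b m t) - r * (Hr r t * trig b m t)) = 0.
  rewrite Z.
  - have E := ps_per _ _ _ _ _ _ Hp r (- PI) Hh.
    have Et := ps_pert _ _ _ _ _ _ Hp r (- PI) Hh.
    have T := trig_periodic b m (- PI).
    have T1 := trig_periodic true m (- PI).
    have T2 := trig_periodic false m (- PI).
    have P : - PI + 2 * PI = PI by ring.
    rewrite P in E Et T T1 T2.
    rewrite /dtrig E Et T T1 T2; ring.
  - move=> t.
    have D1 := is_derive_Rmult _ _ _ _ _ (ps_tt _ _ _ _ _ _ Hp r t Hh) (trig_derive b m t).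
    have D2 := is_derive_Rmult _ _ _ _ _ (ps_t _ _ _ _ _ _ Hp r t Hh) (dtrig_derive b m t).
    apply: (is_derive_eq _ _ _ _ (is_derive_Rminus _ _ _ _ _ D1 D2)); ring.
  - apply: circle_cont_minus; first apply: circle_cont_minus; apply: cs => //.
rewrite circle_int_minus ?circle_int_minus ?circle_int_scal // in Z; try (apply: cs => //); last first.
  apply: circle_cont_minus; apply: cs => //.
rewrite /fourier_coef.
have I : / PI * PI = 1 by field; lra.
set a := circle_int _ in Z *. set c := circle_int _ in Z *. set d := circle_int _ in Z *.
have : r ^ 2 * (/ PI * c) + r * (/ PI * d) - (INR m ^ 2 + alpha ^ 2 * r ^ 2) * (/ PI * a) = - / PI * 0.
  rewrite -Z; ring.
lra.
Qed.

(** Let u be the mode and h the coefficient.  The Wronskian [W] of the two solutions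
has zero derivative, and it tends to 0 at the centre, where h and h' are
bounded and the flux [V] of u vanishes.  Hence W = 0 and h / u is constant. *)
Lemma coef_bessel b m : exists A, forall r, 0 < r < r1 ->
  fourier_coef b m (H r) = A * BesselI m (alpha * r).
Proof.
case: (Rlt_dec 0 r1) => Hr1; last by exists 0 => r Hh; lra.
pose u r := BesselI m (alpha * r).
pose V r := INR m * BesselI m (alpha * r) + alpha * r * BesselI (S m) (alpha * r).
have lin : forall r, is_derive (fun r => alpha * r) r alpha by move=> r; auto_derive => //; ring.
have du : forall r, 0 < r -> is_derive u r (V r / r).
  move=> r Hh.
  apply: (is_derive_eq _ _ _ _ (is_derive_Rcomp _ _ _ _ _ (BesselI_derive m (alpha * r) ltac:(nra)) (lin r))).
  rewrite /V /BesselI_d; field; lra.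
have dV : forall r, 0 < r -> is_derive V r ((INR m ^ 2 + alpha ^ 2 * r ^ 2) / r * u r).
  move=> r Hh.
  apply: (is_derive_eq _ _ _ _ (is_derive_Rcomp _ _ _ _ _ (BesselI_ode m (alpha * r) ltac:(nra)) (lin r))).
  rewrite /u; field; lra.
pose h r := fourier_coef b m (H r). pose h1 r := fourier_coef b m (Hr r).
pose W r := r * h1 r * u r - h r * V r.
have dW : forall r, 0 < r < r1 -> is_derive W r 0.
  move=> r Hh.
  have D1 := is_derive_Rmult _ _ _ _ _ (is_derive_Rmult _ _ _ _ _ (is_derive_id r) (coef_derive2 b m r Hh)) (du r (proj1 Hh)).
  have D2 := is_derive_Rmult _ _ _ _ _ (coef_derive b m r Hh) (dV r (proj1 Hh)).
  apply: (is_derive_eq _ _ _ _ (is_derive_Rminus _ _ _ _ _ D1 D2)).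
  have E := coef_ode b m r Hh.
  transitivity (u r / r * (r ^ 2 * fourier_coef b m (Hrr r) + r * fourier_coef b m (Hr r) - (INR m ^ 2 + alpha ^ 2 * r ^ 2) * fourier_coef b m (H r))).
    rewrite /one /=; field; lra.
  rewrite E; ring.
have W0 : forall r, 0 < r < r1 -> W r = 0.
  move=> r Hh.
  have [B [d [Hd HB]]] := ps_bound _ _ _ _ _ _ Hp.
  have B0 : 0 <= B.
    have := HB (d / 2) 0 ltac:(lra). have := Rabs_pos (H (d/2) 0); lra.
  case: (Req_dec (W r) 0) => // HW. exfalso.
  have Wp := Rabs_pos_lt _ HW.
  (* Bounds on the flux and on the radius that make each half of the Wronskian
   at most half of its supposedly nonzero constant value. *)
  pose e := Rabs (W r) / (4 * (B + 1)).
  have He : 0 < e by apply: Rdiv_lt_0_compat; lra.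
  have [d' [Hd' HV]] := BesselI_flux_lim0 m e He.
  pose uM := BesselI m (alpha * r1).
  have uM0 : 0 < uM by apply: BesselI_pos; nra.
  pose d2 := Rabs (W r) / (4 * (B + 1) * uM).
  have Hd2 : 0 < d2 by apply: Rdiv_lt_0_compat => //; nra.
  pose s := Rmin (Rmin d r1) (Rmin (d' / alpha) d2) / 2.
  have s1 : 0 < Rmin (Rmin d r1) (Rmin (d' / alpha) d2).
    apply: Rmin_pos; apply: Rmin_pos => //; exact: Rdiv_lt_0_compat.
  have L1 := Rmin_l (Rmin d r1) (Rmin (d' / alpha) d2).
  have L2 := Rmin_r (Rmin d r1) (Rmin (d' / alpha) d2).
  have L3 := Rmin_l d r1. have L4 := Rmin_r d r1.
  have L5 := Rmin_l (d' / alpha) d2. have L6 := Rmin_r (d' / alpha) d2.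
  have sb : 0 < s /\ s < d /\ s < r1 /\ s < d' / alpha /\ s < d2 by rewrite /s; lra.
  clear s1 L1 L2 L3 L4 L5 L6; clearbody s; case: sb => [s0 [sd [sr [sd' sd2]]]].
  have Es : W r = W s by apply: (constant_on W 0 r1) => //; lra.
  have as0 : 0 < alpha * s < d'.
    split; first nra. have : alpha * s < alpha * (d' / alpha) by apply: Rmult_lt_compat_l.
    have -> : alpha * (d' / alpha) = d' by field; lra. by [].
  have Vs := HV (alpha * s) as0. rewrite -/(V s) in Vs.
  have us : 0 < u s <= uM.
    split; first by apply: BesselI_pos; lra. apply: BesselI_mono; nra.
  have hb : Rabs (h s) <= 2 * B.
    apply: fourier_coef_bound; first by move=> t _; apply: polar_continuous; lra.
    move=> t; apply HB; lra.
  have h1b : Rabs (h1 s) <= 2 * B.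
    apply: fourier_coef_bound; first by move=> t _; apply: polar_continuous_r; lra.
    move=> t; apply HB; lra.
  have : Rabs (W s) <= s * (2 * B) * u s + 2 * B * V s.
    by apply: wronskian_bound => //; lra.
  rewrite -Es => bad.
  have T1 : 2 * B * V s <= Rabs (W r) / 2.
    apply: (Rle_trans _ (2 * (B + 1) * e)); first by nra.
    right; rewrite /e; field; lra.
  have T2 : s * (2 * B) * u s < Rabs (W r) / 2.
    apply: (Rlt_le_trans _ (d2 * (2 * (B + 1)) * uM)).
      apply: (Rle_lt_trans _ (s * (2 * B) * uM)).
        apply: Rmult_le_compat_l; nra.
      apply: Rmult_lt_compat_r => //.
      have : s * (2 * B) <= s * (2 * (B + 1)) by nra.
      have : s * (2 * (B + 1)) < d2 * (2 * (B + 1)) by apply: Rmult_lt_compat_r; lra.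
      lra.
    right; rewrite /d2; field; lra.
  lra.
exists (h (r1 / 2) / u (r1 / 2)) => r Hh.
have K : h (r1 / 2) / u (r1 / 2) = h r / u r.
  apply: (constant_on (fun r => h r / u r) 0 r1); try lra.
  move=> s Hs. have up : 0 < u s by apply: BesselI_pos; nra.
  have D := is_derive_div _ _ s _ _ (coef_derive b m s Hs) (du s (proj1 Hs)) ltac:(lra).
  have E := W0 s Hs.
  apply: (is_derive_eq _ _ _ _ D).
  transitivity (W s / (s * u s ^ 2)); last by rewrite E; field; split; lra.
  rewrite /W /h /h1; field; lra.
rewrite K -/(h r) -/(u r). have up : 0 < u r by apply: BesselI_pos; nra.
field; lra.
Qed.

(** The same coefficients serve the solution and its radial derivative: the
expansion of the latter is obtained from its own Fourier coefficients, so
no series has to be differentiated term by term. *)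
Theorem polar_expansion : exists A : bool -> nat -> R, forall r, 0 < r < r1 ->
  (forall b m, fourier_coef b m (H r) = A b m * BesselI m (alpha * r)) /\
  (forall b m, fourier_coef b m (Hr r) = A b m * (alpha * BesselI_d m (alpha * r))) /\
  (forall t, is_series (fun m => fourier_term (H r) m t) (H r t)) /\
  (forall t, is_series (fun m => fourier_term (Hr r) m t) (Hr r t)).
Proof.
case: (Rlt_dec 0 r1) => Hr1; last by exists (fun _ _ => 0) => r Hh; lra.
pose A b m := fourier_coef b m (H (r1 / 2)) / BesselI m (alpha * (r1 / 2)).
have EA : forall b m r, 0 < r < r1 -> fourier_coef b m (H r) = A b m * BesselI m (alpha * r).
  move=> b m r Hh. have [a Ea] := coef_bessel b m.
  have P : 0 < BesselI m (alpha * (r1 / 2)) by apply: BesselI_pos; nra.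
  rewrite (Ea r Hh) /A (Ea (r1 / 2)); last lra. field; lra.
exists A => r Hh; split; [|split; [|split]].
- move=> b m; exact: EA.
- move=> b m.
  have D1 := is_derive_unique _ _ _ (coef_derive b m r Hh).
  rewrite -D1; apply: is_derive_unique.
  apply: (is_derive_ext_loc (fun s => A b m * BesselI m (alpha * s))).
    apply: (interval_locally 0 r1) => // s Hs; by rewrite EA.
  apply: is_derive_scal.
  have L : is_derive (fun r => alpha * r) r alpha by auto_derive => //; ring.
  exact: (is_derive_comp _ _ r _ _ (BesselI_derive m (alpha * r) ltac:(nra)) L).
- move=> t; apply: fourier_sum.
  + move=> s; exact: polar_continuous.
  + move=> s; exact: (ps_per _ _ _ _ _ _ Hp).
  + eexists; exact: (ps_t _ _ _ _ _ _ Hp).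
- move=> t; apply: fourier_sum.
  + move=> s; exact: polar_continuous_r.
  + move=> s; exact: (ps_perr _ _ _ _ _ _ Hp).
  + exact: (ps_rt _ _ _ _ _ _ Hp).
Qed.
End Polar.

(** * From Cartesian to polar coordinates *)

Lemma cont2d_comp2 (f a b : R -> R -> R) x y :
  continuity_2d_pt f (a x y) (b x y) -> continuity_2d_pt a x y -> continuity_2d_pt b x y ->
  continuity_2d_pt (fun u v => f (a u v) (b u v)) x y.
Proof.
move=> Hf Ha Hb eps.
have [d Hd] := Hf eps. have [d1 H1] := Ha d. have [d2 H2] := Hb d.
have D : 0 < Rmin d1 d2 by apply: Rmin_pos; exact: cond_pos.
exists (mkposreal _ D) => u v /= Hu Hv. apply: Hd.
- apply: H1; [exact: Rlt_le_trans Hu (Rmin_l _ _)|exact: Rlt_le_trans Hv (Rmin_l _ _)].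
- apply: H2; [exact: Rlt_le_trans Hu (Rmin_r _ _)|exact: Rlt_le_trans Hv (Rmin_r _ _)].
Qed.

(** Continuity of one partial derivative together with the existence of the
other is enough for differentiability at the point. *)
Lemma chain_curve (f fx fy : R -> R -> R) (a b : R -> R) (s a' b' : R) :
  locally (a s, b s) (fun z : R * R => is_derive (fun u => f u (snd z)) (fst z) (fx (fst z) (snd z))) ->
  is_derive (fun v => f (a s) v) (b s) (fy (a s) (b s)) ->
  continuity_2d_pt fx (a s) (b s) ->
  is_derive a s a' -> is_derive b s b' ->
  is_derive (fun t => f (a t) (b t)) s (fx (a s) (b s) * a' + fy (a s) (b s) * b').
Proof.
move=> H1 H2 H3 Ha Hb. apply/is_derive_Reals.
apply: derivable_pt_lim_comp_2d; try by apply/is_derive_Reals.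
apply/filterdiff_differentiable_pt_lim.
apply: (is_derive_filterdiff f (a s) (b s) fx (fy (a s) (b s))) => //.
by apply/continuity_2d_pt_filterlim.
Qed.

Lemma cont2d_cos_r x y : continuity_2d_pt (fun u v => u * cos v) x y.
Proof.
apply: continuity_2d_pt_mult; first exact: continuity_2d_pt_id1.
apply: (continuity_1d_2d_pt_comp cos (fun _ v => v)); last exact: continuity_2d_pt_id2.
exact: continuity_cos.
Qed.
Lemma cont2d_sin_r x y : continuity_2d_pt (fun u v => u * sin v) x y.
Proof.
apply: continuity_2d_pt_mult; first exact: continuity_2d_pt_id1.
apply: (continuity_1d_2d_pt_comp sin (fun _ v => v)); last exact: continuity_2d_pt_id2.
exact: continuity_sin.
Qed.
Lemma cont2d_1d (f : R -> R) x y : continuous f y -> continuity_2d_pt (fun _ v => f v) x y.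
Proof.
move=> H; apply: (continuity_1d_2d_pt_comp f (fun _ v => v)); last exact: continuity_2d_pt_id2.
by apply/continuity_pt_filterlim.
Qed.

Lemma cont2d_bound f x y : continuity_2d_pt f x y -> exists d, 0 < d /\
  forall u v, Rabs (u - x) < d -> Rabs (v - y) < d -> Rabs (f u v) <= Rabs (f x y) + 1.
Proof.
move=> H. have [d Hd] := H (mkposreal 1 Rlt_0_1).
exists d; split; first exact: cond_pos.
move=> u v Hu Hv; have /= := Hd u v Hu Hv.
have := Rabs_triang_inv (f u v) (f x y); lra.
Qed.

Lemma Cmod_polar r t : 0 <= r -> Cmod (r * cos t, r * sin t) = r.
Proof.
move=> Hr; rewrite /Cmod /=.
have E := sin2_cos2 t. rewrite /Rsqr in E.
have -> : r * cos t * (r * cos t * 1) + r * sin t * (r * sin t * 1) = r * r.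
  transitivity (r * r * (sin t * sin t + cos t * cos t)); [ring|rewrite E; ring].
exact: sqrt_square.
Qed.

Lemma cos_2PI_shift t : cos (t + 2 * PI) = cos t.
Proof. have := cos_period t 1. by rewrite /= Rmult_1_r. Qed.
Lemma sin_2PI_shift t : sin (t + 2 * PI) = sin t.
Proof. have := sin_period t 1. by rewrite /= Rmult_1_r. Qed.

Section GPolar.
Variables (alpha r0 : R) (g : C -> R) (U : C -> Prop).
Hypothesis r0p : 0 < r0.
Hypothesis Uo : open U.
Hypothesis HU : forall x : C, Cmod x <= r0 -> U x.
Hypothesis Hg : helmholtz_solution alpha U g.

Let f := curry_C g.
Let fx := fun u v => Derive (fun z => f z v) u.
Let fy := fun u v => Derive (fun z => f u z) v.
Let fxx := fun u v => Derive (fun z => fx z v) u.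
Let fxy := fun u v => Derive (fun z => fx u z) v.
Let fyx := fun u v => Derive (fun z => fy z v) u.
Let fyy := fun u v => Derive (fun z => fy u z) v.

Lemma g_regular u v : U (u, v) ->
  continuity_2d_pt f u v /\
  is_derive (fun z => f z v) u (fx u v) /\ is_derive (fun z => f u z) v (fy u v) /\
  continuity_2d_pt fx u v /\ continuity_2d_pt fy u v /\
  is_derive (fun z => fx z v) u (fxx u v) /\ is_derive (fun z => fx u z) v (fxy u v) /\
  is_derive (fun z => fy z v) u (fyx u v) /\ is_derive (fun z => fy u z) v (fyy u v) /\
  continuity_2d_pt fxx u v /\ continuity_2d_pt fxy u v /\
  continuity_2d_pt fyx u v /\ continuity_2d_pt fyy u v /\
  fxx u v + fyy u v = alpha ^ 2 * f u v.
Proof.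
move=> HUx. have [[C0 [D1 [D2 [Hx Hy]]]] L] := Hg (u, v) HUx.
move: Hx Hy => /= [Cx [Dxx [Dxy [[Cxx _] [Cxy _]]]]] [Cy [Dyx [Dyy [[Cyx _] [Cyy _]]]]].
rewrite /= in C0 D1 D2.
do 13 (apply: conj; first by [|exact: Derive_correct]).
move: L; rewrite /laplacian /partial_derive /= -/f => L.
have : fxx u v + fyy u v - alpha ^ 2 * f u v = 0 by exact: L.
lra.
Qed.

Definition g_polar r t := f (r * cos t) (r * sin t).
Definition g_polar_r r t := fx (r * cos t) (r * sin t) * cos t + fy (r * cos t) (r * sin t) * sin t.
Definition g_polar_rr r t :=
  (fxx (r * cos t) (r * sin t) * cos t + fxy (r * cos t) (r * sin t) * sin t) * cos t +
  (fyx (r * cos t) (r * sin t) * cos t + fyy (r * cos t) (r * sin t) * sin t) * sin t.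
Definition g_polar_t r t := fx (r * cos t) (r * sin t) * (- r * sin t) + fy (r * cos t) (r * sin t) * (r * cos t).

Lemma U_polar r t : 0 <= r <= r0 -> U (r * cos t, r * sin t).
Proof. move=> H; apply: HU; rewrite Cmod_polar; lra. Qed.

Lemma chainU (h hx hy : R -> R -> R) (a b : R -> R) (s a' b' : R) :
  (forall u v, U (u, v) -> is_derive (fun z => h z v) u (hx u v)) ->
  (forall u v, U (u, v) -> is_derive (fun z => h u z) v (hy u v)) ->
  (forall u v, U (u, v) -> continuity_2d_pt hx u v) ->
  U (a s, b s) -> is_derive a s a' -> is_derive b s b' ->
  is_derive (fun t => h (a t) (b t)) s (hx (a s) (b s) * a' + hy (a s) (b s) * b').
Proof.
move=> H1 H2 H3 HUs Ha Hb.
apply: (chain_curve h hx hy) => //; try by [apply: H2|apply: H3].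
have L : @locally (prod_UniformSpace R_UniformSpace R_UniformSpace) (a s, b s) U by exact: (Uo _ HUs).
apply: filter_imp L => -[u v] /= Huv; exact: H1.
Qed.

(** Expanding the polar derivatives by the chain rule gives the polar form of
the Laplacian; the mixed derivatives enter only through their sum, which
cancels between the radial and the angular part. *)
Theorem g_polar_solution : polar_solution alpha r0 g_polar g_polar_r g_polar_rr g_polar_t.
Proof.
have R1 : forall t r, is_derive (fun r => r * cos t) r (cos t) by move=> t r; auto_derive => //; ring.
have R2 : forall t r, is_derive (fun r => r * sin t) r (sin t) by move=> t r; auto_derive => //; ring.
have T1 : forall r t, is_derive (fun t => r * cos t) t (- r * sin t) by move=> r t; auto_derive => //; ring.
have T2 : forall r t, is_derive (fun t => r * sin t) t (r * cos t) by move=> r t; auto_derive => //; ring.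
have TT1 : forall r t, is_derive (fun t => - r * sin t) t (- r * cos t) by move=> r t; auto_derive => //; ring.
have TT2 : forall r t, is_derive (fun t => r * cos t) t (- r * sin t) by move=> r t; auto_derive => //; ring.
have c1 : forall t, is_derive cos t (- sin t) by move=> t; auto_derive => //; ring.
have s1 : forall t, is_derive sin t (cos t) by move=> t; auto_derive => //; ring.
have Ux : forall r t, 0 < r < r0 -> U (r * cos t, r * sin t) by move=> r t Hh; apply: U_polar; lra.
have G := g_regular.
have ch := chainU.
have chf := ch f fx fy _ _ _ _ _ (fun u v H => proj1 (proj2 (G u v H)))
   (fun u v H => proj1 (proj2 (proj2 (G u v H)))) (fun u v H => proj1 (proj2 (proj2 (proj2 (G u v H))))).
have chx : forall a b s a' b', U (a s, b s) -> is_derive a s a' -> is_derive b s b' ->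
  is_derive (fun t => fx (a t) (b t)) s (fxx (a s) (b s) * a' + fxy (a s) (b s) * b').
  move=> a b s a' b'; apply: ch => u v H; have := G u v H; tauto.
have chy : forall a b s a' b', U (a s, b s) -> is_derive a s a' -> is_derive b s b' ->
  is_derive (fun t => fy (a t) (b t)) s (fyx (a s) (b s) * a' + fyy (a s) (b s) * b').
  move=> a b s a' b'; apply: ch => u v H; have := G u v H; tauto.
have cc : forall h r t, continuity_2d_pt h (r * cos t) (r * sin t) ->
    continuity_2d_pt (fun u v => h (u * cos v) (u * sin v)) r t.
  move=> h r t Hh; apply: (cont2d_comp2 h (fun u v => u * cos v) (fun u v => u * sin v)) => //.
  exact: cont2d_cos_r. exact: cont2d_sin_r.
have ccos : forall r t, continuity_2d_pt (fun _ v => cos v) r t by move=> r t; apply: cont2d_1d; exact: continuous_cos.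
have csin : forall r t, continuity_2d_pt (fun _ v => sin v) r t by move=> r t; apply: cont2d_1d; exact: continuous_sin.
split.
- move=> r t Hh.
  exact: (chf (fun r => r * cos t) (fun r => r * sin t) r _ _ (Ux r t Hh) (R1 t r) (R2 t r)).
- move=> r t Hh.
  have D1 := chx (fun r => r * cos t) (fun r => r * sin t) r _ _ (Ux r t Hh) (R1 t r) (R2 t r).
  have D2 := chy (fun r => r * cos t) (fun r => r * sin t) r _ _ (Ux r t Hh) (R1 t r) (R2 t r).
  apply: (is_derive_eq _ _ _ _ (is_derive_Rplus _ _ _ _ _ (is_derive_Rmult _ _ _ _ _ D1 (is_derive_const (cos t) r)) (is_derive_Rmult _ _ _ _ _ D2 (is_derive_const (sin t) r)))).
  rewrite /g_polar_rr /zero /=; ring.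
- move=> r t Hh.
  exact: (chf (fun t => r * cos t) (fun t => r * sin t) t _ _ (Ux r t Hh) (T1 r t) (T2 r t)).
- move=> r t Hh.
  have D1 := chx (fun t => r * cos t) (fun t => r * sin t) t _ _ (Ux r t Hh) (T1 r t) (T2 r t).
  have D2 := chy (fun t => r * cos t) (fun t => r * sin t) t _ _ (Ux r t Hh) (T1 r t) (T2 r t).
  apply: (is_derive_eq _ _ _ _ (is_derive_Rplus _ _ _ _ _ (is_derive_Rmult _ _ _ _ _ D1 (TT1 r t)) (is_derive_Rmult _ _ _ _ _ D2 (TT2 r t)))).
  have Pde : fxx (r * cos t) (r * sin t) + fyy (r * cos t) (r * sin t) = alpha ^ 2 * g_polar r t.
    have := G _ _ (Ux r t Hh); tauto.
  rewrite -Pde /g_polar_rr /g_polar_r.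
  have E := sin2_cos2 t. rewrite /Rsqr in E.
  have Es : cos t ^ 2 = 1 - sin t ^ 2 by rewrite /=; lra.
  set a := fxx _ _. set b := fyy _ _. set c := fxy _ _. set d := fyx _ _.
  set p := fx _ _. set q := fy _ _.
  transitivity (r ^ 2 * (a * sin t ^ 2 + b * cos t ^ 2 - (c + d) * (sin t * cos t)) - r * (p * cos t + q * sin t)); first ring.
  transitivity (r ^ 2 * (a * (1 - cos t ^ 2) + b * (1 - sin t ^ 2) - (c + d) * (sin t * cos t)) - r * (p * cos t + q * sin t)).
    rewrite Es; ring.
  ring.
- move=> r t Hh.
  have D1 := chx (fun t => r * cos t) (fun t => r * sin t) t _ _ (Ux r t Hh) (T1 r t) (T2 r t).
  have D2 := chy (fun t => r * cos t) (fun t => r * sin t) t _ _ (Ux r t Hh) (T1 r t) (T2 r t).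
  eexists. exact: (is_derive_Rplus _ _ _ _ _ (is_derive_Rmult _ _ _ _ _ D1 (c1 t)) (is_derive_Rmult _ _ _ _ _ D2 (s1 t))).
- move=> r t Hh; have := G _ _ (Ux r t Hh) => X.
  apply: continuity_2d_pt_plus; apply: continuity_2d_pt_mult => //; apply: cc; tauto.
- move=> r t Hh; have := G _ _ (Ux r t Hh) => X.
  apply: continuity_2d_pt_plus; apply: continuity_2d_pt_mult => //;
  apply: continuity_2d_pt_plus; apply: continuity_2d_pt_mult => //; apply: cc; tauto.
- move=> r t _; by rewrite /g_polar cos_2PI_shift sin_2PI_shift.
- move=> r t _; by rewrite /g_polar_r cos_2PI_shift sin_2PI_shift.
- move=> r t _; by rewrite /g_polar_t cos_2PI_shift sin_2PI_shift.
- have U0 : U (0, 0) by apply: HU; rewrite /Cmod /= !Rmult_0_l Rplus_0_l sqrt_0; lra.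
  have G0 := G 0 0 U0.
  have [d1 [Hd1 B1]] := cont2d_bound f 0 0 ltac:(tauto).
  have [d2 [Hd2 B2]] := cont2d_bound fx 0 0 ltac:(tauto).
  have [d3 [Hd3 B3]] := cont2d_bound fy 0 0 ltac:(tauto).
  exists (Rabs (f 0 0) + 1 + (Rabs (fx 0 0) + 1) + (Rabs (fy 0 0) + 1)), (Rmin d1 (Rmin d2 d3)).
  split; first by do 2 apply: Rmin_pos => //.
  move=> r t Hh.
  have m1 := Rmin_l d1 (Rmin d2 d3). have m2 := Rmin_r d1 (Rmin d2 d3).
  have m3 := Rmin_l d2 d3. have m4 := Rmin_r d2 d3.
  have cle : Rabs (cos t) <= 1 by apply: Rabs_le; exact: COS_bound.
  have sle : Rabs (sin t) <= 1 by apply: Rabs_le; exact: SIN_bound.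
  have lc : Rabs (r * cos t - 0) <= r.
    rewrite Rminus_0_r Rabs_mult (Rabs_pos_eq r); last lra. nra.
  have ls : Rabs (r * sin t - 0) <= r.
    rewrite Rminus_0_r Rabs_mult (Rabs_pos_eq r); last lra. nra.
  have := B1 (r * cos t) (r * sin t) ltac:(lra) ltac:(lra).
  have := B2 (r * cos t) (r * sin t) ltac:(lra) ltac:(lra).
  have := B3 (r * cos t) (r * sin t) ltac:(lra) ltac:(lra).
  have p1 := Rabs_pos (f 0 0). have p2 := Rabs_pos (fx 0 0). have p3 := Rabs_pos (fy 0 0).
  rewrite /g_polar /g_polar_r => L3 L2 L1; split; first lra.
  apply: Rle_trans (Rabs_triang _ _) _. rewrite !Rabs_mult.
  have := Rabs_pos (fx (r * cos t) (r * sin t)).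
  have := Rabs_pos (fy (r * cos t) (r * sin t)). nra.
Qed.
End GPolar.

(** * The modes of the fundamental solution *)

Section Source.
Variables (alpha rho : R).
Hypothesis Ha : 0 < alpha.
Hypothesis Hrho : 0 < rho.

(** K_0 (alpha |x - y|) as a function of q = |x - y|^2, which is smooth in polar
coordinates, followed by its first two derivatives in q. *)
Definition radial q := K_moment 0 (alpha * sqrt q).
Definition radial_d q := - K_moment 1 (alpha * sqrt q) * (alpha / (2 * sqrt q)).
Definition radial_dd q := K_moment 2 (alpha * sqrt q) * (alpha ^ 2 / (4 * sqrt q ^ 2))
  + K_moment 1 (alpha * sqrt q) * (alpha / (4 * sqrt q ^ 3)).

Lemma scaled_sqrt_derive q : 0 < q -> is_derive (fun q => alpha * sqrt q) q (alpha / (2 * sqrt q)).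
Proof.
move=> Hq; have := sqrt_lt_R0 q Hq => Hs. auto_derive => //. field; lra.
Qed.

Lemma radial_derive q : 0 < q -> is_derive radial q (radial_d q).
Proof.
move=> Hq; have Hs := sqrt_lt_R0 q Hq.
apply: (is_derive_eq _ _ _ _ (is_derive_Rcomp _ _ _ _ _ (K_moment_derive 0 (alpha * sqrt q) ltac:(nra)) (scaled_sqrt_derive q Hq))).
rewrite /radial_d; ring.
Qed.

Lemma radial_d_derive q : 0 < q -> is_derive radial_d q (radial_dd q).
Proof.
move=> Hq; have Hs := sqrt_lt_R0 q Hq.
have D := is_derive_Rcomp _ _ _ _ _ (K_moment_derive 1 (alpha * sqrt q) ltac:(nra)) (scaled_sqrt_derive q Hq).
have D' : is_derive (fun q => alpha / (2 * sqrt q)) q (- alpha / (4 * sqrt q ^ 3)).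
  auto_derive; first by split => //; lra.
  field; lra.
have D2 := is_derive_Rmult _ _ _ _ _ (is_derive_opp _ _ _ D) D'.
apply: (is_derive_eq _ _ _ _ D2). rewrite /radial_dd /opp /=; field; lra.
Qed.

Lemma radial_dd_continuous q : 0 < q -> continuous radial_dd q.
Proof.
move=> Hq; have Hs := sqrt_lt_R0 q Hq.
have D := fun j => is_derive_Rcomp _ _ _ _ _ (K_moment_derive j (alpha * sqrt q) ltac:(nra)) (scaled_sqrt_derive q Hq).
apply: ex_derive_continuous_R. apply: (@ex_derive_plus R_AbsRing R_NormedModule);
  apply: ex_derive_mult; try (by eexists; apply: D); auto_derive; split => //.
- split => //; apply: Rgt_not_eq; nra.
- split => //; apply: Rgt_not_eq; have := pow_lt _ 3 Hs; rewrite /=; lra.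
Qed.

(** The radial Helmholtz equation in the variable q = |x - y|^2 in dimension 2. *)
Lemma radial_ode q : 0 < q -> 4 * radial_d q + 4 * q * radial_dd q = alpha ^ 2 * radial q.
Proof.
move=> Hq; have Hs := sqrt_lt_R0 q Hq.
have E := K_moment_ode (alpha * sqrt q) ltac:(nra).
rewrite /radial_d /radial_dd /radial. rewrite -{3}(sqrt_sqrt q) ?/Rsqr; last lra.
set s := sqrt q in Hs E *.
set k0 := K_moment 0 _ in E *. set k1 := K_moment 1 _ in E *. set k2 := K_moment 2 _ in E *.
transitivity (alpha / s * (alpha * s * k2 - k1)); first by field; lra.
have -> : alpha * s * k2 - k1 = alpha * s * k0 by lra.
field; lra.
Qed.

Definition sqdist r t := r ^ 2 + rho ^ 2 - 2 * r * rho * cos t.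

Lemma sqdist_pos r t : 0 < r < rho -> 0 < sqdist r t.
Proof.
move=> Hr; rewrite /sqdist. have := COS_bound t => Hc.
have : 0 < (rho - r) ^ 2 by apply: pow_lt; lra.
have : 0 <= r * rho * (1 - cos t) by apply: Rmult_le_pos; nra.
nra.
Qed.

Definition source r t := radial (sqdist r t).
Definition source_r r t := (2 * r - 2 * rho * cos t) * radial_d (sqdist r t).
Definition source_rr r t := (2 * r - 2 * rho * cos t) ^ 2 * radial_dd (sqdist r t) + 2 * radial_d (sqdist r t).
Definition source_t r t := (2 * r * rho * sin t) * radial_d (sqdist r t).

Lemma sqdist_dr r t : is_derive (fun r => sqdist r t) r (2 * r - 2 * rho * cos t).
Proof. rewrite /sqdist; auto_derive => //; ring. Qed.
Lemma sqdist_dt r t : is_derive (sqdist r) t (2 * r * rho * sin t).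
Proof. rewrite /sqdist; auto_derive => //; ring. Qed.
Lemma sqdist_continuous r t : continuity_2d_pt sqdist r t.
Proof.
rewrite /sqdist. apply: continuity_2d_pt_minus.
- apply: continuity_2d_pt_plus; last exact: continuity_2d_pt_const.
  apply: (continuity_1d_2d_pt_comp (fun r => r ^ 2) (fun u v => u)); last exact: continuity_2d_pt_id1.
  apply/continuity_pt_filterlim. apply: ex_derive_continuous_R. auto_derive; by [].
- apply: (continuity_2d_pt_ext (fun u v => 2 * rho * (u * cos v))); first by move=> *; ring.
  apply: continuity_2d_pt_mult; [exact: continuity_2d_pt_const|exact: cont2d_cos_r].
Qed.

Lemma sqdist_dr_continuous r t : continuity_2d_pt (fun r t => 2 * r - 2 * rho * cos t) r t.
Proof.
apply: continuity_2d_pt_minus; apply: continuity_2d_pt_mult; try exact: continuity_2d_pt_const.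
- exact: continuity_2d_pt_id1.
- apply: cont2d_1d; exact: continuous_cos.
Qed.

(** The polar Laplacian of F (sqdist r t) is 4 F' + 4 q F'', since the gradient of q has
squared length 4 q and its Laplacian is 4. *)
Lemma source_polar_solution : polar_solution alpha rho source source_r source_rr source_t.
Proof.
have F1c : forall r t, 0 < r < rho -> continuity_2d_pt (fun u v => radial_d (sqdist u v)) r t.
  move=> r t Hh. apply: continuity_1d_2d_pt_comp; last exact: sqdist_continuous.
  apply/continuity_pt_filterlim. apply: is_derive_continuous. apply: radial_d_derive; exact: sqdist_pos.
have F2c : forall r t, 0 < r < rho -> continuity_2d_pt (fun u v => radial_dd (sqdist u v)) r t.
  move=> r t Hh. apply: continuity_1d_2d_pt_comp; last exact: sqdist_continuous.
  apply/continuity_pt_filterlim. apply: radial_dd_continuous; exact: sqdist_pos.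
have Dr : forall (G G' : R -> R) r t, 0 < r < rho -> (forall q, 0 < q -> is_derive G q (G' q)) ->
   is_derive (fun r => G (sqdist r t)) r ((2 * r - 2 * rho * cos t) * G' (sqdist r t)).
  move=> G G' r t Hh HG. apply: (is_derive_Rcomp G (fun r => sqdist r t)); [apply: HG; exact: sqdist_pos|exact: sqdist_dr].
have Dt : forall (G G' : R -> R) r t, 0 < r < rho -> (forall q, 0 < q -> is_derive G q (G' q)) ->
   is_derive (fun t => G (sqdist r t)) t ((2 * r * rho * sin t) * G' (sqdist r t)).
  move=> G G' r t Hh HG. apply: (is_derive_Rcomp G (sqdist r)); [apply: HG; exact: sqdist_pos|exact: sqdist_dt].
have per : forall r t, sqdist r (t + 2 * PI) = sqdist r t by move=> r t; rewrite /sqdist cos_2PI_shift.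
split.
- move=> r t Hh; apply: Dr => // q; exact: radial_derive.
- move=> r t Hh.
  have D1 : is_derive (fun r => 2 * r - 2 * rho * cos t) r 2 by auto_derive => //; ring.
  apply: (is_derive_eq _ _ _ _ (is_derive_Rmult _ _ _ _ _ D1 (Dr radial_d radial_dd r t Hh radial_d_derive))).
  rewrite /source_rr; ring.
- move=> r t Hh; apply: Dt => // q; exact: radial_derive.
- move=> r t Hh.
  have D1 : is_derive (fun t => 2 * r * rho * sin t) t (2 * r * rho * cos t) by auto_derive => //; ring.
  apply: (is_derive_eq _ _ _ _ (is_derive_Rmult _ _ _ _ _ D1 (Dt radial_d radial_dd r t Hh radial_d_derive))).
  rewrite /source /source_rr /source_r -radial_ode; last exact: sqdist_pos.
  have E := sin2_cos2 t. rewrite /Rsqr in E.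
  set f2 := radial_dd _. set f1 := radial_d _.
  have -> : 2 * r * rho * sin t * (2 * r * rho * sin t * f2) = 4 * r ^ 2 * rho ^ 2 * (1 - cos t * cos t) * f2.
    have -> : 1 - cos t * cos t = sin t * sin t by lra. ring.
  rewrite /sqdist; ring.
- move=> r t Hh.
  have D1 : is_derive (fun t => 2 * r - 2 * rho * cos t) t (2 * rho * sin t) by auto_derive => //; ring.
  eexists; exact: (is_derive_Rmult _ _ _ _ _ D1 (Dt radial_d radial_dd r t Hh radial_d_derive)).
- move=> r t Hh. apply: continuity_2d_pt_mult; [exact: sqdist_dr_continuous|exact: F1c].
- move=> r t Hh. apply: continuity_2d_pt_plus; apply: continuity_2d_pt_mult.
  + apply: (continuity_2d_pt_ext (fun r t => (2 * r - 2 * rho * cos t) * (2 * r - 2 * rho * cos t))); first by move=> *; ring.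
    apply: continuity_2d_pt_mult; exact: sqdist_dr_continuous.
  + exact: F2c.
  + exact: continuity_2d_pt_const.
  + exact: F1c.
- move=> r t _; by rewrite /source per.
- move=> r t _; by rewrite /source_r per cos_2PI_shift.
- move=> r t _; by rewrite /source_t per sin_2PI_shift.
- have q0 : 0 < rho ^ 2 by apply: pow_lt.
  have C0 := is_derive_continuous _ _ _ (radial_derive _ q0).
  have C1 := is_derive_continuous _ _ _ (radial_d_derive _ q0).
  have [d0 B0] := proj1 (filterlim_locally _ _) C0 (mkposreal 1 Rlt_0_1).
  have [d1 B1] := proj1 (filterlim_locally _ _) C1 (mkposreal 1 Rlt_0_1).
  have bd : forall (G : R -> R) (d : posreal), (forall y, ball (rho ^ 2) d y -> ball (G (rho ^ 2)) 1 (G y)) ->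
     forall y, Rabs (y - rho ^ 2) < d -> Rabs (G y) <= Rabs (G (rho ^ 2)) + 1.
    move=> G d HG y Hy. have := HG y Hy. rewrite /ball /= /AbsRing_ball /abs /= /minus /plus /opp /= => X.
    have := Rabs_triang_inv (G y) (G (rho ^ 2)). rewrite /Rminus /=. lra.
  have {}B0 := bd radial d0 B0. have {}B1 := bd radial_d d1 B1.
  exists (Rabs (radial (rho ^ 2)) + 1 + 4 * rho * (Rabs (radial_d (rho ^ 2)) + 1)),
    (Rmin rho (Rmin d0 d1 / (3 * rho))).
  have m1 := Rmin_l d0 d1. have m2 := Rmin_r d0 d1.
  have mp : 0 < Rmin d0 d1 by apply: Rmin_pos; exact: cond_pos.
  split; first by apply: Rmin_pos => //; apply: Rdiv_lt_0_compat; lra.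
  move=> r t Hh.
  have n1 := Rmin_l rho (Rmin d0 d1 / (3 * rho)). have n2 := Rmin_r rho (Rmin d0 d1 / (3 * rho)).
  have hc := COS_bound t.
  have qb : Rabs (sqdist r t - rho ^ 2) < Rmin d0 d1.
    have -> : sqdist r t - rho ^ 2 = r * (r - 2 * rho * cos t) by rewrite /sqdist; ring.
    apply: (Rle_lt_trans _ (r * (3 * rho))).
      rewrite Rabs_mult Rabs_pos_eq; last lra. apply: Rmult_le_compat_l; first lra.
      apply: Rabs_le; nra.
    have : r * (3 * rho) < Rmin d0 d1 / (3 * rho) * (3 * rho) by apply: Rmult_lt_compat_r; lra.
    have -> : Rmin d0 d1 / (3 * rho) * (3 * rho) = Rmin d0 d1 by field; lra. by [].
  have L0 := B0 (sqdist r t) ltac:(lra). have L1 := B1 (sqdist r t) ltac:(lra).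
  have p0 := Rabs_pos (radial (rho ^ 2)). have p1 := Rabs_pos (radial_d (rho ^ 2)).
  rewrite /source /source_r; split; first by nra.
  rewrite Rabs_mult.
  have : Rabs (2 * r - 2 * rho * cos t) <= 4 * rho by apply: Rabs_le; nra.
  have := Rabs_pos (2 * r - 2 * rho * cos t). have := Rabs_pos (radial_d (sqdist r t)). 
  set x := Rabs (2 * r - _). set y := Rabs (radial_d (sqdist r t)) in L1 *. move=> y0 x0 xr.
  have : x * y <= 4 * rho * (Rabs (radial_d (rho ^ 2)) + 1) by apply: Rmult_le_compat.
  lra.
Qed.

Lemma source_sin_coef m r : 0 < r < rho -> fourier_coef false m (source r) = 0.
Proof.
move=> Hh. rewrite /fourier_coef.
suff : circle_int (fun t => source r t * trig false m t) = 0 by move=> ->; ring.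
set f := fun t => _.
have cf : circle_cont f.
  apply: circle_cont_mult; last exact: trig_circle_cont. move=> t _; exact: (polar_continuous _ _ _ _ _ _ source_polar_solution).
have : circle_int f = - circle_int f; last lra.
have C := is_RInt_swap _ _ _ _ (@RInt_correct R_CompleteNormedModule f (- PI) PI (circle_cont_ex_RInt _ cf)).
rewrite -{1}(Ropp_involutive PI) in C.
have E := is_RInt_unique _ _ _ _ (is_RInt_comp_opp f (- PI) PI _ C).
have E2 : RInt (fun y => opp (f (- y))) (- PI) PI = circle_int f.
  apply: RInt_ext => t _; rewrite /f /source /sqdist /opp /= /trig cos_neg Ropp_mult_distr_r_reverse sin_neg; ring.
by rewrite -{1}E2 E.
Qed.

Lemma circle_int_pos (f : R -> R) : circle_cont f -> (forall t, -PI < t < PI -> t <> 0 -> 0 < f t) -> 0 < circle_int f.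
Proof.
move=> Hc Hf. have Hpi := PI_RGT_0.
have ex : forall a b, -PI <= a <= b -> b <= PI -> ex_RInt f a b.
  move=> a b Hab Hb; apply: (@ex_RInt_continuous R_CompleteNormedModule) => z.
  rewrite Rmin_left ?Rmax_right; try lra; move=> Hz; apply: Hc; lra.
rewrite /circle_int -(@RInt_Chasles R_CompleteNormedModule f (- PI) 0 PI); try (apply: ex; lra).
apply: Rplus_lt_0_compat; apply: RInt_gt_0; try lra; move=> t Ht; try (apply: Hf; lra); apply: Hc; lra.
Qed.

Variable A : bool -> nat -> R.
Hypothesis HA : forall r, 0 < r < rho ->
  (forall b m, fourier_coef b m (source r) = A b m * BesselI m (alpha * r)) /\
  (forall b m, fourier_coef b m (source_r r) = A b m * (alpha * BesselI_d m (alpha * r))).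

Lemma source_coef_sin m : A false m = 0.
Proof.
have [H _] := HA (rho / 2) ltac:(lra).
have := H false m. rewrite source_sin_coef; last lra.
have := BesselI_pos m (alpha * (rho / 2)) ltac:(nra). move=> P E.
apply: (Rmult_eq_reg_r (BesselI m (alpha * (rho / 2)))); lra.
Qed.

Lemma source_coef0_pos : 0 < A true 0.
Proof.
have [H _] := HA (rho / 2) ltac:(lra).
have E := H true 0%nat.
have P := BesselI_pos 0 (alpha * (rho / 2)) ltac:(nra).
have : 0 < fourier_coef true 0 (source (rho / 2)).
  apply: Rmult_lt_0_compat; first by apply: Rinv_0_lt_compat; exact: PI_RGT_0.
  apply: circle_int_pos.
    apply: circle_cont_mult; last exact: trig_circle_cont. move=> t _; apply: (polar_continuous _ _ _ _ _ _ source_polar_solution); lra.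
  move=> t _ _. rewrite /trig /= Rmult_0_l cos_0 Rmult_1_r. apply: K_moment0_pos.
  have := sqrt_lt_R0 _ (sqdist_pos (rho / 2) t ltac:(lra)); nra.
rewrite E => X; nra.
Qed.

(** Integration by parts turns the coefficient into the integral of
-F' (2 r rho sin^2 t), and F is decreasing. *)
Lemma source_coef1_pos : 0 < A true 1.
Proof.
set r := rho / 2. have Hr : 0 < r < rho by rewrite /r; lra.
have [H _] := HA r Hr. have Hpi := PI_RGT_0.
have E := H true 1%nat.
have P := BesselI_pos 1 (alpha * r) ltac:(nra).
have S := source_polar_solution.
have cH : circle_cont (source r) by move=> t _; exact: (polar_continuous _ _ _ _ _ _ S).
have cT : circle_cont (source_t r).
  move=> t _; apply: is_derive_continuous; exact: (ps_tt _ _ _ _ _ _ S).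
have : 0 < fourier_coef true 1 (source r).
  apply: Rmult_lt_0_compat; first by apply: Rinv_0_lt_compat.
  have Z := circle_int_derive (fun t => source r t * sin t) (fun t => source_t r t * sin t + source r t * trig true 1 t).
  have c1 : circle_cont (fun t => source_t r t * sin t) by apply: circle_cont_mult => //; move=> t _; exact: continuous_sin.
  have c2 : circle_cont (fun t => source r t * trig true 1 t) by apply: circle_cont_mult => //; exact: trig_circle_cont.
  rewrite circle_int_plus // in Z. rewrite sin_neg sin_PI in Z.
  have {}Z : circle_int (fun t => source r t * trig true 1 t) = - circle_int (fun t => source_t r t * sin t).
    have : circle_int (fun t => source_t r t * sin t) + circle_int (fun t => source r t * trig true 1 t) = source r PI * 0 - source r (- PI) * - 0; last lra.
    apply: Z; last exact: circle_cont_plus.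
    move=> t. have Ds : is_derive sin t (cos t) by auto_derive => //; ring.
    apply: (is_derive_eq _ _ _ _ (is_derive_Rmult _ _ _ _ _ (ps_t _ _ _ _ _ _ S r t Hr) Ds)).
    by rewrite /trig /= Rmult_1_l.
  rewrite Z.
  have -> : - circle_int (fun t => source_t r t * sin t) = circle_int (fun t => -1 * (source_t r t * sin t)) by rewrite circle_int_scal //; ring.
  apply: circle_int_pos; first by apply: circle_cont_mult => //; exact: circle_cont_const.
  move=> t Ht Hn. rewrite /source_t /radial_d.
  have s0 := sqrt_lt_R0 _ (sqdist_pos r t Hr).
  have K := K_moment1_pos (alpha * sqrt (sqdist r t)) ltac:(nra).
  have a0 : 0 < alpha / (2 * sqrt (sqdist r t)) by apply: Rdiv_lt_0_compat; lra.
  have sn : 0 < sin t * sin t.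
    have [Hs|Hs] : t < 0 \/ 0 < t by lra.
    - have := sin_gt_0 (- t) ltac:(lra) ltac:(lra). rewrite sin_neg; nra.
    - have := sin_gt_0 t ltac:(lra) ltac:(lra). nra.
  have -> : -1 * (2 * r * rho * sin t * (- K_moment 1 (alpha * sqrt (sqdist r t)) * (alpha / (2 * sqrt (sqdist r t)))) * sin t) =
    (2 * r * rho) * (sin t * sin t) * (K_moment 1 (alpha * sqrt (sqdist r t)) * (alpha / (2 * sqrt (sqdist r t)))) by ring.
  apply: Rmult_lt_0_compat; apply: Rmult_lt_0_compat => //; nra.
rewrite E => X; nra.
Qed.

Lemma trig_prod_sin n t : sin t * trig false (S n) t = / 2 * (trig true n t - trig true (S (S n)) t).
Proof.
rewrite /trig !S_INR.
have -> : INR n * t = (INR n + 1) * t - t by ring.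
have -> : (INR n + 1 + 1) * t = (INR n + 1) * t + t by ring.
rewrite cos_minus cos_plus; field.
Qed.
Lemma trig_prod_cos n t : cos t * trig true (S n) t = / 2 * (trig true n t + trig true (S (S n)) t).
Proof.
rewrite /trig !S_INR.
have -> : INR n * t = (INR n + 1) * t - t by ring.
have -> : (INR n + 1 + 1) * t = (INR n + 1) * t + t by ring.
rewrite cos_minus cos_plus; field.
Qed.

(** The source is invariant under rotations about (rho, 0), which in polar
coordinates about the origin reads
(r - rho cos t) dw/dt = r rho sin t dw/dr.  Integrated against sin ((n + 1) t), this
relates three consecutive coefficients and their radial derivatives at one
radius; the recurrences of I_m eliminate everything but the constants
[A true n] and leave the recurrence of K_n (alpha rho). *)
Lemma source_coef_rec n : A true (S (S n)) = A true n + 2 * INR (S n) / (alpha * rho) * A true (S n).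
Proof.
set r := rho / 2. have Hr : 0 < r < rho by rewrite /r; lra.
have [H H'] := HA r Hr. have Hpi := PI_RGT_0.
have S := source_polar_solution.
have cH : circle_cont (source r) by move=> t _; exact: (polar_continuous _ _ _ _ _ _ S).
have cHr : circle_cont (source_r r) by move=> t _; exact: (polar_continuous_r _ _ _ _ _ _ S).
pose m := INR (Datatypes.S n).
pose T k t := source r t * trig true k t.
pose T' k t := source_r r t * trig true k t.
have cT : forall k, circle_cont (T k) by move=> k; apply: circle_cont_mult => //; exact: trig_circle_cont.
have cT' : forall k, circle_cont (T' k) by move=> k; apply: circle_cont_mult => //; exact: trig_circle_cont.
have cs : forall c f, circle_cont f -> circle_cont (fun t => c * f t) by move=> c f Hf; apply: circle_cont_mult => //; exact: circle_cont_const.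
have Z : circle_int (fun t => r * rho / 2 * (T' n t - T' (Datatypes.S (Datatypes.S n)) t) +
   (rho / 2 * (T n t - T (Datatypes.S (Datatypes.S n)) t) + (m * r * T (Datatypes.S n) t -
     m * rho / 2 * (T n t + T (Datatypes.S (Datatypes.S n)) t)))) = 0.
  rewrite (circle_int_derive (fun t => source r t * ((r - rho * cos t) * trig false (Datatypes.S n) t))).
  - have E := ps_per _ _ _ _ _ _ S r (- PI) Hr.
    have P : - PI + 2 * PI = PI by ring.
    rewrite P in E. rewrite E.
    have -> : trig false (Datatypes.S n) PI = 0.
      apply: sin_eq_0_1; exists (Z.of_nat (Datatypes.S n)); by rewrite -INR_IZR_INZ.
    have -> : trig false (Datatypes.S n) (- PI) = 0.
      apply: sin_eq_0_1; exists (- Z.of_nat (Datatypes.S n))%Z; rewrite opp_IZR -INR_IZR_INZ; ring.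
    ring.
  - move=> t.
    have D1 : is_derive (fun t => r - rho * cos t) t (rho * sin t) by auto_derive => //; ring.
    have D2 := is_derive_Rmult _ _ _ _ _ D1 (trig_derive false (Datatypes.S n) t).
    apply: (is_derive_eq _ _ _ _ (is_derive_Rmult _ _ _ _ _ (ps_t _ _ _ _ _ _ S r t Hr) D2)).
    rewrite /dtrig -/m.
    have -> : source_t r t * ((r - rho * cos t) * trig false (Datatypes.S n) t) =
      source_r r t * (r * rho) * (sin t * trig false (Datatypes.S n) t) by rewrite /source_t /source_r; field.
    have -> : rho * sin t * trig false (Datatypes.S n) t + (r - rho * cos t) * (m * trig true (Datatypes.S n) t)
     = rho * (sin t * trig false (Datatypes.S n) t) + m * r * trig true (Datatypes.S n) t - m * rho * (cos t * trig true (Datatypes.S n) t) by ring.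
    rewrite trig_prod_sin trig_prod_cos /T /T'; field.
  - apply: circle_cont_plus; first by apply: cs; exact: circle_cont_minus.
    apply: circle_cont_plus; first by apply: cs; exact: circle_cont_minus.
    apply: circle_cont_minus; apply: cs => //; exact: circle_cont_plus.
have L : forall c k l, circle_int (fun t => c * (T k t - T l t)) = c * (circle_int (T k) - circle_int (T l)).
  by move=> c k l; rewrite circle_int_scal ?circle_int_minus //; exact: circle_cont_minus.
have L' : forall c k l, circle_int (fun t => c * (T' k t - T' l t)) = c * (circle_int (T' k) - circle_int (T' l)).
  by move=> c k l; rewrite circle_int_scal ?circle_int_minus //; exact: circle_cont_minus.
have Lp : forall c k l, circle_int (fun t => c * (T k t + T l t)) = c * (circle_int (T k) + circle_int (T l)).
  by move=> c k l; rewrite circle_int_scal ?circle_int_plus //; exact: circle_cont_plus.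
have cm : circle_cont (fun t => m * r * T (Datatypes.S n) t - m * rho / 2 * (T n t + T (Datatypes.S (Datatypes.S n)) t)).
  apply: circle_cont_minus; apply: cs => //; exact: circle_cont_plus.
rewrite circle_int_plus in Z; [|by apply: cs; exact: circle_cont_minus|by apply: circle_cont_plus => //; apply: cs; exact: circle_cont_minus].
rewrite circle_int_plus in Z; [|by apply: cs; exact: circle_cont_minus|exact: cm].
rewrite circle_int_minus in Z; [|exact: cs|by apply: cs; exact: circle_cont_plus].
rewrite L L' Lp circle_int_scal // in Z.
have K : forall k, circle_int (T k) = PI * (A true k * BesselI k (alpha * r)).
  move=> k; rewrite -H /fourier_coef -/(T k); field; lra.
have K' : forall k, circle_int (T' k) = PI * (A true k * (alpha * BesselI_d k (alpha * r))).
  move=> k; rewrite -H' /fourier_coef -/(T' k); field; lra.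
rewrite !K !K' in Z.
have x0 : 0 < alpha * r by nra.
have B := BesselI_rec (Datatypes.S n) (alpha * r) x0.
have P := BesselI_pos (Datatypes.S n) (alpha * r) x0.
rewrite /BesselI_d in Z.
have m0 : INR n = m - 1 by rewrite /m S_INR; ring.
have m1 : INR (Datatypes.S (Datatypes.S n)) = m + 1 by rewrite /m S_INR.
rewrite m0 m1 in Z. rewrite m1 in B.
set I0 := BesselI n _ in Z. set I1 := BesselI (Datatypes.S n) _ in Z B P. set I2 := BesselI (Datatypes.S (Datatypes.S n)) _ in Z B.
have E3 : BesselI (Datatypes.S (Datatypes.S (Datatypes.S n))) (alpha * r) = I1 - 2 * (m + 1) / (alpha * r) * I2 by rewrite B; ring.
rewrite E3 in Z.
set a0 := A true n in Z *. set a1 := A true (Datatypes.S n) in Z *. set a2 := A true (Datatypes.S (Datatypes.S n)) in Z *.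
have Y : PI * r * I1 / 2 * (alpha * rho * (a0 - a2) + 2 * m * a1) = 0.
  rewrite -[RHS]Z; field; lra.
have {}Y : alpha * rho * (a0 - a2) + 2 * m * a1 = 0.
  apply: (Rmult_eq_reg_l (PI * r * I1 / 2)); first by rewrite Y; ring.
  apply: Rgt_not_eq. have : 0 < PI * r by nra. nra.
rewrite -/m. have -> : a2 = a0 + (2 * m * a1) / (alpha * rho); last by field; lra.
apply: (Rmult_eq_reg_l (alpha * rho)); last by apply: Rgt_not_eq; nra.
have -> : alpha * rho * (a0 + 2 * m * a1 / (alpha * rho)) = alpha * rho * a0 + 2 * m * a1 by field; lra.
lra.
Qed.

Lemma source_coef_pos n : 0 < A true n.
Proof.
suff : 0 < A true n /\ 0 < A true (S n) by case.
elim: n => [|n [IH1 IH2]]; first by split; [exact: source_coef0_pos|exact: source_coef1_pos].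
split => //; rewrite source_coef_rec.
have : 0 < 2 * INR (S n) / (alpha * rho).
  apply: Rdiv_lt_0_compat; last nra. have : 0 < INR (S n) by apply: lt_0_INR; lia. lra.
nra.
Qed.
End Source.

(** * Discrete orthogonality at the nodes *)

Definition sumN (f : nat -> R) (N : nat) : R := sum_n_m f 1 N.

Lemma sumN_0 f : sumN f 0 = 0.
Proof. rewrite /sumN sum_n_m_zero //; lia. Qed.
Lemma sumN_S f n : sumN f (S n) = sumN f n + f (S n).
Proof. rewrite /sumN sum_n_Sm //; lia. Qed.
Lemma sumN_ext f g N : (forall j, (1 <= j <= N)%nat -> f j = g j) -> sumN f N = sumN g N.
Proof. move=> H; apply: sum_n_m_ext_loc => j Hj; apply: H; lia. Qed.
Lemma sumN_scal c f N : sumN (fun j => c * f j) N = c * sumN f N.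
Proof. elim: N => [|n IH]; rewrite ?sumN_0 ?sumN_S ?IH; ring. Qed.
Lemma sumN_plus f g N : sumN (fun j => f j + g j) N = sumN f N + sumN g N.
Proof. elim: N => [|n IH]; rewrite ?sumN_0 ?sumN_S ?IH; ring. Qed.
Lemma sumN_const0 f N : (forall j, (1 <= j <= N)%nat -> f j = 0) -> sumN f N = 0.
Proof. move=> H; rewrite (sumN_ext _ (fun j => 0 * 0)); last by move=> j Hj; rewrite H //; ring. rewrite sumN_scal; ring. Qed.
Lemma sumN_ge0 f N : (forall j, (1 <= j <= N)%nat -> 0 <= f j) -> 0 <= sumN f N.
Proof.
elim: N => [|n IH] H; first by rewrite sumN_0; lra.
rewrite sumN_S. have := IH ltac:(move=> j Hj; apply: H; lia). have := H (S n) ltac:(lia). lra.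
Qed.
Lemma sumN_term f N : (forall j, (1 <= j <= N)%nat -> 0 <= f j) ->
  forall j, (1 <= j <= N)%nat -> f j <= sumN f N.
Proof.
elim: N => [|n IH] H j Hj; first lia.
rewrite sumN_S. have Hn := H (S n) ltac:(lia).
have H' : forall j, (1 <= j <= n)%nat -> 0 <= f j by move=> i Hi; apply: H; lia.
have := sumN_ge0 f n H' => G.
case: (Nat.eq_dec j (S n)) => [->|Hn']; first lra.
have := IH H' j ltac:(lia). lra.
Qed.

Lemma sumN_series (a : nat -> nat -> R) (l : nat -> R) N :
  (forall j, (1 <= j <= N)%nat -> is_series (a j) (l j)) ->
  is_series (fun m => sumN (fun j => a j m) N) (sumN l N).
Proof.
elim: N => [|n IH] H.
  rewrite sumN_0. apply: (is_series_ext (fun _ => 0)); first by move=> m; rewrite sumN_0.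
  apply: filterlim_ext; last exact: filterlim_const.
  move=> m; elim: m => [|m IHm]; first by rewrite sum_O.
  by rewrite sum_Sn -IHm /plus /= Rplus_0_r.
rewrite sumN_S.
apply: (is_series_ext (fun m => plus (sumN (fun j => a j m) n) (a (S n) m))).
  move=> m; by rewrite sumN_S.
apply: is_series_plus; first by apply: IH => j Hj; apply: H; lia.
apply: H; lia.
Qed.

Definition node (N j : nat) : R := INR j * (2 * PI / INR N).

Lemma cos_sum_tele y n : 2 * sin (y / 2) * sumN (fun j => cos (INR j * y)) n = sin ((INR n + / 2) * y) - sin (y / 2).
Proof.
elim: n => [|n IH].
  rewrite sumN_0 /=. have -> : (0 + / 2) * y = y / 2 by field. ring.
rewrite sumN_S Rmult_plus_distr_l IH S_INR.
have -> : (INR n + / 2) * y = (INR n + 1) * y - y / 2 by field.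
have -> : (INR n + 1 + / 2) * y = (INR n + 1) * y + y / 2 by field.
rewrite sin_plus sin_minus; ring.
Qed.

Lemma sin_sum_tele y n : 2 * sin (y / 2) * sumN (fun j => sin (INR j * y)) n = cos (y / 2) - cos ((INR n + / 2) * y).
Proof.
elim: n => [|n IH].
  rewrite sumN_0 /=. have -> : (0 + / 2) * y = y / 2 by field. ring.
rewrite sumN_S Rmult_plus_distr_l IH S_INR.
have -> : (INR n + / 2) * y = (INR n + 1) * y - y / 2 by field.
have -> : (INR n + 1 + / 2) * y = (INR n + 1) * y + y / 2 by field.
rewrite cos_plus cos_minus; ring.
Qed.

Lemma sin_kpi k : sin (IZR k * PI) = 0.
Proof. apply: sin_eq_0_1; by exists k. Qed.
Lemma cos_2kpi k : cos (2 * (IZR k * PI)) = 1.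
Proof. rewrite cos_2a_sin sin_kpi; ring. Qed.
Lemma sin_2kpi k : sin (2 * (IZR k * PI)) = 0.
Proof. rewrite sin_2a sin_kpi; ring. Qed.
Lemma cos_shift x k : cos (x + 2 * (IZR k * PI)) = cos x.
Proof. rewrite cos_plus cos_2kpi sin_2kpi; ring. Qed.
Lemma sin_shift x k : sin (x + 2 * (IZR k * PI)) = sin x.
Proof. rewrite sin_plus cos_2kpi sin_2kpi; ring. Qed.

Section Nodes.
Variable N : nat.
Hypothesis N1 : (1 <= N)%nat.

Lemma N_pos : 0 < INR N. Proof. apply: lt_0_INR; lia. Qed.

Definition multN (l : Z) := exists z : Z, l = (z * Z.of_nat N)%Z.

Lemma half_angle_zero l : sin (IZR l * (2 * PI / INR N) / 2) = 0 -> multN l.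
Proof.
move=> /sin_eq_0_0 [k Hk]. exists k. have NP := N_pos. have Hpi := PI_RGT_0.
apply: eq_IZR. rewrite mult_IZR -INR_IZR_INZ.
apply: (Rmult_eq_reg_r (PI / INR N)); last by apply: Rgt_not_eq; apply: Rdiv_lt_0_compat.
have -> : IZR k * INR N * (PI / INR N) = IZR k * PI by field; lra.
rewrite -Hk; field; lra.
Qed.

Lemma cos_node_sum l : ~ multN l -> sumN (fun j => cos (IZR l * node N j)) N = 0.
Proof.
move=> Hl. have NP := N_pos.
set y := IZR l * (2 * PI / INR N).
rewrite (sumN_ext _ (fun j => cos (INR j * y))); last by move=> j _; congr cos; rewrite /node /y; ring.
have T := cos_sum_tele y N.
have E : (INR N + / 2) * y = y / 2 + 2 * (IZR l * PI) by rewrite /y; field; lra.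
rewrite E sin_shift Rminus_diag in T.
case: (Rmult_integral _ _ T) => // S0. exfalso; apply: Hl; apply: half_angle_zero.
rewrite -/y; lra.
Qed.

Lemma sin_node_sum l : sumN (fun j => sin (IZR l * node N j)) N = 0.
Proof.
have NP := N_pos.
case: (classic (multN l)) => [[z Hz]|Hl].
  apply: sumN_const0 => j _.
  have -> : IZR l * node N j = 2 * (IZR (z * Z.of_nat j) * PI).
    rewrite Hz !mult_IZR -!INR_IZR_INZ /node; field; lra.
  exact: sin_2kpi.
set y := IZR l * (2 * PI / INR N).
rewrite (sumN_ext _ (fun j => sin (INR j * y))); last by move=> j _; congr sin; rewrite /node /y; ring.
have T := sin_sum_tele y N.
have E : (INR N + / 2) * y = y / 2 + 2 * (IZR l * PI) by rewrite /y; field; lra.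
rewrite E cos_shift Rminus_diag in T.
case: (Rmult_integral _ _ T) => // S0. exfalso; apply: Hl; apply: half_angle_zero.
rewrite -/y; lra.
Qed.

(** The modes that cannot be told apart from [p] at the nodes, up to sign. *)
Definition alias (m p : nat) := multN (Z.of_nat m - Z.of_nat p) \/ multN (Z.of_nat m + Z.of_nat p).
Definition node_dot (b : bool) (m p : nat) := sumN (fun j => trig b m (node N j) * trig b p (node N j)) N.

Lemma node_dot_not_alias b m p : ~ alias m p -> node_dot b m p = 0.
Proof.
move=> H. have H1 : ~ multN (Z.of_nat m - Z.of_nat p) by move=> X; apply: H; left.
have H2 : ~ multN (Z.of_nat m + Z.of_nat p) by move=> X; apply: H; right.
have s : exists s, forall x, trig b m x * trig b p x =
   / 2 * cos (IZR (Z.of_nat m - Z.of_nat p) * x) + s * cos (IZR (Z.of_nat m + Z.of_nat p) * x).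
  exists (if b then / 2 else - / 2) => x.
  rewrite minus_IZR plus_IZR -!INR_IZR_INZ Rmult_minus_distr_r Rmult_plus_distr_r cos_minus cos_plus /trig.
  case: b; field.
case: s => s Hs.
rewrite /node_dot (sumN_ext _ _ N (fun j _ => Hs (node N j))) sumN_plus !sumN_scal !cos_node_sum //; ring.
Qed.

Lemma node_dot_cross m p : sumN (fun j => trig true m (node N j) * trig false p (node N j)) N = 0.
Proof.
have Hs : forall x, trig true m x * trig false p x =
   / 2 * sin (IZR (Z.of_nat p + Z.of_nat m) * x) + / 2 * sin (IZR (Z.of_nat p - Z.of_nat m) * x).
  move=> x; rewrite minus_IZR plus_IZR -!INR_IZR_INZ Rmult_minus_distr_r Rmult_plus_distr_r sin_minus sin_plus /trig; field.
rewrite (sumN_ext _ _ N (fun j _ => Hs (node N j))) sumN_plus !sumN_scal !sin_node_sum; ring.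
Qed.

Lemma alias_trig b m p : alias m p -> exists s, (s = 1 \/ s = -1) /\
  forall j, trig b m (node N j) = s * trig b p (node N j).
Proof.
have NP := N_pos.
case=> -[z Hz].
- exists 1; split; first by left. move=> j. rewrite Rmult_1_l /trig.
  have E : INR m = INR p + IZR z * INR N by rewrite !INR_IZR_INZ -mult_IZR -plus_IZR; congr IZR; lia.
  have -> : INR m * node N j = INR p * node N j + 2 * (IZR (z * Z.of_nat j) * PI).
    rewrite E mult_IZR -INR_IZR_INZ /node; field; lra.
  case: b; [exact: cos_shift|exact: sin_shift].
- exists (if b then 1 else -1); split; first by case: b; [left|right]. move=> j.
  have E : INR m = - INR p + IZR z * INR N by rewrite !INR_IZR_INZ -mult_IZR -opp_IZR -plus_IZR; congr IZR; lia.
  have X : INR m * node N j = - (INR p * node N j) + 2 * (IZR (z * Z.of_nat j) * PI).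
    rewrite E mult_IZR -INR_IZR_INZ /node; field; lra.
  rewrite /trig X; case: b; [rewrite cos_shift cos_neg|rewrite sin_shift sin_neg]; ring.
Qed.

(** A mode in the lower half of the spectrum is the first of its alias class,
and the second one is at least N - p. *)
Lemma alias_far m p : (2 * p <= N)%nat -> alias m p -> m <> p -> (N - p <= m)%nat.
Proof.
move=> Hp [[z Hz]|[z Hz]] Hm.
- have [h|[h|h]] : (z <= -1 \/ z = 0 \/ 1 <= z)%Z by lia.
  + have : (z * Z.of_nat N <= -1 * Z.of_nat N)%Z by apply: Z.mul_le_mono_nonneg_r; lia. lia.
  + subst z; lia.
  + have : (1 * Z.of_nat N <= z * Z.of_nat N)%Z by apply: Z.mul_le_mono_nonneg_r; lia. lia.
- have [h|h] : (z <= 0 \/ 1 <= z)%Z by lia.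
  + have : (z * Z.of_nat N <= 0 * Z.of_nat N)%Z by apply: Z.mul_le_mono_nonneg_r; lia. lia.
  + have : (1 * Z.of_nat N <= z * Z.of_nat N)%Z by apply: Z.mul_le_mono_nonneg_r; lia. lia.
Qed.

(** Fold the remainder of [m] modulo [N] into the lower half. *)
Lemma alias_rep m : exists p, (2 * p <= N)%nat /\ (p <= m)%nat /\ alias m p.
Proof.
have N0 : N <> 0%nat by lia.
have E := Nat.div_mod_eq m N. have B := Nat.mod_upper_bound m N N0.
set q := (m mod N)%nat in E B. set k := (m / N)%nat in E.
case: (le_lt_dec (2 * q) N) => H.
- exists q; split => //; split; first nia. left; exists (Z.of_nat k); nia.
- exists (N - q)%nat; split; first lia. split; first nia. right; exists (Z.of_nat k + 1)%Z; nia.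
Qed.

Lemma node_dot_self_zero b p : node_dot b p p = 0 -> forall j, (1 <= j <= N)%nat -> trig b p (node N j) = 0.
Proof.
move=> H j Hj.
have P : forall j, (1 <= j <= N)%nat -> 0 <= trig b p (node N j) * trig b p (node N j) by move=> i _; exact: Rle_0_sqr.
have X := sumN_term _ N P j Hj. rewrite -/(node_dot b p p) H in X.
have Y := Rle_0_sqr (trig b p (node N j)). rewrite /Rsqr in Y.
have Z : trig b p (node N j) * trig b p (node N j) = 0 by lra.
by case: (Rmult_integral _ _ Z).
Qed.

(** The only modes below N / 2 that are invisible at the nodes vanish
identically. *)
Lemma node_dot_self_zero_mode b p : node_dot b p p = 0 -> (2 * p < N)%nat -> b = false /\ p = 0%nat.
Proof.
move=> /node_dot_self_zero H Hp. have NP := N_pos. have Hpi := PI_RGT_0.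
case: b H => H.
  have := H N ltac:(lia). rewrite /trig /node.
  have -> : INR p * (INR N * (2 * PI / INR N)) = 2 * (IZR (Z.of_nat p) * PI).
    rewrite -INR_IZR_INZ; field; lra.
  rewrite cos_2kpi; lra.
split => //. case: p Hp H => // p Hp H. exfalso.
have := H 1%nat ltac:(lia). rewrite /trig /node Rmult_1_l => E.
have p0 : 0 < INR (S p) by apply: lt_0_INR; lia.
have p1 : 2 * INR (S p) < INR N.
  have := lt_INR _ _ Hp. by rewrite mult_INR.
have : 0 < sin (INR (S p) * (2 * PI / INR N)); last lra.
have E2 : INR (S p) * (2 * PI / INR N) = PI * (2 * INR (S p) / INR N) by field; lra.
have q0 : 0 < 2 * INR (S p) / INR N by apply: Rdiv_lt_0_compat; lra.
have q1 : 2 * INR (S p) / INR N < 1.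
  apply: (Rmult_lt_reg_r (INR N)) => //. have -> : 2 * INR (S p) / INR N * INR N = 2 * INR (S p) by field; lra. lra.
rewrite E2; apply: sin_gt_0; nra.
Qed.

End Nodes.

(** * Aliasing *)

(** Stated with an index [n0] below which the terms vanish, because the series
over an alias class start late. *)
Lemma geom_tail_bound (t : nat -> R) l K q n0 : 0 <= K -> 0 < q < 1 -> is_series t l ->
  (forall m, (m < n0)%nat -> t m = 0) -> (forall m, (n0 <= m)%nat -> Rabs (t m) <= K * q ^ m) ->
  Rabs l <= K * q ^ n0 / (1 - q).
Proof.
move=> HK Hq Hs H0 Hb.
have qp : forall n, 0 < q ^ n by move=> n; apply: pow_lt; lra.
have B : forall n, (n < n0)%nat /\ sum_n t n = 0 \/
   (n0 <= n)%nat /\ Rabs (sum_n t n) <= K * (q ^ n0 - q ^ S n) / (1 - q).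
  elim => [|n IH].
    rewrite sum_O. case: (le_lt_dec n0 0) => h; [right|left].
      split => //. apply: Rle_trans (Hb 0%nat h) _. have -> : n0 = 0%nat by lia.
      right; rewrite /=; field; lra.
    split => //; exact: H0.
  rewrite sum_Sn /plus /=. case: (le_lt_dec n0 (S n)) => h; last first.
    left; split => //. case: IH => [[_ ->]|[h' _]]; last lia. rewrite H0 //; ring.
  right; split => //. have X := Hb (S n) h. case: IH => [[h' ->]|[h' IH]].
    rewrite Rplus_0_l. have -> : n0 = S n by lia. apply: Rle_trans X _.
    right; rewrite /=; field; lra.
  apply: Rle_trans (Rabs_triang _ _) _.
  apply: (Rle_trans _ (K * (q ^ n0 - q ^ S n) / (1 - q) + K * q ^ S n)); first exact: Rplus_le_compat.
  right; rewrite /=; field; lra.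
have B2 : forall n, Rabs (sum_n t n) <= K * q ^ n0 / (1 - q).
  have i0 : 0 < / (1 - q) by apply: Rinv_0_lt_compat; lra.
  move=> n; case: (B n) => [[_ ->]|[_ h]].
    rewrite Rabs_R0. have := qp n0 => ?. apply: Rmult_le_pos; last lra. nra.
  apply: Rle_trans h _. apply: Rmult_le_compat_r; first lra.
  apply: Rmult_le_compat_l => //. have := qp (S n); lra.
have L := is_lim_seq_abs _ _ (Hs : is_lim_seq (sum_n t) l).
exact: (is_lim_seq_le _ _ (Rabs l) _ B2 L (is_lim_seq_const _)).
Qed.

Lemma is_series_delta (p : nat) (c : R) : is_series (fun m => if Nat.eqb m p then c else 0) c.
Proof.
have E : forall n, (p <= n)%nat -> sum_n (fun m => if Nat.eqb m p then c else 0) n = c.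
  have Z : forall n, (n < p)%nat -> sum_n (fun m => if Nat.eqb m p then c else 0) n = 0.
    elim => [|n IH] h.
      rewrite sum_O. case: (Nat.eqb_spec 0 p) => //; lia.
    rewrite sum_Sn IH; last lia. case: (Nat.eqb_spec (S n) p) => ?; first lia. exact: Rplus_0_r.
  elim => [|n IH] h.
    rewrite sum_O. case: (Nat.eqb_spec 0 p) => //; lia.
  rewrite sum_Sn. case: (Nat.eqb_spec (S n) p) => e.
    rewrite Z; last lia. exact: Rplus_0_l.
  rewrite IH; last lia. exact: Rplus_0_r.
have L : is_lim_seq (sum_n (fun m => if Nat.eqb m p then c else 0)) c; last exact: L.
apply: (is_lim_seq_ext_loc (fun _ => c)); last exact: is_lim_seq_const.
exists p => n hn; by rewrite E.
Qed.

Lemma series_term_bound (t : nat -> R) l p : is_series t l -> (forall m, 0 <= t m) -> t p <= l.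
Proof.
move=> Hs H.
have B : forall n, (p <= n)%nat -> t p <= sum_n t n.
  have Z : forall n, 0 <= sum_n t n.
    elim => [|n IH]; first by rewrite sum_O.
    rewrite sum_Sn /plus /=; have := H (S n); lra.
  elim => [|n IH] h.
    have -> : p = 0%nat by lia. rewrite sum_O; lra.
  rewrite sum_Sn /plus /=. case: (Nat.eq_dec p (S n)) => [->|e].
    have := Z n; lra.
  have := IH ltac:(lia). have := H (S n); lra.
have L : Rbar_le (t p) l; last exact: L.
apply: (is_lim_seq_le_loc (fun _ => t p) (sum_n t) (t p) l).
- exists p => n hn; exact: B.
- exact: is_lim_seq_const.
- exact: Hs.
Qed.

Lemma is_series_Rminus (t u : nat -> R) (l l' : R) : is_series t l -> is_series u l' ->
  is_series (fun m => t m - u m) (l - l').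
Proof. exact: (@is_series_minus R_AbsRing R_NormedModule). Qed.
Lemma is_series_Rscal (c : R) (t : nat -> R) (l : R) : is_series t l -> is_series (fun m => c * t m) (c * l).
Proof. exact: (@is_series_scal R_AbsRing R_NormedModule). Qed.
Lemma is_series_eq (t u : nat -> R) (l l' : R) : is_series t l -> (forall m, t m = u m) -> l = l' ->
  is_series u l'.
Proof. by move=> H E <-; apply: is_series_ext H. Qed.

(** The setting shared by the estimates that follow: [d] are the normal
derivatives of the modes, [k] the coefficients of the source and [A] those
of the solution, [P] is the discrete Fourier transform of the charges, and
[X] collects the mode coefficients of the error of the normal derivative,
which [colloc] makes vanish at the nodes. *)
Section Discrete.
Variables (d k : nat -> R) (mu K1 : R).
Hypothesis Hmu : 0 < mu < 1.
Hypothesis HK1 : 0 <= K1.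
Hypothesis dpos : forall m, 0 < d m.
Hypothesis kpos : forall m, 0 < k m.
Let w m := mode_weight m * d m.
Let bb m := w m * k m.
Hypothesis ratio : forall n m, (n <= m)%nat -> bb m <= K1 * mu ^ (m - n) * bb n.

Variables (N : nat) (Q : nat -> R) (A : bool -> nat -> R) (M : R).
Hypothesis N1 : (1 <= N)%nat.
Hypothesis HA : forall b m, w m * Rabs (A b m) <= M * mu ^ m.
Let P b m := sumN (fun j => Q j * trig b m (node N j)) N.
Let X b m := w m * (A b m - k m * P b m).
Hypothesis colloc : forall j, (1 <= j <= N)%nat ->
  is_series (fun m => X true m * trig true m (node N j) + X false m * trig false m (node N j)) 0.

Lemma mode_weight_bounds m : 0 < mode_weight m <= 1. Proof. case: m => [|m] /=; lra. Qed.
Lemma w_pos m : 0 < w m. Proof. apply: Rmult_lt_0_compat; [apply mode_weight_bounds|exact: dpos]. Qed.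
Lemma bb_pos m : 0 < bb m. Proof. apply: Rmult_lt_0_compat; [exact: w_pos|exact: kpos]. Qed.
Lemma mu_pow_pos n : 0 < mu ^ n. Proof. apply: pow_lt; lra. Qed.
Lemma M_pos : 0 <= M.
Proof. have := HA true 0. have := w_pos 0. have := Rabs_pos (A true 0). rewrite /=; nra. Qed.

Lemma project b p : is_series (fun m => X b m * node_dot N b m p) 0.
Proof.
have S : is_series (fun m => sumN (fun j => trig b p (node N j) *
  (X true m * trig true m (node N j) + X false m * trig false m (node N j))) N) (sumN (fun j => trig b p (node N j) * 0) N).
  apply: sumN_series => j Hj. apply: (is_series_scal (trig b p (node N j)) _ 0); exact: colloc.
rewrite (sumN_const0 (fun j => trig b p (node N j) * 0)) in S; last by move=> *; ring.
apply: is_series_ext S => m.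
rewrite /node_dot -sumN_scal.
have C : forall c, sumN (fun j => c * (trig true m (node N j) * trig false p (node N j))) N = 0.
  move=> c; rewrite sumN_scal node_dot_cross //; ring.
have C' : forall c, sumN (fun j => c * (trig true p (node N j) * trig false m (node N j))) N = 0.
  move=> c; rewrite sumN_scal node_dot_cross //; ring.
case: b.
- rewrite -[RHS]Rplus_0_r -(C' (X false m)) -sumN_plus; apply: sumN_ext => j _; ring.
- rewrite -[RHS]Rplus_0_r -(C (X true m)) -sumN_plus; apply: sumN_ext => j _; ring.
Qed.

(** Projection on the mode [p], normalised to have coefficient 1 there.  All other
coefficients are 0 or a sign, and by the fourth clause the sign is absorbed by
the charges: they contribute P_p times a nonnegative weight. *)
Lemma project_sign b p : (2 * p <= N)%nat -> node_dot N b p p <> 0 ->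
  exists e : nat -> R, e p = 1 /\ (forall m, Rabs (e m) <= 1) /\
    (forall m, e m <> 0 -> m <> p -> (N - p <= m)%nat) /\
    (forall m, P b m * e m = P b p * (e m * e m)) /\
    is_series (fun m => X b m * e m) 0.
Proof.
move=> Hp H0. exists (fun m => node_dot N b m p / node_dot N b p p).
have key : forall m, node_dot N b m p / node_dot N b p p = 0 \/
   alias N m p /\ exists s, (s = 1 \/ s = -1) /\ node_dot N b m p / node_dot N b p p = s /\ P b m = s * P b p.
  move=> m. case: (classic (alias N m p)) => H; last first.
    left; rewrite node_dot_not_alias // /Rdiv; ring.
  right; split => //. have [s [Hs E]] := alias_trig N N1 b m p H.
  exists s; split => //; split.
  - have -> : node_dot N b m p = s * node_dot N b p p.
      rewrite /node_dot -sumN_scal; apply: sumN_ext => j _; rewrite E; ring.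
    field; exact: H0.
  - rewrite /P -sumN_scal; apply: sumN_ext => j _; rewrite E; ring.
split; [by field|split; [|split; [|split]]].
- move=> m; case: (key m) => [->|[_ [s [Hs [-> _]]]]]; first by rewrite Rabs_R0; lra.
  case: Hs => ->; first by rewrite Rabs_R1; lra.
  rewrite Rabs_left; lra.
- move=> m Hm Hn; case: (key m) => [//|[Ha _]]. exact: (alias_far N N1).
- move=> m; case: (key m) => [->|[_ [s [Hs [-> ->]]]]]; first by ring.
  case: Hs => ->; ring.
- apply: (is_series_eq _ _ _ _ (is_series_Rscal (/ node_dot N b p p) _ _ (project b p))); last by ring.
  move=> m; rewrite /Rdiv; ring.
Qed.

(** All charge contributions to the projected equation have the sign of P_p, so the
single one of index p is bounded by the part that comes from the solution. *)
Lemma source_part_bound_low b p : (2 * p <= N)%nat -> bb p * Rabs (P b p) <= M * mu ^ p / (1 - mu).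
Proof.
move=> Hp. have MM := M_pos. have mp := mu_pow_pos p.
case: (Req_dec (node_dot N b p p) 0) => H0.
  have -> : P b p = 0.
    apply: sumN_const0 => j Hj; rewrite (node_dot_self_zero N b p H0) //; ring.
  rewrite Rabs_R0 Rmult_0_r. apply: Rmult_le_pos; first nra.
  left; apply: Rinv_0_lt_compat; lra.
have [e [ep [e1 [ef [eP eX]]]]] := project_sign b p Hp H0.
(* The part of the projected equation that comes from the solution. *)
pose Y m := w m * A b m * e m.
have Yb : forall m, Rabs (Y m) <= M * mu ^ m.
  move=> m; rewrite /Y (Rabs_mult (_ * _)) (Rabs_mult (w m)) (Rabs_pos_eq (w m)); last by left; exact: w_pos.
  apply: Rle_trans (HA b m).
  have := e1 m. have := Rabs_pos (e m). have : 0 <= w m * Rabs (A b m).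
    apply: Rmult_le_pos; [left; exact: w_pos|exact: Rabs_pos].
  nra.
have [y Hy] : exists y, is_series Y y.
  have : ex_series Y; last by [].
  apply: (ex_series_le Y (fun m => M * mu ^ m)); first exact: Yb.
  apply: (ex_series_scal M); apply: ex_series_geom; rewrite Rabs_pos_eq; lra.
have yB : Rabs y <= M * mu ^ p / (1 - mu).
  apply: (geom_tail_bound Y) => // m Hm.
  rewrite /Y. case: (Req_dec (e m) 0) => [->|He]; first by ring.
  have := ef m He. lia.
have Z : is_series (fun m => P b p * (bb m * (e m * e m))) y.
  apply: (is_series_eq _ _ _ _ (is_series_Rminus _ _ _ _ Hy eX)); last by ring.
  move=> m. rewrite /Y /X /bb.
  transitivity (w m * k m * (P b m * e m)); first by ring. rewrite eP; ring.
have sq : forall m, 0 <= bb m * (e m * e m).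
  move=> m; apply: Rmult_le_pos; [left; exact: bb_pos|exact: Rle_0_sqr].
apply: Rle_trans yB.
have [Hs|Hs] := Rle_dec 0 (P b p).
- rewrite (Rabs_pos_eq (P b p)) //. apply: Rle_trans (Rle_abs y).
  have := series_term_bound _ _ p Z. rewrite ep => B.
  have -> : bb p * P b p = P b p * (bb p * (1 * 1)) by ring.
  apply: B => m; exact: Rmult_le_pos.
- rewrite (Rabs_left1 (P b p)); last lra. rewrite -(Rabs_Ropp y). apply: Rle_trans (Rle_abs (- y)).
  have Z2 := is_series_Rscal (-1) _ _ Z.
  have := series_term_bound _ _ p Z2. rewrite ep => B.
  have -> : bb p * - P b p = -1 * (P b p * (bb p * (1 * 1))) by ring.
  have -> : - y = -1 * y by ring.
  apply: B => m. have := sq m; nra.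
Qed.

(** Aliasing turns the mode [m] into its representative in the lower half; the
ratio bound on [bb] compares the two. *)
Lemma source_part_bound b m : bb m * Rabs (P b m) <= K1 / (1 - mu) * M * mu ^ m.
Proof.
have [p [Hp [Hpm Ha]]] := alias_rep N N1 m.
have [s [Hs E]] := alias_trig N N1 b m p Ha.
have EP : Rabs (P b m) = Rabs (P b p).
  have -> : P b m = s * P b p by rewrite /P -sumN_scal; apply: sumN_ext => j _; rewrite E; ring.
  rewrite Rabs_mult. case: Hs => ->; rewrite ?Rabs_Ropp ?Rabs_R1 ?Rmult_1_l //.
rewrite EP.
have B := source_part_bound_low b p Hp. have R := ratio p m Hpm.
have ap := Rabs_pos (P b p).
apply: (Rle_trans _ (K1 * mu ^ (m - p) * bb p * Rabs (P b p))); first exact: Rmult_le_compat_r.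
have -> : K1 * mu ^ (m - p) * bb p * Rabs (P b p) = K1 * mu ^ (m - p) * (bb p * Rabs (P b p)) by ring.
have -> : K1 / (1 - mu) * M * mu ^ m = K1 * mu ^ (m - p) * (M * mu ^ p / (1 - mu)).
  have {1}-> : m = (m - p + p)%nat by lia. rewrite pow_add; field; lra.
apply: Rmult_le_compat_l => //. apply: Rmult_le_pos => //; left; exact: mu_pow_pos.
Qed.

Lemma mode_error_bound b m : Rabs (X b m) <= (1 + K1 / (1 - mu)) * M * mu ^ m.
Proof.
have -> : X b m = w m * A b m + - (bb m * P b m) by rewrite /X /bb; ring.
apply: Rle_trans (Rabs_triang _ _) _. rewrite Rabs_Ropp (Rabs_mult (w m)) (Rabs_mult (bb m)).
rewrite (Rabs_pos_eq (w m)); last by left; exact: w_pos.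
rewrite (Rabs_pos_eq (bb m)); last by left; exact: bb_pos.
have := HA b m. have := source_part_bound b m. lra.
Qed.

(** One geometric series comes from bounding the charges, the other from the tail
of the alias class. *)
Definition alias_const := (1 + K1 / (1 - mu)) / (1 - mu).

(** For modes above N / 2 both parts of the error are already small.  Below N / 2
the projected equation expresses the error of the mode by the errors of its
aliases, all of index at least N - m.  A mode that vanishes at all nodes
escapes the equation, but below N / 2 it vanishes identically. *)
Theorem aliased_mode_error_bound b m x :
  Rabs (X b m * trig b m x) <= alias_const * M * mu ^ (Nat.max m (N - m)).
Proof.
have i0 : 0 < 1 - mu by lra.
have C0 : 0 <= 1 + K1 / (1 - mu).
  have : 0 <= K1 / (1 - mu); last lra. apply: Rmult_le_pos => //; left; exact: Rinv_0_lt_compat.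
have CK : 1 + K1 / (1 - mu) <= alias_const.
  rewrite /alias_const. apply: (Rmult_le_reg_r (1 - mu)) => //.
  have -> : (1 + K1 / (1 - mu)) / (1 - mu) * (1 - mu) = 1 + K1 / (1 - mu) by field; lra. nra.
have MM := M_pos.
have T := trig_bound b m x. have a0 := Rabs_pos (X b m). have b0 := Rabs_pos (trig b m x).
have XT : Rabs (X b m * trig b m x) <= Rabs (X b m) by rewrite Rabs_mult; nra.
have simple : Rabs (X b m) <= alias_const * M * mu ^ m.
  apply: Rle_trans (mode_error_bound b m) _. apply: Rmult_le_compat_r; first by left; exact: mu_pow_pos.
  exact: Rmult_le_compat_r.
case: (le_lt_dec N (2 * m)) => h.
  have -> : Nat.max m (N - m) = m by lia. exact: Rle_trans XT simple.
have -> : Nat.max m (N - m) = (N - m)%nat by lia.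
case: (Req_dec (node_dot N b m m) 0) => H0.
  have [-> ->] := node_dot_self_zero_mode N N1 b m H0 h.
  rewrite /trig /= Rmult_0_l sin_0 Rmult_0_r Rabs_R0.
  apply: Rmult_le_pos; last by left; exact: mu_pow_pos. nra.
apply: Rle_trans XT _.
have [e [ep [e1 [ef [eP eX]]]]] := project_sign b m ltac:(lia) H0.
have D := is_series_delta m (X b m).
(* Isolate the term of index m, where e is 1. *)
have S := is_series_Rminus _ _ _ _ D eX. rewrite Rminus_0_r in S.
have G := geom_tail_bound _ _ ((1 + K1 / (1 - mu)) * M) mu (N - m) _ Hmu S.
have -> : alias_const * M * mu ^ (N - m) = (1 + K1 / (1 - mu)) * M * mu ^ (N - m) / (1 - mu).
  rewrite /alias_const; field; lra.
apply: G.
- exact: Rmult_le_pos.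
- move=> i Hi. case: (Nat.eqb_spec i m) => [->|n]; first by rewrite ep; ring.
  case: (Req_dec (e i) 0) => [->|He]; first by ring.
  have := ef i He n; lia.
- move=> i Hi. case: (Nat.eqb_spec i m) => [->|n].
    rewrite ep Rmult_1_r Rminus_diag Rabs_R0.
    apply: Rmult_le_pos; last by left; exact: mu_pow_pos. exact: Rmult_le_pos.
  rewrite Rminus_0_l Rabs_Ropp (Rabs_mult (X b i)). apply: Rle_trans (mode_error_bound b i).
  have := e1 i; have := Rabs_pos (e i); have := Rabs_pos (X b i); nra.
Qed.
End Discrete.

(** * Geometric decay of the modes *)

(** An eventual ratio bound is carried down to index 0 one step at a time, each
step enlarging the constant. *)
Lemma eventually_geometric (e : nat -> R) lam m0 : (forall m, 0 < e m) -> 0 < lam ->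
  (forall m, (m0 <= m)%nat -> e (S m) <= lam * e m) ->
  exists C, 0 < C /\ forall n m, (n <= m)%nat -> e m <= C * lam ^ (m - n) * e n.
Proof.
move=> He Hl H.
suff K : forall i, (i <= m0)%nat -> exists C, 1 <= C /\
    forall n m, (m0 - i <= n)%nat -> (n <= m)%nat -> e m <= C * lam ^ (m - n) * e n.
  have [C [HC X]] := K m0 (Nat.le_refl _). exists C; split; first lra.
  move=> n m Hnm; apply: X => //; lia.
elim => [|i IH] Hi.
  exists 1; split; first lra. move=> n m Hn. elim: m => [|m IHm] Hm.
    have -> : n = 0%nat by lia. rewrite /=; lra.
  case: (Nat.eq_dec n (S m)) => [->|Hne].
    rewrite Nat.sub_diag /=; lra.
  have {}IHm := IHm ltac:(lia). have X := H m ltac:(lia).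
  have -> : (S m - n)%nat = S (m - n) by lia. rewrite [_ ^ S _]/=. nra.
have [C [HC X]] := IH ltac:(lia).
pose j := (m0 - S i)%nat.
have Sj : S j = (m0 - i)%nat by rewrite /j; lia.
pose C' := C * (1 + e (S j) / (lam * e j)).
have q0 : 0 < e (S j) / (lam * e j) by apply: Rdiv_lt_0_compat => //; apply: Rmult_lt_0_compat.
have CC' : C <= C' by rewrite /C'; nra.
exists C'; split; first lra.
move=> n m Hn Hm. have lp : 0 < lam ^ (m - n) by apply: pow_lt.
case: (Nat.eq_dec n j) => [E|Hne]; last first.
  apply: Rle_trans (X n m ltac:(lia) Hm) _.
  apply: Rmult_le_compat_r; first by left; exact: He.
  apply: Rmult_le_compat_r; lra.
subst n. case: (Nat.eq_dec m j) => [->|Hmj].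
  rewrite Nat.sub_diag /=. have := He j; nra.
apply: Rle_trans (X (S j) m ltac:(lia) ltac:(lia)) _.
have -> : (m - j)%nat = S (m - S j) by lia. rewrite [_ ^ S _]/=.
have lp' : 0 < lam ^ (m - S j) by apply: pow_lt.
have E : e (S j) = e (S j) / (lam * e j) * (lam * e j) by field; split; apply: Rgt_not_eq.
have ej := He j.
have -> : C' * (lam * lam ^ (m - S j)) * e j = C * lam ^ (m - S j) * ((1 + e (S j) / (lam * e j)) * (lam * e j)) by rewrite /C'; ring.
apply: Rmult_le_compat_l; first by apply: Rmult_le_pos; lra.
rewrite {1}E. have : 0 < lam * e j by apply: Rmult_lt_0_compat. nra.
Qed.

(** Bernoulli's inequality for 1 / s. *)
Lemma linear_geometric s : 0 < s < 1 -> exists C, 0 < C /\ forall m, (INR m + 1) * s ^ m <= C.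
Proof.
move=> Hs. pose h := / s - 1.
have h0 : 0 < h.
  rewrite /h. have : 1 < / s; last lra. rewrite -Rinv_1; apply: Rinv_lt_contravar; lra.
exists (1 + / h). have ih : 0 < / h by apply: Rinv_0_lt_compat.
split; first lra. move=> m.
have B := poly m h h0.
have E : (1 + h) ^ m * s ^ m = 1.
  rewrite -Rpow_mult_distr. have -> : (1 + h) * s = 1 by rewrite /h; field; lra. exact: pow1.
have sp : 0 < s ^ m by apply: pow_lt; lra.
have m0 := pos_INR m.
have L : (INR m + 1) <= (1 + / h) * (1 + INR m * h).
  have : / h * h = 1 by field; lra. nra.
have : (1 + INR m * h) * s ^ m <= 1 by rewrite -E; apply: Rmult_le_compat_r; lra.
nra.
Qed.

Section BesselConst.
Variable x : R.
Hypothesis x0 : 0 < x.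

Lemma BesselI_d_pos m : 0 < BesselI_d m x.
Proof.
rewrite /BesselI_d. have := BesselI_pos m x x0. have := BesselI_pos (S m) x x0. have := pos_INR m => h a b.
have : 0 <= INR m / x by apply: Rmult_le_pos => //; left; exact: Rinv_0_lt_compat. nra.
Qed.

Lemma BesselI_d_upper m : BesselI_d m x <= (/ x + x / 2) * ((INR m + 1) * BesselI m x).
Proof.
rewrite /BesselI_d. have P := BesselI_pos m x x0. have Rt := BesselI_ratio m x x0. have h := pos_INR m.
rewrite S_INR in Rt. have ix := Rinv_0_lt_compat _ x0.
have : x / (2 * (INR m + 1)) <= x / 2.
  apply: Rmult_le_compat_l; first lra. apply: Rinv_le_contravar; lra.
move=> L. have T : BesselI (S m) x <= x / 2 * BesselI m x by nra.
have U : INR m / x * BesselI m x <= / x * ((INR m + 1) * BesselI m x).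
  rewrite /Rdiv (Rmult_comm _ (/ x)) Rmult_assoc. apply: Rmult_le_compat_l; nra.
have V : x / 2 * BesselI m x <= x / 2 * ((INR m + 1) * BesselI m x).
  apply: Rmult_le_compat_l; nra.
lra.
Qed.

Lemma BesselI_d_lower : exists C, 0 < C /\ forall m, (INR m + 1) * BesselI m x <= C * BesselI_d m x.
Proof.
have P0 := BesselI_pos 0 x x0. have P1 := BesselI_pos 1 x x0.
exists (2 * x + BesselI 0 x / BesselI 1 x). have q : 0 < BesselI 0 x / BesselI 1 x by apply: Rdiv_lt_0_compat.
split; first lra. case=> [|m].
  rewrite /BesselI_d /=. have -> : 0 / x * BesselI 0 x + BesselI 1 x = BesselI 1 x by field; lra.
  have : BesselI 0 x / BesselI 1 x * BesselI 1 x = BesselI 0 x by field; lra. nra.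
have D := BesselI_d_pos (S m). have P := BesselI_pos (S m) x x0. have P2 := BesselI_pos (S (S m)) x x0.
have h : 1 <= INR (S m) by apply: (le_INR 1); lia.
apply: (Rle_trans _ (2 * x * BesselI_d (S m) x)); last by nra.
have -> : 2 * x * BesselI_d (S m) x = 2 * INR (S m) * BesselI (S m) x + 2 * x * BesselI (S (S m)) x by rewrite /BesselI_d; field; lra.
nra.
Qed.

Variables (z : R) (k : nat -> R).
Hypothesis z0 : x < z.
Hypothesis kp : forall m, 0 < k m.
Hypothesis krec : forall n, k (S (S n)) = k n + 2 * INR (S n) / z * k (S n).

Let e m := (INR m + 1) * (k m * BesselI m x).

Lemma mode_size_pos m : 0 < e m.
Proof.
apply: Rmult_lt_0_compat; first by have := pos_INR m; lra.
apply: Rmult_lt_0_compat => //; exact: BesselI_pos.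
Qed.

(** The recurrence of [k] gives k_(m+2) / k_(m+1) close to 2 (m + 1) / z, and the ratio of the
Bessel functions is at most x / (2 (m + 2)); the factor m + 1 in the definition
of [e] accounts for the derivative of the modes. *)
Lemma mode_size_ratio m : (1 <= m)%nat -> e (S (S m)) <= x / z * (1 + z ^ 2 / (4 * INR m)) * e (S m).
Proof.
move=> Hm. have h : 1 <= INR m by apply: (le_INR 1).
have zp : 0 < z by lra.
have k1 : k m <= z / (2 * INR m) * k (S m).
  case: m Hm h => [|m] Hm h; first lia.
  have E := krec m. rewrite E. have a := kp m. have b := kp (S m).
  have -> : z / (2 * INR (S m)) * (k m + 2 * INR (S m) / z * k (S m)) = k (S m) + z / (2 * INR (S m)) * k m by field; lra.
  have : 0 < z / (2 * INR (S m)) by apply: Rdiv_lt_0_compat; lra. nra.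
have k2 : k (S (S m)) <= (z / (2 * INR m) + 2 * (INR m + 1) / z) * k (S m).
  rewrite krec S_INR; lra.
have b2 := BesselI_ratio (S m) x x0. rewrite !S_INR in b2.
have P := BesselI_pos (S m) x x0. have P2 := BesselI_pos (S (S m)) x x0. have a := kp (S m). have a2 := kp (S (S m)).
rewrite /e !S_INR. set n := INR m in h k1 k2 b2 *.
apply: (Rle_trans _ ((n + 1 + 1 + 1) * (((z / (2 * n) + 2 * (n + 1) / z) * k (S m)) * (x / (2 * (n + 1 + 1)) * BesselI (S m) x)))).
  apply: Rmult_le_compat_l; first lra. apply: Rmult_le_compat; lra.
have -> : (n + 1 + 1 + 1) * (((z / (2 * n) + 2 * (n + 1) / z) * k (S m)) * (x / (2 * (n + 1 + 1)) * BesselI (S m) x)) =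
  x / z * (((n + 3) * (n + 1) / ((n + 2))) * (1 + z ^ 2 / (4 * (n * (n + 1))))) * (k (S m) * BesselI (S m) x) by field; lra.
have -> : x / z * (1 + z ^ 2 / (4 * n)) * ((n + 1 + 1) * (k (S m) * BesselI (S m) x)) =
  x / z * ((n + 2) * (1 + z ^ 2 / (4 * n))) * (k (S m) * BesselI (S m) x) by ring.
apply: Rmult_le_compat_r; first by left; apply: Rmult_lt_0_compat.
apply: Rmult_le_compat_l; first by left; apply: Rdiv_lt_0_compat.
have z2 : 0 <= z ^ 2 by exact: pow2_ge_0.
apply: Rmult_le_compat.
- apply: Rmult_le_pos; first nra. left; apply: Rinv_0_lt_compat; lra.
- have : 0 <= z ^ 2 / (4 * (n * (n + 1))); last lra.
  apply: Rmult_le_pos => //; left; apply: Rinv_0_lt_compat; nra.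
- apply: (Rmult_le_reg_r (n + 2)); first lra.
  have -> : (n + 3) * (n + 1) / (n + 2) * (n + 2) = (n + 3) * (n + 1) by field; lra. nra.
- apply: Rplus_le_compat_l. apply: Rmult_le_compat_l => //.
  apply: Rinv_le_contravar; nra.
Qed.

Lemma mode_size_geometric : exists lam C, 0 < lam < 1 /\ 0 < C /\
  forall n m, (n <= m)%nat -> e m <= C * lam ^ (m - n) * e n.
Proof.
have zp : 0 < z by lra.
have q1 : x / z < 1.
  apply: (Rmult_lt_reg_r z) => //. have -> : x / z * z = x by field; lra. lra.
have q0 : 0 < x / z by apply: Rdiv_lt_0_compat.
(* Any ratio strictly between x / z and 1 would do. *)
pose lam := (1 + x / z) / 2.
pose eps := lam / (x / z) - 1.
have ep : 0 < eps.
  rewrite /eps. have : 1 < lam / (x / z); last lra.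
  apply: (Rmult_lt_reg_r (x / z)) => //.
  have -> : lam / (x / z) * (x / z) = lam by field; lra. rewrite /lam; lra.
have [m1 Hm1] := INR_unbounded (z ^ 2 / (4 * eps)).
have z2 : 0 <= z ^ 2 by exact: pow2_ge_0.
have step : forall m, (S (S m1) <= m)%nat -> e (S m) <= lam * e m.
  move=> [|[|m]] Hm; [lia|lia|].
  apply: Rle_trans (mode_size_ratio (S m) ltac:(lia)) _.
  apply: Rmult_le_compat_r; first by left; exact: mode_size_pos.
  have Hn : INR m1 <= INR (S m) by apply: le_INR; lia.
  have n0 : 1 <= INR (S m) by apply: (le_INR 1); lia.
  have T : z ^ 2 / (4 * INR (S m)) <= eps.
    apply: (Rmult_le_reg_r (INR (S m))); first lra.
    have -> : z ^ 2 / (4 * INR (S m)) * INR (S m) = eps * (z ^ 2 / (4 * eps)) by field; lra.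
    apply: Rmult_le_compat_l; lra.
  have -> : lam = x / z * (1 + eps) by rewrite /eps; field; lra.
  apply: Rmult_le_compat_l; lra.
have [C [HC HH]] := eventually_geometric e lam (S (S m1)) mode_size_pos ltac:(rewrite /lam; lra) step.
exists lam, C; split; last by split.
rewrite /lam; lra.
Qed.
End BesselConst.

(** * Source and collocation points in polar coordinates *)

Lemma circle_point_polar radius N k :
  circle_point radius N k = (radius * cos (node N k), radius * sin (node N k)).
Proof.
have E : (omega N ^ k)%C = (cos (node N k), sin (node N k)).
  elim: k => [|k IH].
    by rewrite /node /= Rmult_0_l cos_0 sin_0.
  have -> : (omega N ^ S k)%C = (omega N * omega N ^ k)%C by [].
  rewrite IH /omega /Cmult /= /node.
  have -> : INR (S k) * (2 * PI / INR N) = 2 * PI / INR N + INR k * (2 * PI / INR N) by rewrite S_INR; ring.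
  rewrite cos_plus sin_plus; congr pair. ring.
rewrite /circle_point E /Cmult /RtoC /=; congr pair; ring.
Qed.

Lemma dist_polar (r rho t u : R) :
  Cmod (Cminus (r * cos t, r * sin t) (rho * cos u, rho * sin u)) = sqrt (sqdist rho r (t - u)).
Proof.
rewrite /Cmod /Cminus /Cplus /Copp /= /sqdist cos_minus; congr sqrt.
have E1 := sin2_cos2 t. have E2 := sin2_cos2 u. rewrite /Rsqr in E1 E2.
transitivity (r ^ 2 * (sin t * sin t + cos t * cos t) + rho ^ 2 * (sin u * sin u + cos u * cos u)
  - 2 * r * rho * (cos t * cos u + sin t * sin u)); first by ring.
rewrite E1 E2; ring.
Qed.

Lemma mfs_polar alpha rho N Q r t : 0 < alpha -> (forall u, 0 < sqdist rho r u) ->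
  mfs_approx alpha rho N Q (r * cos t, r * sin t) =
  sumN (fun k => Q k * source alpha rho r (t - node N k)) N.
Proof.
move=> Ha HQ; rewrite /mfs_approx -/(sumN _ N). apply: sumN_ext => k _.
rewrite circle_point_polar dist_polar /source /radial K0_K_moment //.
apply: Rmult_lt_0_compat => //; exact: sqrt_lt_R0.
Qed.

(** At a point of the circle of radius [r], moving by h along the outward normal
means increasing the radius by h. *)
Lemma normal_derivative_polar (f : C -> R) (r t l l' : R) : 0 < r ->
  is_normal_derivative f (r * cos t, r * sin t) l ->
  is_derive (fun s => f (s * cos t, s * sin t)) r l' -> l = l'.
Proof.
move=> Hr Hn Hd.
have Sh : is_derive (fun h => h + r) 0 1 by auto_derive.
have Hd0 : is_derive (fun s => f (s * cos t, s * sin t)) (0 + r) l' by rewrite Rplus_0_l.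
have D : is_derive (fun h => f ((h + r) * cos t, (h + r) * sin t)) 0 (1 * l').
  exact: (is_derive_Rcomp (fun s => f (s * cos t, s * sin t)) (fun h => h + r) 0 l' 1 Hd0 Sh).
rewrite Rmult_1_l in D.
rewrite -(is_derive_unique _ _ _ D). symmetry. apply: is_derive_unique.
apply: is_derive_ext Hn => h. congr f. rewrite Cmod_polar; last lra.
rewrite /Cplus /Cmult /RtoC /=; congr pair; field; lra.
Qed.

Lemma polar_form (x : C) : 0 < Cmod x -> exists t, x = (Cmod x * cos t, Cmod x * sin t).
Proof.
case: x => u v Hx. set m := Cmod (u, v) in Hx *.
have E : m * m = u * u + v * v.
  rewrite /m /Cmod sqrt_sqrt /=; first by ring. nra.
have B : -1 <= u / m <= 1.
  have : (u / m) * (u / m) <= 1.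
    apply: (Rmult_le_reg_r (m * m)); first nra.
    have -> : u / m * (u / m) * (m * m) = u * u by field; lra. nra.
  nra.
have C1 : m * cos (acos (u / m)) = u by rewrite cos_acos //; field; lra.
have S1 : m * sin (acos (u / m)) = Rabs v.
  have U : 0 <= 1 - Rsqr (u / m) by rewrite /Rsqr; nra.
  rewrite sin_acos // -(sqrt_Rsqr_abs v).
  transitivity (sqrt (m * m * (1 - Rsqr (u / m)))).
    rewrite sqrt_mult ?sqrt_square //; nra.
  congr sqrt. rewrite /Rsqr.
  transitivity (m * m - u * u); first by field; lra.
  lra.
case: (Rle_dec 0 v) => Hv.
- exists (acos (u / m)). rewrite C1 S1 Rabs_pos_eq //.
- exists (- acos (u / m)). rewrite cos_neg sin_neg C1 Ropp_mult_distr_r_reverse S1 Rabs_left; last lra.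
  by rewrite Ropp_involutive.
Qed.

(** * The error estimate *)

(** Rotating the source to a node multiplies its modes by the values of the same
modes at that node, so the charges enter only through their discrete Fourier
transform. *)
Lemma superposition_series (f : R -> R) (c : nat -> R) (Q : nat -> R) N th :
  (forall m, fourier_coef true m f = c m) -> (forall m, fourier_coef false m f = 0) ->
  (forall t, is_series (fun m => fourier_term f m t) (f t)) ->
  is_series (fun m => mode_weight m * c m *
     (sumN (fun j => Q j * trig true m (node N j)) N * trig true m th +
      sumN (fun j => Q j * trig false m (node N j)) N * trig false m th))
    (sumN (fun j => Q j * f (th - node N j)) N).
Proof.
move=> Ht Hf Hs.
have S := sumN_series (fun j m => Q j * fourier_term f m (th - node N j)) (fun j => Q j * f (th - node N j)) N
  (fun j _ => is_series_Rscal (Q j) _ _ (Hs (th - node N j))).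
apply: (is_series_eq _ _ _ _ S) => // m.
have E : forall a b, a * sumN (fun j => Q j * trig true m (node N j)) N + b * sumN (fun j => Q j * trig false m (node N j)) N
  = sumN (fun j => a * (Q j * trig true m (node N j)) + b * (Q j * trig false m (node N j))) N.
  by move=> a b; rewrite sumN_plus !sumN_scal.
transitivity ((mode_weight m * c m * trig true m th) * sumN (fun j => Q j * trig true m (node N j)) N +
  (mode_weight m * c m * trig false m th) * sumN (fun j => Q j * trig false m (node N j)) N); last by ring.
rewrite E; apply: sumN_ext => j _.
have T : trig true m (th - node N j) = trig true m th * trig true m (node N j) + trig false m th * trig false m (node N j).
  rewrite /trig. have -> : INR m * (th - node N j) = INR m * th - INR m * node N j by ring.
  exact: cos_minus.
rewrite /fourier_term Ht Hf T; ring.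
Qed.

Lemma sumN_derive (F : nat -> R -> R) (l : nat -> R) N x :
  (forall j, is_derive (F j) x (l j)) -> is_derive (fun s => sumN (fun j => F j s) N) x (sumN l N).
Proof.
move=> H; elim: N => [|n IH].
  rewrite sumN_0; apply: (is_derive_ext (fun _ => 0)); first by move=> s; rewrite sumN_0.
  exact: is_derive_const.
rewrite sumN_S. apply: (is_derive_ext (fun s => sumN (fun j => F j s) n + F (S n) s)).
  by move=> s; rewrite sumN_S.
exact: is_derive_Rplus.
Qed.

Lemma closed_bound_at0 (E : R -> R) r B : 0 < r -> continuous E 0 ->
  (forall t, 0 < t < r -> Rabs (E t) <= B) -> Rabs (E 0) <= B.
Proof.
move=> Hr Hc HB. apply: Rnot_lt_le => Hlt.
have ep : 0 < Rabs (E 0) - B by lra.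
have [d Hd] := proj1 (filterlim_locally _ _) Hc (mkposreal _ ep).
have d0 := cond_pos d.
pose t := Rmin (d / 2) (r / 2).
have t0 : 0 < t by apply: Rmin_pos; lra.
have t1 := Rmin_l (d / 2) (r / 2). have t2 := Rmin_r (d / 2) (r / 2). rewrite -/t in t1 t2.
have := Hd t. rewrite /ball /= /AbsRing_ball /abs /= /minus /plus /opp /= Ropp_0 Rplus_0_r (Rabs_pos_eq t); last lra.
move=> /(_ ltac:(lra)) X. have Y := HB t ltac:(lra).
have Z := Rabs_triang_inv (E 0) (E t). rewrite Rabs_minus_sym in Z.
rewrite /Rminus in Z. lra.
Qed.

(** The constants come from the geometry alone: [lam] is the decay rate of the
source modes on the circle of radius [r], [sg] that of the modes of [g] there
(a square root of r / r1, the other half of the decay absorbing the factor m + 1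
from the normal derivative), and a^4 is the larger one.  The exponent
max (m, N - m) of [aliased_mode_error_bound] dominates (2 m + N) / 4, which leaves
a^N and a summable factor in [m]. *)
Lemma uniform_error (alpha r rho r0 : R) : 0 < alpha -> 0 < r -> r < rho -> r < r0 ->
  exists K a : R, 0 < K /\ 0 < a < 1 /\
  forall (s g : C -> R) (U : C -> Prop), open U -> (forall x : C, Cmod x <= r0 -> U x) ->
  helmholtz_solution alpha U g ->
  (forall x : C, Cmod x = r -> is_normal_derivative g x (s x)) ->
  forall N : nat, (1 <= N)%nat -> forall Q : nat -> R, collocation alpha r rho s N Q ->
  forall M : R, (forall x : C, Cmod x <= r0 -> Rabs (g x) <= M) ->
  forall x : C, Cmod x < r -> Rabs (g x - mfs_approx alpha rho N Q x) <= K * a ^ N * M.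
Proof.
move=> Ha Hr Hrho Hr0.
have rho0 : 0 < rho by lra.
pose x := alpha * r. have x0 : 0 < x by apply: Rmult_lt_0_compat.
have S := source_polar_solution alpha rho Ha rho0.
have [kk Hk] := polar_expansion alpha rho _ _ _ _ Ha S.
have Hk' : forall q, 0 < q < rho ->
  (forall b m, fourier_coef b m (source alpha rho q) = kk b m * BesselI m (alpha * q)) /\
  (forall b m, fourier_coef b m (source_r alpha rho q) = kk b m * (alpha * BesselI_d m (alpha * q))).
  by move=> q Hq; have [h1 [h2 _]] := Hk q Hq.
pose k m := kk true m.
have kpos : forall m, 0 < k m := source_coef_pos alpha rho Ha rho0 kk Hk'.
have krec : forall n, k (Datatypes.S (Datatypes.S n)) = k n + 2 * INR (Datatypes.S n) / (alpha * rho) * k (Datatypes.S n)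
  := source_coef_rec alpha rho Ha rho0 kk Hk'.
have ksin : forall m, kk false m = 0 := source_coef_sin alpha rho Ha rho0 kk Hk'.
have [lam [Ce [Hlam [HCe He]]]] := mode_size_geometric x x0 (alpha * rho) k ltac:(rewrite /x; nra) kpos krec.
have [Cu [HCu Hu]] := BesselI_d_lower x x0.
have Hd := BesselI_d_upper x x0. pose Cd := / x + x / 2. rewrite -/Cd in Hd.
have HCd : 0 < Cd by have := Rinv_0_lt_compat _ x0; rewrite /Cd; lra.
(* An intermediate circle, as the expansion holds on the open disk only. *)
pose r1 := (r + r0) / 2. have Hr1 : r < r1 < r0 by rewrite /r1; lra.
pose sg := sqrt (r / r1).
have q0 : 0 < r / r1 by apply: Rdiv_lt_0_compat; lra.
have q1 : r / r1 < 1.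
  apply: (Rmult_lt_reg_r r1); first lra. have -> : r / r1 * r1 = r by field; lra. lra.
have Hsg : 0 < sg < 1.
  split; first exact: sqrt_lt_R0. rewrite -sqrt_1; apply: sqrt_lt_1; lra.
have sg2 : sg * sg = r / r1 by apply: sqrt_sqrt; lra.
have [Cs [HCs Hs]] := linear_geometric sg Hsg.
pose mu := Rmax lam sg.
have Hmu : 0 < mu < 1 by split; [apply: Rlt_le_trans (Rmax_l _ _); lra|apply: Rmax_lub_lt; lra].
pose a := sqrt (sqrt mu).
have s0 : 0 < sqrt mu by apply: sqrt_lt_R0; lra.
have s1 : sqrt mu < 1 by rewrite -sqrt_1; apply: sqrt_lt_1; lra.
have Ha01 : 0 < a < 1.
  split; first exact: sqrt_lt_R0. rewrite -sqrt_1; apply: sqrt_lt_1; lra.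
have a4 : a ^ 4 = mu.
  have -> : a ^ 4 = (a * a) * (a * a) by ring. rewrite /a !sqrt_sqrt; lra.
pose d m := alpha * BesselI_d m x.
have dpos : forall m, 0 < d m by move=> m; apply: Rmult_lt_0_compat => //; exact: BesselI_d_pos.
pose K1 := 2 * Cd * Ce * Cu.
have HK1 : 0 <= K1 by rewrite /K1; apply: Rmult_le_pos; last lra; nra.
have ratio : forall n m, (n <= m)%nat -> mode_weight m * d m * k m <= K1 * mu ^ (m - n) * (mode_weight n * d n * k n).
  move=> n m Hnm.
  have Up : mode_weight m * d m * k m <= alpha * Cd * ((INR m + 1) * (k m * BesselI m x)).
    have W := mode_weight_bounds m. have D := Hd m. have kp := kpos m. have dp := dpos m.
    apply: (Rle_trans _ (d m * k m)).
      have := Rmult_lt_0_compat _ _ dp kp; nra.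
    have -> : alpha * Cd * ((INR m + 1) * (k m * BesselI m x)) = alpha * (Cd * ((INR m + 1) * BesselI m x)) * k m by ring.
    apply: Rmult_le_compat_r; first lra. apply: Rmult_le_compat_l; lra.
  have Lo : alpha * ((INR n + 1) * (k n * BesselI n x)) <= 2 * Cu * (mode_weight n * d n * k n).
    have kp := kpos n. have dp := dpos n.
    have W : / 2 <= mode_weight n by case: (n) => [|i] /=; lra.
    apply: (Rle_trans _ (Cu * (d n * k n))).
      have -> : alpha * ((INR n + 1) * (k n * BesselI n x)) = alpha * k n * ((INR n + 1) * BesselI n x) by ring.
      have -> : Cu * (d n * k n) = alpha * k n * (Cu * BesselI_d n x) by rewrite /d; ring.
      apply: Rmult_le_compat_l => //. left; exact: Rmult_lt_0_compat.
    have -> : 2 * Cu * (mode_weight n * d n * k n) = 2 * mode_weight n * (Cu * (d n * k n)) by ring.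
    have : 0 < Cu * (d n * k n) by apply: Rmult_lt_0_compat => //; exact: Rmult_lt_0_compat. nra.
  have E := He n m Hnm.
  have lm : lam ^ (m - n) <= mu ^ (m - n).
    apply: pow_incr; split; [lra|exact: Rmax_l].
  have en : 0 < (INR n + 1) * (k n * BesselI n x).
    apply: Rmult_lt_0_compat; first by have := pos_INR n; lra. apply: Rmult_lt_0_compat => //; exact: BesselI_pos.
  have lp : 0 < lam ^ (m - n) by apply: pow_lt; lra.
  apply: Rle_trans Up _.
  apply: (Rle_trans _ (alpha * Cd * (Ce * mu ^ (m - n) * ((INR n + 1) * (k n * BesselI n x))))).
    apply: Rmult_le_compat_l; first nra.
    apply: Rle_trans E _. apply: Rmult_le_compat_r; first lra. apply: Rmult_le_compat_l; lra.
  have -> : alpha * Cd * (Ce * mu ^ (m - n) * ((INR n + 1) * (k n * BesselI n x))) =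
    Cd * Ce * mu ^ (m - n) * (alpha * ((INR n + 1) * (k n * BesselI n x))) by ring.
  have -> : K1 * mu ^ (m - n) * (mode_weight n * d n * k n) = Cd * Ce * mu ^ (m - n) * (2 * Cu * (mode_weight n * d n * k n)) by rewrite /K1; ring.
  apply: Rmult_le_compat_l => //. apply: Rmult_le_pos; first nra. lra.
pose K3 := 2 * alpha * Cd * Cs.
have HK3 : 0 < K3 by rewrite /K3; repeat apply: Rmult_lt_0_compat; lra.
pose Kf := alias_const mu K1.
have HKf : 0 < Kf.
  have i0 : 0 < / (1 - mu) by apply: Rinv_0_lt_compat; lra.
  rewrite /Kf /alias_const; apply: Rmult_lt_0_compat => //. have := Rmult_le_pos _ _ HK1 (Rlt_le _ _ i0). rewrite /Rdiv; lra.
pose K4 := 2 * (Cu / alpha) * Kf * K3.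
have HK4 : 0 < K4.
  have : 0 < Cu / alpha by apply: Rdiv_lt_0_compat. move=> ?; do 3 (apply: Rmult_lt_0_compat => //); lra.
exists (K4 / (1 - a ^ 2)), a.
have a2 : 0 < a ^ 2 < 1 by split; [apply: pow_lt; lra|rewrite /=; nra].
split; first by apply: Rdiv_lt_0_compat; lra. split => //.
move=> s g U Uo HU Hg Hn N N1 Q Hc M HM.
have M0 : 0 <= M.
  have := HM (0, 0). have := Rabs_pos (g (0,0)). rewrite /Cmod /= !Rmult_0_l Rplus_0_l sqrt_0; lra.
have G := g_polar_solution alpha r0 g U ltac:(lra) Uo HU Hg.
have [A HA] := polar_expansion alpha r0 _ _ _ _ Ha G.
pose P b m := sumN (fun j => Q j * trig b m (node N j)) N.
have AB : forall b m, mode_weight m * d m * Rabs (A b m) <= K3 * M * mu ^ m.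
  move=> b m. have [h1 _] := HA r1 ltac:(lra).
  have B1 : Rabs (A b m) * BesselI m (alpha * r1) <= 2 * M.
    have P1 : 0 < BesselI m (alpha * r1) by apply: BesselI_pos; nra.
    rewrite -(Rabs_pos_eq (BesselI m (alpha * r1))); last lra. rewrite -Rabs_mult -h1.
    apply: fourier_coef_bound.
      move=> t _; apply: (polar_continuous _ _ _ _ _ _ G); lra.
    move=> t; rewrite /g_polar /curry_C; apply: HM. rewrite Cmod_polar; lra.
  have Gr : BesselI m x <= (sg * sg) ^ m * BesselI m (alpha * r1).
    rewrite sg2. have := BesselI_growth m x (alpha * r1) ltac:(rewrite /x; nra).
    have -> : x / (alpha * r1) = r / r1 by rewrite /x; field; lra. by [].
  have D := Hd m. have L := Hs m. have m0 := pos_INR m.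
  have sp : 0 < sg ^ m by apply: pow_lt; lra.
  have aA := Rabs_pos (A b m).
  have W := mode_weight_bounds m. have dp := dpos m.
  apply: (Rle_trans _ (d m * Rabs (A b m))).
    have := Rmult_le_pos _ _ (Rlt_le _ _ dp) aA; nra.
  apply: (Rle_trans _ (alpha * Cd * ((INR m + 1) * sg ^ m) * sg ^ m * (Rabs (A b m) * BesselI m (alpha * r1)))).
    have -> : alpha * Cd * ((INR m + 1) * sg ^ m) * sg ^ m * (Rabs (A b m) * BesselI m (alpha * r1)) =
      alpha * (Cd * ((INR m + 1) * ((sg * sg) ^ m * BesselI m (alpha * r1)))) * Rabs (A b m).
      rewrite Rpow_mult_distr; ring.
    apply: Rmult_le_compat_r => //. apply: Rmult_le_compat_l; first lra.
    apply: Rle_trans D _. apply: Rmult_le_compat_l; first lra. apply: Rmult_le_compat_l; lra.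
  have smu : sg ^ m <= mu ^ m by apply: pow_incr; split; [lra|exact: Rmax_r].
  have -> : K3 * M * mu ^ m = alpha * Cd * Cs * mu ^ m * (2 * M) by rewrite /K3; ring.
  have aC : 0 < alpha * Cd by exact: Rmult_lt_0_compat.
  have BIp : 0 < BesselI m (alpha * r1) by apply: BesselI_pos; nra.
  apply: Rmult_le_compat => //.
  - apply: Rmult_le_pos; last lra. apply: Rmult_le_pos; first lra. apply: Rmult_le_pos; lra.
  - apply: Rmult_le_pos => //; lra.
  - apply: Rmult_le_compat => //; try lra.
      apply: Rmult_le_pos; first lra. apply: Rmult_le_pos; lra.
    apply: Rmult_le_compat_l; lra.
have wser : forall q, 0 < q < rho -> forall th,
  is_series (fun m => mode_weight m * (k m * BesselI m (alpha * q)) * (P true m * trig true m th + P false m * trig false m th))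
   (sumN (fun j => Q j * source alpha rho q (th - node N j)) N) /\
  is_series (fun m => mode_weight m * (k m * (alpha * BesselI_d m (alpha * q))) * (P true m * trig true m th + P false m * trig false m th))
   (sumN (fun j => Q j * source_r alpha rho q (th - node N j)) N).
  move=> q Hq th. have [h1 [h2 [h3 h4]]] := Hk q Hq. split; apply: superposition_series => //.
  - move=> m; rewrite h1 ksin; ring.
  - move=> m; rewrite h2 ksin; ring.
have Qp : forall q u, 0 < q < rho -> 0 < sqdist rho q u by move=> q u; exact: sqdist_pos.
have colloc : forall j, (1 <= j <= N)%nat ->
  is_series (fun m => mode_weight m * d m * (A true m - k m * P true m) * trig true m (node N j) +
    mode_weight m * d m * (A false m - k m * P false m) * trig false m (node N j)) 0.
  move=> j Hj. have [_ [h2 [_ h4]]] := HA r ltac:(lra).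
  have [_ ws] := wser r ltac:(lra) (node N j).
  (* Both sides of the collocation equation are radial derivatives at the node. *)
  have Eg : s (circle_point r N j) = g_polar_r g r (node N j).
    apply: (normal_derivative_polar g r (node N j)) => //.
      rewrite circle_point_polar; apply: Hn. rewrite Cmod_polar; lra.
    apply: (ps_r _ _ _ _ _ _ G); lra.
  have Ew : s (circle_point r N j) = sumN (fun i => Q i * source_r alpha rho r (node N j - node N i)) N.
    apply: (normal_derivative_polar (mfs_approx alpha rho N Q) r (node N j)) => //.
      have := Hc j Hj. by rewrite circle_point_polar.
    apply: (is_derive_ext_loc (fun q => sumN (fun i => Q i * source alpha rho q (node N j - node N i)) N)).
      apply: (interval_locally 0 rho) => // q Hq. rewrite mfs_polar //. move=> u; exact: Qp.
    apply: sumN_derive => i.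
    apply: is_derive_scal. apply: (ps_r _ _ _ _ _ _ S); lra.
  apply: (is_series_eq _ _ _ _ (is_series_Rminus _ _ _ _ (h4 (node N j)) ws)); last by rewrite -Eg -Ew; ring.
  move=> m; rewrite /fourier_term !h2 -/x /d; ring.
have DB := aliased_mode_error_bound d k mu K1 Hmu HK1 dpos kpos ratio N Q A (K3 * M) N1 AB colloc.
have main : forall q th, 0 < q < r ->
  Rabs (g (q * cos th, q * sin th) - mfs_approx alpha rho N Q (q * cos th, q * sin th)) <= K4 / (1 - a ^ 2) * a ^ N * M.
  move=> q th Hq. have [h1 [_ [h3 _]]] := HA q ltac:(lra).
  have [ws _] := wser q ltac:(lra) th.
  have Sr := is_series_Rminus _ _ _ _ (h3 th) ws.
  rewrite mfs_polar //; last by move=> u; apply: Qp; lra.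
  have -> : K4 / (1 - a ^ 2) * a ^ N * M = K4 * M * a ^ N * (a ^ 2) ^ 0 / (1 - a ^ 2) by rewrite /=; field; rewrite /= in a2; lra.
  have aN : 0 < a ^ N by apply: pow_lt; lra.
  apply: (geom_tail_bound _ _ _ _ _ _ a2 Sr).
  - apply: Rmult_le_pos; last lra. apply: Rmult_le_pos; lra.
  - move=> m; lia.
  - move=> m _.
    have B1 := DB true m th. have B2 := DB false m th. rewrite -/Kf in B1 B2.
    have BIq : 0 < BesselI m (alpha * q) by apply: BesselI_pos; nra.
    have Bd : BesselI m (alpha * q) / d m <= Cu / alpha.
      have Bx : BesselI m (alpha * q) <= BesselI m x by apply: BesselI_mono; rewrite /x; nra.
      have L := Hu m. have m0 := pos_INR m. have Dp := BesselI_d_pos x x0 m.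
      apply: (Rmult_le_reg_r (d m)); first exact: dpos.
      have -> : BesselI m (alpha * q) / d m * d m = BesselI m (alpha * q) by field; apply: Rgt_not_eq; exact: dpos.
      have -> : Cu / alpha * d m = Cu * BesselI_d m x by rewrite /d; field; lra.
      have : BesselI m x <= (INR m + 1) * BesselI m x by have := BesselI_pos m x x0; nra.
      lra.
    have pw : mu ^ Nat.max m (N - m) <= a ^ N * (a ^ 2) ^ m.
      rewrite -a4 -!pow_mult -pow_add.
      have -> : (4 * Nat.max m (N - m))%nat = ((N + 2 * m) + (4 * Nat.max m (N - m) - (N + 2 * m)))%nat by lia.
      set i := (4 * Nat.max m (N - m) - (N + 2 * m))%nat.
      have ai : a ^ i <= 1 by rewrite -(pow1 i); apply: pow_incr; lra.
      have ap : 0 < a ^ (N + 2 * m) by apply: pow_lt; lra.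
      rewrite (pow_add _ _ i); nra.
    rewrite /fourier_term !h1.
    have dm := dpos m.
    have -> : mode_weight m * (A true m * BesselI m (alpha * q) * trig true m th + A false m * BesselI m (alpha * q) * trig false m th) -
      mode_weight m * (k m * BesselI m (alpha * q)) * (P true m * trig true m th + P false m * trig false m th) =
      BesselI m (alpha * q) / d m * (mode_weight m * d m * (A true m - k m * P true m) * trig true m th +
        mode_weight m * d m * (A false m - k m * P false m) * trig false m th) by field; lra.
    rewrite Rabs_mult Rabs_pos_eq; last by left; apply: Rdiv_lt_0_compat.
    have MK : 0 <= Kf * (K3 * M) by apply: Rmult_le_pos; [lra|apply: Rmult_le_pos; lra].
    apply: (Rle_trans _ (Cu / alpha * (2 * (Kf * (K3 * M) * (a ^ N * (a ^ 2) ^ m))))).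
      apply: Rmult_le_compat => //; [by left; apply: Rdiv_lt_0_compat|exact: Rabs_pos|].
      apply: Rle_trans (Rabs_triang _ _) _.
      apply: Rle_trans (Rplus_le_compat _ _ _ _ B1 B2) _.
      have := Rmult_le_compat_l _ _ _ MK pw. lra.
    right; rewrite /K4; ring.
move=> y Hy. case: (Req_dec (Cmod y) 0) => Hy0; last first.
  have [th E] := polar_form y ltac:(have := Cmod_ge_0 y; lra).
  rewrite E; apply: main. have := Cmod_ge_0 y; lra.
have -> : y = (0 * cos 0, 0 * sin 0) by rewrite (Cmod_eq_0 _ Hy0) !Rmult_0_l.
(* The centre has no polar angle; the bound extends to it by continuity. *)
have Q0 : forall u, 0 < sqdist rho 0 u.
  move=> u; rewrite /sqdist. have -> : 0 ^ 2 + rho ^ 2 - 2 * 0 * rho * cos u = rho ^ 2 by ring. exact: pow_lt.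
rewrite mfs_polar //.
apply: (closed_bound_at0 (fun q => g (q * cos 0, q * sin 0) - sumN (fun j => Q j * source alpha rho q (0 - node N j)) N) r) => //.
- apply: (@continuous_minus _ R_AbsRing R_NormedModule).
  + have U0 : U (0, 0) by apply: HU; rewrite /Cmod /= !Rmult_0_l Rplus_0_l sqrt_0; lra.
    have R0 := g_regular alpha g U Hg 0 0 U0.
    apply: (continuous_ext (fun z => curry_C g z 0)).
      move=> z; by rewrite /curry_C cos_0 sin_0 Rmult_1_r Rmult_0_r.
    apply: is_derive_continuous; apply R0.
  + apply: ex_derive_continuous_R; eexists; apply: sumN_derive => j. apply: is_derive_scal.
    apply: (is_derive_Rcomp (radial alpha) (fun q => sqdist rho q (0 - node N j))); last exact: sqdist_dr.
    exact: radial_derive.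
- move=> t Ht. rewrite -(mfs_polar alpha rho N Q t 0) //; first exact: main.
  move=> u; apply: Qp; lra.
Qed.

Theorem theorem2p5 (alpha r rho r0 : R) :
  0 < alpha -> 0 < r -> r < rho ->
  rho > sqrt (4 * alpha ^ 2 * r ^ 2 + 6
              - 2 * sqrt (4 * alpha ^ 2 * r ^ 2 + 9)) / alpha ->
  r0 > r ->
  exists C1 a : R, 0 < C1 /\ 0 < a < 1 /\
    forall (s g : C -> R) (U : C -> Prop),
      open U ->
      (forall x : C, Cmod x <= r0 -> U x) ->
      helmholtz_solution alpha U g ->
      (forall x : C, Cmod x = r -> is_normal_derivative g x (s x)) ->
      forall N : nat, (1 <= N)%nat ->
      forall Q : nat -> R, collocation alpha r rho s N Q ->
        Rbar_le
          (sup_norm (fun x => Cmod x < r)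
             (fun x => g x - mfs_approx alpha rho N Q x))
          (Rbar_mult (C1 * INR N ^ 2 * a ^ N)
             (sup_norm (fun x => Cmod x <= r0) g)).
Proof.
move=> Ha Hr Hrho _ Hr0.
have [C1 [a [HC [Ha1 H]]]] := uniform_error alpha r rho r0 Ha Hr Hrho Hr0.
exists C1, a; split => //; split => //.
move=> s g U Uo HU Hg Hn N N1 Q Hc.
have {}H := H s g U Uo HU Hg Hn N N1 Q Hc.
have n1 : 1 <= INR N by apply: (le_INR 1).
have aN : 0 < a ^ N by apply: pow_lt; lra.
have N2 : 1 <= INR N ^ 2 by rewrite /=; nra.
have cpos : 0 < C1 * INR N ^ 2 * a ^ N by apply: Rmult_lt_0_compat => //; nra.
have [ub _] := Lub_Rbar_correct (fun v => exists x : C, Cmod x <= r0 /\ v = Rabs (g x)).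
rewrite {2}/sup_norm. case: (Lub_Rbar _) ub => [M| |] ub.
- have HM : forall x : C, Cmod x <= r0 -> Rabs (g x) <= M.
    move=> x Hx. by apply: (ub (Rabs (g x))); exists x.
  have M0 : 0 <= M.
    have := HM (0, 0). have := Rabs_pos (g (0,0)). rewrite /Cmod /= !Rmult_0_l Rplus_0_l sqrt_0; lra.
  have [_ lub] := Lub_Rbar_correct (fun v => exists x : C, Cmod x < r /\ v = Rabs (g x - mfs_approx alpha rho N Q x)).
  apply: lub => _ [x [Hx ->]]. have X := H M HM x Hx. rewrite /=.
  apply: Rle_trans X _. apply: Rmult_le_compat_r => //.
  apply: Rmult_le_compat_r; first lra. rewrite /= in N2 |- *. nra.
- have -> : Rbar_mult (C1 * INR N ^ 2 * a ^ N) p_infty = p_infty.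
    apply: is_Rbar_mult_unique. apply: is_Rbar_mult_sym; exact: is_Rbar_mult_p_infty_pos.
  by case: (sup_norm _ _).
- exfalso. have : Rbar_le (Rabs (g 0%C)) m_infty; last by [].
  apply: ub. exists 0%C; split => //. rewrite Cmod_0; lra.
Qed.
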